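(* Let $f\in L^1$ be a first-order Haar chaos. The following conditions are equivalent: (a) there is $p\in(1,2]$ such that $f\in L^p$ and the system of dilations and translations $\{f_n\}_{n\ge1}$ of $f$ is a basis of $L^p_0$ equivalent to the Haar system; (b) $f\in L^2$ and for every $p\in(1,2]$ the system $\{f_n\}_{n\ge1}$ is a basis of $L^p_0$ equivalent to the Haar system.
   Context: All functions are complex-valued on $I=(0,1]$; $L^p_0$ is the closed subspace of mean-zero functions in $L^p(0,1)$. Let $h=\chi_{(0,1/2]}-\chi_{(1/2,1]}$. For $n=2^k+j$ with $k\ge0$, $0\le j\le 2^k-1$, $h_n(t)=h(2^kt-j)$ for $t\in(j2^{-k},(j+1)2^{-k}]$ and $0$ otherwise. For mean-zero $f\in L^1$, the system of dilations and translations is $f_n(t)=f(2^kt-j)$ on $(j2^{-k},(j+1)2^{-k}]$, $0$ otherwise. A first-order Haar chaos is a function $f=\sum_{k\ge0}c_kh_{2^k}$, $c_k\in\mathbb C$ (a finite sum at each point). A sequence $\{f_n\}$ is a basis of $L^p_0$ equivalent to $\{h_n\}$ if there is a linear isomorphism of $L^p_0$ onto itself mapping $h_n$ to $f_n$ for all $n\ge1$. *)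

(* Defs.v *)
From HB Require Import structures.
From mathcomp Require Import all_boot all_order all_algebra.
From mathcomp Require Import complex.
From mathcomp Require Import all_classical all_reals all_analysis.
Set Implicit Arguments. Unset Strict Implicit. Unset Printing Implicit Defensive.
Import Order.TTheory GRing.Theory Num.Theory.
Local Open Scope classical_set_scope.
Local Open Scope ring_scope.

Section Defs.
Variable R : realType.

Definition Iset : set R := `]0, 1]%classic.

Definition mu := (@lebesgue_measure R).

Definition cabs (z : R[i]) : R := Normc.normc z.

Definition haar0 (t : R) : R[i] :=
  if (0 < t) && (t <= 2^-1) then 1
  else if (2^-1 < t) && (t <= 1) then -1 else 0.

Definition hk (n : nat) : nat := trunc_log 2 n.
Definition hj (n : nat) : nat := (n - 2 ^ hk n)%N.

Definition dil (g : R -> R[i]) (n : nat) (t : R) : R[i] :=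
  let s := (2 ^+ hk n) * t - (hj n)%:R in
  if (0 < s) && (s <= 1) then g s else 0.

Definition haar (n : nat) : R -> R[i] := dil haar0 n.

(* f is a first-order Haar chaos: f = sum_k c_k h_(2^k) on I, a finite sum at each point *)
Definition first_order_haar_chaos (f : R -> R[i]) : Prop :=
  exists c : nat -> R[i], forall t, Iset t ->
    exists N : nat, forall M : nat, (N <= M)%N ->
      f t = \sum_(k < M) c k * haar (2 ^ k) t.

Definition inLp (p : R) (f : R -> R[i]) : Prop :=
  [/\ measurable_fun Iset (fun x => complex.Re (f x)),
      measurable_fun Iset (fun x => complex.Im (f x)) &
      (\int[mu]_(x in Iset) ((cabs (f x)) `^ p)%:E < +oo)%E].

Definition Lpnorm (p : R) (f : R -> R[i]) : R :=
  (fine (\int[mu]_(x in Iset) ((cabs (f x)) `^ p)%:E)) `^ p^-1.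

Definition inLp0 (p : R) (f : R -> R[i]) : Prop :=
  [/\ inLp p f,
      (\int[mu]_(x in Iset) (complex.Re (f x))%:E = 0)%E &
      (\int[mu]_(x in Iset) (complex.Im (f x))%:E = 0)%E].

Definition aeq (f g : R -> R[i]) : Prop :=
  {ae mu, forall x, Iset x -> f x = g x}.

(* {g_n}_{n>=1} is a basis of L^p_0 equivalent to the Haar system: there is a
   linear isomorphism (bounded, bounded below, onto) T of L^p_0 onto itself,
   acting on representatives compatibly with a.e. equality, with T h_n = g_n. *)
Definition equiv_haar (p : R) (g : nat -> R -> R[i]) : Prop :=
  exists (T : (R -> R[i]) -> (R -> R[i])) (C : R),
  [/\ 0 < C,
      (forall u, inLp0 p u -> inLp0 p (T u)),
      (forall u v, inLp0 p u -> inLp0 p v -> aeq u v -> aeq (T u) (T v)) &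
   [/\
      (forall (a b : R[i]) u v, inLp0 p u -> inLp0 p v ->
          aeq (T (fun x => a * u x + b * v x)) (fun x => a * T u x + b * T v x)),
      (forall u, inLp0 p u ->
          Lpnorm p (T u) <= C * Lpnorm p u /\ Lpnorm p u <= C * Lpnorm p (T u)),
      (forall v, inLp0 p v -> exists u, inLp0 p u /\ aeq (T u) v) &
      (forall n : nat, (0 < n)%N -> aeq (T (haar n)) (g n))]].

End Defs.

(* Main.v *)
Require Import Defs.
From HB Require Import structures.
From mathcomp Require Import all_boot all_order all_algebra.
From mathcomp Require Import complex.
From mathcomp Require Import all_classical all_reals all_analysis.
From mathcomp Require Import measurable_realfun.
From mathcomp Require Import ring lra zify.
Import Order.TTheory GRing.Theory Num.Theory.
Local Open Scope ring_scope.
Set Implicit Arguments.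
Unset Strict Implicit.
Import numFieldNormedType.Exports.

(* Index the dyadic intervals as in a binary heap, so that [I_n] has halves
   [I_(2n)] and [I_(2n+1)]. If [f = \sum_i c_i h_(2^i)] then
   [f_n = \sum_i c_i h_(2^i n)]: on Haar coefficients, [h_n |-> f_n] acts along
   each chain [n, 2n, 4n, ...] ([n] odd) as multiplication by the power series
   [\sum_i c_i z^i]. Hence the system is equivalent to the Haar system in [L^p_0]
   iff this multiplier and that of the inverse power series are bounded on Haar
   sums in [L^p], and this boundedness does not depend on [p] in [(1, 2]]:

   From [L^p] to [L^2]: put copies of a finite chain, with random signs, at every
   node of the levels [0, L, 2L, ..., (K - 1) L]. By Khinchine's inequality the
   [L^p] norms are those of the square functions, which are sums of [K] independent
   terms; by the law of large numbers these are of order [K] as [K] grows, which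
   yields the [L^2] bound on the chain. As chains are orthogonal in [L^2], that
   is the [L^2] bound of the multiplier.

   From [L^2] to [L^q]: stop a Haar sum when its maximal function exceeds [lam].
   The multiplier commutes with this before the stopping time, so the [L^2] bound
   gives a weak type estimate at every level [lam], and summing over the levels
   [lam = r 2^k] and using Doob's maximal inequality gives the [L^q] bound.

   The [L^2] bound applied to [h_1] and Fatou's lemma give [f \in L^2]. *)

(** The obstacle in passing from L^p to L^2 is that a copy of a chain never ends: on its leftmost
    path the value changes at every level, so copies started at different levels are not
    independent. Only the paths that leave the chain within [La] steps are kept, since their value
    depends on [La] binary digits alone; this bounds [vmass], the energy of the chain on these
    paths, uniformly in [La]. What is still on the chain after N steps carries the energy 2^-N
    |S_N|^2, with S_N the partial sum of the coefficients. The L^p bound, tested on the single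
    leftmost interval, gives |S_N| = O(2^(N/p)), so 2^-N |S_N| tends to 0 because p > 1; each drop
    of this quantity is controlled by [vmass], and summing the drops from N on bounds the lost
    energy too.

    The inequalities are proved for finite averages over the tree, uniformly in its depth, where no
    question of convergence arises. Integrals enter only afterwards: cutting a function at level M
    is a conditional expectation, which contracts the L^p norm, and with the density of Haar sums
    this transfers uniform bounds to L^p_0 and back. *)

Section Scalars.
Variable R : realType.
Implicit Types (p q x y m r : R) (z w : R[i]).

(** * The modulus of complex numbers *)

Lemma cabs_ge0 z : 0 <= cabs z.
Proof. by case: z => a b; rewrite /cabs /= sqrtr_ge0. Qed.

Lemma cabs0 : cabs (0 : R[i]) = 0. Proof. exact: Normc.normc0. Qed.

Lemma cabsD z w : cabs (z + w) <= cabs z + cabs w.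
Proof. exact: le_normcD. Qed.

Lemma cabsN z : cabs (- z) = cabs z. Proof. exact: normcN. Qed.

Lemma cabsB z w : cabs (z - w) <= cabs z + cabs w.
Proof. by rewrite -[X in _ <= _ + X]cabsN cabsD. Qed.

Lemma cabsM z w : cabs (z * w) = cabs z * cabs w.
Proof. exact: Normc.normcM. Qed.

Lemma cabs_eq0 z : cabs z = 0 -> z = 0. Proof. exact: Normc.eq0_normc. Qed.

Lemma cabs_sqr z : cabs z ^+ 2 = complex.Re z ^+ 2 + complex.Im z ^+ 2.
Proof. by case: z => a b; rewrite /cabs /= sqr_sqrtr// addr_ge0 ?sqr_ge0. Qed.

Lemma cabs_Re z : `|complex.Re z| <= cabs z.
Proof.
by rewrite -ler_sqr ?nnegrE ?cabs_ge0// cabs_sqr real_normK ?num_real// lerDl sqr_ge0.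
Qed.

Lemma cabs_Im z : `|complex.Im z| <= cabs z.
Proof.
by rewrite -ler_sqr ?nnegrE ?cabs_ge0// cabs_sqr real_normK ?num_real// lerDr sqr_ge0.
Qed.

Lemma cReD z w : complex.Re (z + w) = complex.Re z + complex.Re w.
Proof. by case: z w => [? ?] [? ?]. Qed.

Lemma cImD z w : complex.Im (z + w) = complex.Im z + complex.Im w.
Proof. by case: z w => [? ?] [? ?]. Qed.

Lemma cReN z : complex.Re (- z) = - complex.Re z. Proof. by case: z. Qed.

Lemma cImN z : complex.Im (- z) = - complex.Im z. Proof. by case: z. Qed.

Lemma cReM z w : complex.Re (z * w) =
  complex.Re z * complex.Re w - complex.Im z * complex.Im w.
Proof. by case: z w => [? ?] [? ?]. Qed.

Lemma cImM z w : complex.Im (z * w) =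
  complex.Re z * complex.Im w + complex.Im z * complex.Re w.
Proof. by case: z w => [? ?] [? ?]. Qed.

Lemma cabs_parallelogram z w :
  cabs (z + w) ^+ 2 + cabs (z - w) ^+ 2 = 2 * (cabs z ^+ 2 + cabs w ^+ 2).
Proof. by rewrite !cabs_sqr !cReD !cImD cReN cImN; ring. Qed.

(** The two sides differ by 8 times the square of the determinant of [z] and [w] as plane vectors.
    The coefficient 6 leads to the constant 3 in [rad4]. *)
Lemma cabs_parallelogram4 z w : cabs (z + w) ^+ 4 + cabs (z - w) ^+ 4 <=
  2 * (cabs z ^+ 4 + 6 * cabs z ^+ 2 * cabs w ^+ 2 + cabs w ^+ 4).
Proof.
rewrite !(exprM _ 2 2) !cabs_sqr !cReD !cImD cReN cImN.
move: (complex.Re z) (complex.Im z) (complex.Re w) (complex.Im w) => a b c d.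
rewrite -subr_ge0.
have -> : 2 * ((a ^+ 2 + b ^+ 2) ^+ 2 + 6 * (a ^+ 2 + b ^+ 2) * (c ^+ 2 + d ^+ 2) +
   (c ^+ 2 + d ^+ 2) ^+ 2) - (((a + c) ^+ 2 + (b + d) ^+ 2) ^+ 2 +
   ((a - c) ^+ 2 + (b - d) ^+ 2) ^+ 2) = 8 * (a * d - b * c) ^+ 2 by ring.
by rewrite mulr_ge0// sqr_ge0.
Qed.

(** * Inequalities for real powers *)

(** By convexity the tangent at [m] stays below the graph of x^p. This minorant, affine in [x], is
    what the inequalities of Jensen and Doob are derived from. *)
Lemma young_tangent p x m : 1 < p -> 0 <= x -> 0 <= m ->
  p * m `^ (p - 1) * x <= x `^ p + (p - 1) * m `^ p.
Proof.
move=> p1 x0 m0; have p0 : 0 < p by lra.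
have q0 : 0 < p / (p - 1) by rewrite divr_gt0//; lra.
have := @conjugate_powR _ x (m `^ (p - 1)) p (p / (p - 1)) x0 (powR_ge0 _ _) p0 q0.
rewrite -powRrM.
have -> : (p - 1) * (p / (p - 1)) = p by field; lra.
have H : p^-1 + (p / (p - 1))^-1 = 1 by field; lra.
move=> /(_ H) /(ler_wpM2l (ltW p0)).
have -> : p * (x `^ p / p + m `^ p / (p / (p - 1))) = x `^ p + (p - 1) * m `^ p.
  by field; lra.
by rewrite -(mulrA p) (mulrC (_ `^ _)).
Qed.

Lemma powRDle p x y : 0 <= p -> 0 <= x -> 0 <= y ->
  (x + y) `^ p <= 2 `^ p * (x `^ p + y `^ p).
Proof.
move=> p0; wlog xy : x y / x <= y => [H x0 y0|x0 y0].
  have [/H|/ltW/H] := lerP x y; first exact.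
  by rewrite addrC [X in _ <= _ * X]addrC; apply.
apply: (@le_trans _ _ ((2 * y) `^ p)).
  by apply: ge0_ler_powR; rewrite ?nnegrE ?addr_ge0 ?mulr_ge0//; lra.
by rewrite powRM// ler_wpM2l ?powR_ge0// lerDr powR_ge0.
Qed.

(** A quadratic minorant turns a first moment and a bound on the second one into a lower bound for a
    fractional moment; both [khinchine] and [blocksum_powR_ge] rest on it, after rescaling. *)
Lemma powR_quad q y : 2^-1 <= q -> q <= 1 -> 0 <= y -> y - y ^+ 2 / 2 <= y `^ q.
Proof.
move=> q0 q1 y0; have [->|yn0] := eqVneq y 0.
  by rewrite powR0; [lra|apply: lt0r_neq0; lra].
have y0' : 0 < y by rewrite lt0r yn0.
have [y1|/ltW y1] := lerP y 1.
  have : y `^ 1 <= y `^ q by apply: ger_powR => //; rewrite y0'.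
  by rewrite powRr1//; have := sqr_ge0 y; lra.
have : y `^ 0 <= y `^ q by apply: ler_powR => //; lra.
by rewrite powRr0; have := sqr_ge0 (y - 1); rewrite sqrrB; lra.
Qed.

Lemma powR_rescale q s y : 2^-1 <= q -> q <= 1 -> 0 < s -> 0 <= y ->
  s `^ q * (y / s - (y / s) ^+ 2 / 2) <= y `^ q.
Proof.
move=> q0 q1 s0 y0.
have {3}-> : y = s * (y / s) by rewrite mulrC divfK// gt_eqF.
have ys : 0 <= y / s by rewrite divr_ge0// ltW.
by rewrite powRM ?(ltW s0)// ler_wpM2l ?powR_ge0// powR_quad.
Qed.

(** The terms at least double, so the last one below A^p controls the sum. Subtracting r^p on the
    right is what closes the induction that replaces [r] by [r * 2]. *)
Lemma sum_grid_lt p (A r : R) n : 1 <= p -> 0 < r ->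
  \sum_(k < n) (r * 2 ^+ k) `^ p * (r * 2 ^+ k < A)%R%:R <=
  (r < A)%R%:R * (2 * A `^ p - r `^ p).
Proof.
move=> p1; elim: n r => [|n IH] r r0.
  rewrite big_ord0; case: (ltP r A) => rA; rewrite ?mul0r// mul1r.
  have := @ge0_ler_powR R p _ r A.
  rewrite !nnegrE => /(_ _ _ _ (ltW rA)) H.
  have := powR_ge0 A p; have : r `^ p <= A `^ p by apply: H; lra.
  lra.
rewrite big_ord_recl expr0 mulr1.
have -> : \sum_(i < n) (r * 2 ^+ bump 0 i) `^ p * (r * 2 ^+ bump 0 i < A)%R%:R =
   \sum_(i < n) ((r * 2) * 2 ^+ i) `^ p * ((r * 2) * 2 ^+ i < A)%R%:R.
  by apply: eq_bigr => i _; rewrite /bump /= add1n exprS mulrA.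
have r20 : 0 < r * 2 by lra.
have := IH _ r20.
case: (ltP r A) => rA; last first.
  have -> : (r * 2 < A) = false by apply/negbTE; rewrite -leNgt; lra.
  by rewrite mulr0 add0r !mul0r.
rewrite mulr1 mul1r.
have rp : 2 * r `^ p <= (r * 2) `^ p.
  rewrite powRM ?(ltW r0)// mulrC ler_wpM2l ?powR_ge0//.
  by rewrite le1r_powR// ler1n.
have rA' : r `^ p <= A `^ p by apply: ge0_ler_powR; rewrite ?nnegrE; lra.
by case: (ltP (r * 2) A) => rA2; rewrite ?mul1r ?mul0r; lra.
Qed.

(** A geometric series of ratio 2^-d, whose sum is the constant; its first nonzero term sits at a
    grid point not below [r] nor below [A]. *)
Lemma sum_grid_ge d (A r : R) n : 0 < d -> 0 < r ->
  \sum_(k < n) (r * 2 ^+ k) `^ (- d) * (A <= r * 2 ^+ k)%R%:R <=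
  (1 - 2 `^ (- d))^-1 * (Num.max r A) `^ (- d).
Proof.
move=> d0; set k0 := (_)^-1.
have t1 : 2 `^ (- d) < 1 :> R.
  have := @gt0_ltr_powR R d d0 1 2; rewrite !nnegrE powR1 powRN => /(_ _ _ _) H.
  by rewrite invf_lt1 ?powR_gt0//; apply: H; lra.
have k00 : 0 < k0 by rewrite invr_gt0; lra.
have k0E : 1 + k0 * 2 `^ (- d) = k0 by rewrite /k0; field; lra.
elim: n r => [|n IH] r r0.
  by rewrite big_ord0 mulr_ge0 ?powR_ge0// ltW.
rewrite big_ord_recl expr0 mulr1.
have -> : \sum_(i < n) (r * 2 ^+ bump 0 i) `^ (- d) * (A <= r * 2 ^+ bump 0 i)%R%:R =
   \sum_(i < n) ((r * 2) * 2 ^+ i) `^ (- d) * (A <= (r * 2) * 2 ^+ i)%R%:R.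
  by apply: eq_bigr => i _; rewrite /bump /= add1n exprS mulrA.
have r20 : 0 < r * 2 by lra.
have := IH _ r20.
case: (leP A r) => rA.
  have -> : Num.max (r * 2) A = r * 2 by apply/max_idPl; lra.
  rewrite mulr1 powRM ?(ltW r0)// => H.
  rewrite -[X in _ <= X * _]k0E mulrDl mul1r lerD2l (le_trans H)//.
  by rewrite mulrAC mulrA.
rewrite mulr0 add0r => /le_trans; apply.
rewrite ler_wpM2l ?(ltW k00)// !powRN lef_pV2 ?posrE ?powR_gt0//; try lra.
  by apply: ge0_ler_powR; rewrite ?nnegrE ?le_max ?lexx ?orbT ?(ltW d0)//; lra.
by rewrite lt_max r20.
Qed.

(** If x lies in (lam, 2 lam] with lam = r 2^k, the term of index k alone pays for x^p; the term r^p
    covers x <= r. *)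
Lemma powR_layer_cake p x r n : 0 <= p -> 0 < r -> 0 <= x -> x <= r * 2 ^+ n ->
  x `^ p <= r `^ p + \sum_(k < n) (2 * (r * 2 ^+ k)) `^ p * (r * 2 ^+ k < x)%R%:R.
Proof.
move=> p0 r0 x0; elim: n => [|n IH] xn.
  rewrite big_ord0 addr0 ge0_ler_powR ?nnegrE//; first exact: ltW.
  by move: xn; rewrite expr0 mulr1.
rewrite big_ord_recr /= addrA.
have [xr|xr] := leP x (r * 2 ^+ n); first by rewrite mulr0 addr0 IH.
rewrite mulr1 ler_wpDl//.
  rewrite addr_ge0 ?powR_ge0// sumr_ge0// => i _.
  by rewrite mulr_ge0 ?powR_ge0// ler0n.
have rn : 0 < r * 2 ^+ n by rewrite mulr_gt0// exprn_gt0.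
rewrite ge0_ler_powR ?nnegrE//; first by rewrite mulr_ge0// ltW.
by move: xn; rewrite exprS; nra.
Qed.

End Scalars.

(** * Haar sums on the dyadic tree *)

Section Tree.
Variable R : realType.
Implicit Types (X Y : nat -> R) (a b c x y : nat -> R[i]) (M k n l : nat).

(* Dyadic intervals are indexed as in a binary heap: the halves of [I_n] are
   [I_(2n)] and [I_(2n+1)]. [Ex M X n] is the mean over the [2^M] intervals
   lying [M] levels below [I_n]. *)
Definition avg2 X n : R := (X n.*2 + X n.*2.+1) / 2.

Definition Ex M X : nat -> R := iter M avg2 X.

Lemma Ex0 X n : Ex 0 X n = X n. Proof. by []. Qed.

Lemma ExS M X n : Ex M.+1 X n = avg2 (Ex M X) n. Proof. by []. Qed.

Lemma ExSr M X n : Ex M.+1 X n = Ex M (avg2 X) n.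
Proof. by rewrite /Ex iterSr. Qed.

Lemma Ex_add M N X n : Ex (M + N) X n = Ex M (Ex N X) n.
Proof. by rewrite /Ex iterD. Qed.

Lemma Ex_le M X Y n : (forall l, (l %/ 2 ^ M = n)%N -> X l <= Y l) ->
  Ex M X n <= Ex M Y n.
Proof.
elim: M n => [|M IH] n XY; first by apply: XY; rewrite expn0 divn1.
rewrite !ExS /avg2 ler_wpM2r ?invr_ge0// lerD// IH// => l ln; apply: XY;
  rewrite expnSr divnMA ln; lia.
Qed.

Lemma Ex_eq M X Y n : (forall l, (l %/ 2 ^ M = n)%N -> X l = Y l) ->
  Ex M X n = Ex M Y n.
Proof.
by move=> XY; apply/eqP; rewrite eq_le !Ex_le// => l /XY ->.
Qed.

Lemma Ex_cst M (r : R) n : Ex M (fun=> r) n = r.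
Proof. by elim: M n => [//|M IH] n; rewrite ExS /avg2 !IH; field. Qed.

Lemma ExD M X Y n : Ex M (fun l => X l + Y l) n = Ex M X n + Ex M Y n.
Proof. by elim: M n => [//|M IH] n; rewrite !ExS /avg2 !IH; field. Qed.

Lemma ExZ M (r : R) X n : Ex M (fun l => r * X l) n = r * Ex M X n.
Proof. by elim: M n => [//|M IH] n; rewrite !ExS /avg2 !IH; field. Qed.

Lemma ExB M X Y n : Ex M (fun l => X l - Y l) n = Ex M X n - Ex M Y n.
Proof. by elim: M n => [//|M IH] n; rewrite !ExS /avg2 !IH; field. Qed.

Lemma Ex_sum (I : Type) (s : seq I) M (F : I -> nat -> R) n :
  Ex M (fun l => \sum_(k <- s) F k l) n = \sum_(k <- s) Ex M (F k) n.
Proof.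
elim: s => [|i s IH]; first by under Ex_eq do rewrite big_nil; rewrite Ex_cst big_nil.
by under Ex_eq do rewrite big_cons; rewrite ExD IH big_cons.
Qed.

Lemma Ex_ge0 M X n : (forall l, 0 <= X l) -> 0 <= Ex M X n.
Proof. by move=> X0; rewrite -(Ex_cst M 0 n) Ex_le. Qed.

Lemma Ex_exchange M N (F : nat -> nat -> R) n m :
  Ex M (fun l => Ex N (F l) m) n = Ex N (fun k => Ex M (fun l => F l k) n) m.
Proof.
elim: M n => [//|M IH] n; rewrite ExS /avg2 !IH -ExD mulrC -ExZ.
by apply: Ex_eq => l _; rewrite ExS /avg2 mulrC.
Qed.

(** The tangent inequality at the mean [m] is averaged. *)
Lemma Ex_jensen M p X n : 1 < p -> (forall l, 0 <= X l) ->
  (Ex M X n) `^ p <= Ex M (fun l => X l `^ p) n.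
Proof.
move=> p1 X0; set m := Ex M X n; have m0 : 0 <= m by exact: Ex_ge0.
have : Ex M (fun l => p * m `^ (p - 1) * X l) n <=
       Ex M (fun l => X l `^ p + (p - 1) * m `^ p) n.
  by apply: Ex_le => l _; rewrite young_tangent.
rewrite ExZ ExD Ex_cst -/m.
have -> : p * m `^ (p - 1) * m = p * m `^ p.
  by rewrite -mulrA (mulrC _ m) mulr_powRB1//; lra.
lra.
Qed.

(** [M] halvings lead from a node of level [M] back to the root 1; this is the form in which [Ex_le]
    and [Ex_eq] supply the level of a leaf. *)
Lemma lev_div M l : (l %/ 2 ^ M = 1)%N -> trunc_log 2 l = M.
Proof.
move=> H; apply: trunc_log_eq => //; rewrite expnSr.
have := divn_eq l (2 ^ M); have := ltn_pmod l (expn_gt0 2 M); rewrite H.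
by move: (2 ^ M)%N (l %% 2 ^ M)%N => A B; lia.
Qed.

(* [val k a l] is the value on [I_l], [l] of level [k], of the Haar sum
   [\sum_n a_n h_n]; it only sees the [n] among the [k] proper ancestors of [l]. *)
Fixpoint val k a l : R[i] :=
  if k is k'.+1 then
    val k' a l./2 + (if odd l then - a l./2 else a l./2)
  else 0.

Lemma val_double k a l : val k.+1 a l.*2 = val k a l + a l.
Proof. by rewrite /= odd_double doubleK. Qed.

Lemma val_doubleS k a l : val k.+1 a l.*2.+1 = val k a l - a l.
Proof. by rewrite /= odd_double uphalf_double. Qed.

Lemma eq_val k a b l :
  (forall j, (0 < j <= k)%N -> a (l %/ 2 ^ j)%N = b (l %/ 2 ^ j)%N) ->
  val k a l = val k b l.
Proof.
elim: k l => [//|k IH] l H /=.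
have <- : a l./2 = b l./2 by have := H 1%N isT; rewrite expn1 divn2.
congr (_ + _); apply: IH => j jk; have := H j.+1.
rewrite expnS divnMA divn2; apply; lia.
Qed.

Lemma valD k a b l : val k (fun n => a n + b n) l = val k a l + val k b l.
Proof.
elim: k l => [|k IH] l /=; first by rewrite addr0.
by rewrite IH; case: odd; ring.
Qed.

Lemma valZ k (r : R[i]) a l : val k (fun n => r * a n) l = r * val k a l.
Proof.
elim: k l => [|k IH] l /=; first by rewrite mulr0.
by rewrite IH; case: odd; ring.
Qed.

Lemma val0 k l : val k (fun=> 0) l = 0.
Proof. by elim: k l => [//|k IH] l /=; rewrite IH oppr0 if_same addr0. Qed.

Lemma val_sum (I : Type) (s : seq I) k (F : I -> nat -> R[i]) l :
  val k (fun n => \sum_(i <- s) F i n) l = \sum_(i <- s) val k (F i) l.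
Proof.
elim: s => [|i s IH].
  by rewrite big_nil -[RHS](val0 k l); apply: eq_val => j _; rewrite big_nil.
by rewrite big_cons/= -IH -valD; apply: eq_val => j _; rewrite big_cons.
Qed.

Definition l2 M a : R := Ex M (fun l => cabs (val M a l) ^+ 2) 1.

Lemma l2_ge0 M a : 0 <= l2 M a.
Proof. by apply: Ex_ge0 => l; rewrite sqr_ge0. Qed.

(** Orthogonality of the Haar system: on the two halves of I_n the value changes by [a n] and
    [- a n], and the parallelogram law removes the cross terms. *)
Lemma l2S M a : l2 M.+1 a = l2 M a + Ex M (fun n => cabs (a n) ^+ 2) 1.
Proof.
rewrite /l2 ExSr -ExD; apply: Ex_eq => l _.
by rewrite /avg2 val_double val_doubleS cabs_parallelogram mulrC mulKf.
Qed.

Lemma l2E M a : l2 M a = \sum_(k < M) Ex k (fun n => cabs (a n) ^+ 2) 1.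
Proof.
elim: M => [|M IH]; first by rewrite big_ord0 /l2 Ex0 [val _ _ _]/= cabs0 expr0n.
by rewrite l2S IH big_ord_recr.
Qed.

(** A Haar sum is a martingale, its value at a node being the mean of its values below; the modulus
    is therefore a submartingale. *)
Lemma cabs_val_le d k a n :
  cabs (val k a n) <= Ex d (fun l => cabs (val (k + d) a l)) n.
Proof.
elim: d => [|d IH]; first by rewrite addn0.
apply: (le_trans IH); rewrite ExSr addnS; apply: Ex_le => l _.
rewrite /avg2 val_double val_doubleS ler_pdivlMr// mulr_natr.
move: (val _ a l) (a l) => z w.
have := cabsD (z + w) (z - w); rewrite (_ : z + w + (z - w) = z *+ 2); last by ring.
by rewrite {1}/cabs normcMn.
Qed.

(* A chain of coefficients carried by the left descendants [2^i n] of each odd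
   [n] is acted on by [conv c] as by the power series [\sum_i c_i z^i]. *)
Definition cauchy x y m : R[i] := \sum_(i < m.+1) x i * y (m - i)%N.

Definition conv c a n : R[i] :=
  \sum_(i < (logn 2 n).+1) c i * a (n %/ 2 ^ i)%N.

(** [D] bounds p-th powers of norms, hence plays the part of the p-th power of an operator norm; its
    independence of the depth [M] is what makes this a statement on L^p. *)
Definition Bd (p : R) c : Prop := exists2 D : R, 0 <= D &
  forall M a, Ex M (fun l => cabs (val M (conv c a) l) `^ p) 1 <=
              D * Ex M (fun l => cabs (val M a l) `^ p) 1.

Lemma logn2_odd m o : odd o -> logn 2 (2 ^ m * o) = m.
Proof.
move=> oo; have o0 : (0 < o)%N by case: o oo.
by rewrite lognM ?expn_gt0// pfactorK// lognE dvdn2 oo !andbF addn0.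
Qed.

Lemma odd_part n : (0 < n)%N -> exists m o, odd o /\ n = (2 ^ m * o)%N.
Proof.
move=> n0; have [r rodd Hn] := pfactor_coprime (isT : prime 2) n0.
by exists (logn 2 n), r; rewrite -coprime2n mulnC.
Qed.

Lemma expn_div2 m i o : (i <= m)%N -> (2 ^ m * o %/ 2 ^ i = 2 ^ (m - i) * o)%N.
Proof. by move=> im; rewrite -{1}(subnKC im) expnD -mulnA mulKn// expn_gt0. Qed.

Lemma conv_chain c a m o : odd o ->
  conv c a (2 ^ m * o)%N = cauchy c (fun i => a (2 ^ i * o)%N) m.
Proof.
move=> oo; rewrite /conv /cauchy logn2_odd//; apply: eq_bigr => i _.
by rewrite expn_div2// -ltnS.
Qed.

Lemma eq_conv c a b n : (0 < n)%N ->
  (forall i, (2 ^ i %| n)%N -> a (n %/ 2 ^ i)%N = b (n %/ 2 ^ i)%N) ->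
  conv c a n = conv c b n.
Proof.
move=> n0 ab; apply: eq_bigr => i _; rewrite ab//.
by rewrite pfactor_dvdn// -ltnS.
Qed.

Lemma eq_cauchy x y z m : (forall i, (i <= m)%N -> y i = z i) ->
  cauchy x y m = cauchy x z m.
Proof. by move=> yz; apply: eq_bigr => i _; rewrite yz// leq_subr. Qed.

(** Truncation to polynomials lets the ring laws of polynomials provide associativity and
    commutativity of the product of power series. *)
Lemma cauchy_coef x y m M : (m < M)%N -> cauchy x y m =
  ((\poly_(i < M) x i) * (\poly_(i < M) y i))`_m.
Proof.
move=> mM; rewrite coefM; apply: eq_bigr => i _; rewrite !coef_poly.
by rewrite !ifT// (leq_ltn_trans _ mM)// ?leq_subr// -ltnS.
Qed.

Lemma cauchyA x y z m : cauchy x (cauchy y z) m = cauchy (cauchy x y) z m.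
Proof.
transitivity (((\poly_(i < m.+1) x i) * ((\poly_(i < m.+1) y i) *
  (\poly_(i < m.+1) z i)))`_m).
  rewrite coefM; apply: eq_bigr => i _; rewrite coef_poly ltn_ord.
  by rewrite -cauchy_coef// ltnS leq_subr.
rewrite mulrA coefM; apply: eq_bigr => i _.
by rewrite [in X in _ * X]coef_poly -(@cauchy_coef _ _ _ m.+1)// ltnS leq_subr.
Qed.

Lemma cauchyC x y m : cauchy x y m = cauchy y x m.
Proof. by rewrite !(@cauchy_coef _ _ m m.+1)// mulrC. Qed.

Definition delta (m : nat) : R[i] := if m is 0 then 1 else 0.

Lemma cauchy_delta x m : cauchy delta x m = x m.
Proof.
rewrite /cauchy big_ord_recl/= mul1r subn0 big1 ?addr0// => i _.
by rewrite mul0r.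
Qed.

Lemma conv_inv c d a n : (0 < n)%N -> (forall m, cauchy d c m = delta m) ->
  conv d (conv c a) n = a n.
Proof.
move=> n0 dc; have [m [r [oo ->]]] := odd_part n0; rewrite conv_chain//.
rewrite (@eq_cauchy _ _ (cauchy c (fun i => a (2 ^ i * r)%N))); last first.
  by move=> i _; rewrite conv_chain.
rewrite cauchyA -(cauchy_delta (fun i => a (2 ^ i * r)%N)).
by apply: eq_bigr => i _; rewrite dc.
Qed.

(** The last entry solves for d_m the equation saying that the coefficient of index m of the product
    of d and c is that of 1. The recursion needs all earlier values, so it builds their list. *)
Fixpoint cinv_seq c n : seq R[i] :=
  if n is n'.+1 then
    let s := cinv_seq c n' in
    rcons s (- (c 0)^-1 * \sum_(i < n') c (n' - i)%N * s`_i + (c 0)^-1 * delta n')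
  else [::].

Lemma size_cinv_seq c n : size (cinv_seq c n) = n.
Proof. by elim: n => [//|n IH] /=; rewrite size_rcons IH. Qed.

Definition cinv c m := (cinv_seq c m.+1)`_m.

Lemma nth_cinv_seq c n i : (i < n)%N -> (cinv_seq c n)`_i = cinv c i.
Proof.
elim: n => [//|n IH]; rewrite ltnS leq_eqVlt => /predU1P[->//|iltn].
by rewrite /= nth_rcons size_cinv_seq iltn IH.
Qed.

Lemma cinvE c m : c 0 != 0 -> cauchy (cinv c) c m = delta m.
Proof.
move=> c0; rewrite /cauchy big_ord_recr/= subnn.
rewrite {2}/cinv /= nth_rcons size_cinv_seq ltnn eqxx.
have -> : \sum_(i < m) c (m - i)%N * (cinv_seq c m)`_i = \sum_(i < m) cinv c i * c (m - i)%N.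
  by apply: eq_bigr => i _; rewrite nth_cinv_seq// mulrC.
by field.
Qed.

End Tree.

(** * From [L^2] to [L^q] *)

Section Stopping.
Variable R : realType.
Implicit Types (p q r lam : R) (a c : nat -> R[i]) (al : nat -> nat -> R).

(** * Doob's maximal inequality *)

Fixpoint amax al k n : R :=
  if k is k'.+1 then Num.max (amax al k' n./2) (al k n) else al 0 n.

Lemma amax_anc al k j l : amax al k (l %/ 2 ^ j)%N <= amax al (k + j) l.
Proof.
elim: j l => [|j IH] l; first by rewrite expn0 divn1 addn0.
rewrite addnS /= le_max; apply/orP; left.
by rewrite expnS divnMA divn2 IH.
Qed.

Lemma amax_ge al k n : al k n <= amax al k n.
Proof. by case: k => [//|k] /=; rewrite le_max lexx orbT. Qed.

(** A pathwise proof: the mean of [phi], taken at the running maximum and the current value, is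
    nonpositive at the root and does not increase from level to level. *)
Lemma doob p M al : 1 < p -> (forall k n, 0 <= al k n) ->
  (forall k n, (k < M)%N -> al k n = avg2 (al k.+1) n) ->
  Ex M (fun n => amax al M n `^ p) 1 <=
  (p / (p - 1)) `^ p * Ex M (fun n => al M n `^ p) 1.
Proof.
move=> p1 al0 alE; set q := p / (p - 1).
have p0 : 0 < p - 1 by lra.
have qE : q = 1 + (p - 1)^-1 by rewrite /q; field; lra.
have q0 : 0 <= q by rewrite divr_ge0//; lra.
have am0 k n : 0 <= amax al k n by rewrite (le_trans (al0 k n)) ?amax_ge.
(* [m ^ p - q m ^ (p - 1) x] is affine in [x] and decreases when a new record
   [x] replaces the running maximum [m]. *)
pose phi m x := m `^ p - q * (m `^ (p - 1) * x).
have phi_max m x : 0 <= m -> 0 <= x -> phi (Num.max m x) x <= phi m x.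
  move=> m0 x0; case: (leP x m) => // mx; rewrite /phi.
  rewrite [x `^ _ * x]mulrC mulr_powRB1//; last lra.
  have := young_tangent p1 x0 m0.
  have -> : q * (m `^ (p - 1) * x) = (p * m `^ (p - 1) * x) / (p - 1).
    by rewrite /q; field; lra.
  move=> H; have : p * m `^ (p - 1) * x / (p - 1) <= x `^ p / (p - 1) + m `^ p.
    by rewrite ler_pdivrMr// mulrDl divfK; [lra|lra].
  rewrite qE mulrDl mul1r mulrC; lra.
have key k : (k <= M)%N -> Ex k (fun n => phi (amax al k n) (al k n)) 1 <= 0.
  elim: k => [_|k IH kM].
    rewrite Ex0 /= /phi [X in q * X]mulrC mulr_powRB1//; last lra.
    by rewrite qE mulrDl mul1r opprD addrA subrr add0r oppr_le0 mulr_ge0 ?invr_ge0 ?powR_ge0// ltW.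
  apply: le_trans (IH (ltnW kM)); rewrite ExSr; apply: Ex_le => n _.
  have -> : phi (amax al k n) (al k n) =
      (phi (amax al k n) (al k.+1 n.*2) + phi (amax al k n) (al k.+1 n.*2.+1)) / 2.
    by rewrite alE// /avg2 /phi; field.
  rewrite /avg2 /= doubleK uphalf_double ler_wpM2r ?invr_ge0//.
  by rewrite lerD// phi_max.
have {key} := key M (leqnn M).
rewrite /phi ExB ExZ subr_le0 -ExZ => H.
(* Young's inequality leaves the share (p - 1)/p of the maximum on the right, to be absorbed on the
   left; taking [q] along with [al] produces the constant q^p. *)
have : Ex M (fun n => q * (amax al M n `^ (p - 1) * al M n)) 1 <=
   Ex M (fun n => ((p - 1) / p) * amax al M n `^ p + (q `^ p / p) * al M n `^ p) 1.
  apply: Ex_le => n _; have := young_tangent p1 (mulr_ge0 q0 (al0 M n)) (am0 M n).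
  rewrite powRM//.
  move: (amax al M n `^ (p - 1)) (amax al M n `^ p) (al M n) => A B E G.
  rewrite -(ler_pM2l (_ : 0 < p)); last lra.
  have -> : p * ((p - 1) / p * B + q `^ p / p * E `^ p) = q `^ p * E `^ p + (p - 1) * B.
    by field; lra.
  by apply: le_trans G; rewrite le_eqVlt; apply/orP; left; apply/eqP; ring.
move=> /(le_trans H); rewrite ExD !ExZ.
set A := Ex M _ 1; set B := Ex M _ 1 => K.
have : p * A <= p * ((p - 1) / p * A + q `^ p / p * B) by rewrite ler_pM2l//; lra.
have -> : p * ((p - 1) / p * A + q `^ p / p * B) = (p - 1) * A + q `^ p * B.
  by field; lra.
lra.
Qed.

(** * Stopped Haar sums and the weak type estimate *)

(** The martingale closed by the modulus at the leaves. It dominates the modulus of the partial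
    sums, satisfies the averaging identity that [doob] asks for, and, being nonnegative, at most
    doubles from a node to its child. *)
Definition alpha M a k n : R := Ex (M - k) (fun l => cabs (val M a l)) n.

Lemma alpha_ge0 M a k n : 0 <= alpha M a k n.
Proof. by apply: Ex_ge0 => l; exact: cabs_ge0. Qed.

Lemma alphaE M a k n : (k < M)%N -> alpha M a k n = avg2 (alpha M a k.+1) n.
Proof. by move=> kM; rewrite /alpha -subnSK. Qed.

Lemma alpha_leaf M a l : alpha M a M l = cabs (val M a l).
Proof. by rewrite /alpha subnn. Qed.

Lemma cabs_val_alpha M a k n : (k <= M)%N -> cabs (val k a n) <= alpha M a k n.
Proof.
by move=> kM; have := cabs_val_le (M - k) k a n; rewrite subnKC.
Qed.

(** The stopping is predictable: [a n] acts on the halves of I_n, while the test reads [alpha] only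
    on the path down to [n]. *)
Definition stop M a lam n : R[i] :=
  if amax (alpha M a) (trunc_log 2 n) n <= lam then a n else 0.

(** When the maximum first exceeds [lam], the parent still has [alpha] at most [lam], so [alpha] at
    the node is at most twice that; from there on the stopped sum is frozen. *)
Lemma val_stop M a lam k n : 0 <= lam -> (k <= M)%N -> (n %/ 2 ^ k = 1)%N ->
  if amax (alpha M a) k n <= lam then val k (stop M a lam) n = val k a n
  else cabs (val k (stop M a lam) n) <= 2 * lam.
Proof.
move=> lam0; elim: k n => [|k IH] n kM nk.
  by case: ifP => // _; rewrite [val _ _ _]/= cabs0 mulr_ge0.
have nk2 : (n./2 %/ 2 ^ k = 1)%N by rewrite -divn2 -divnMA -expnS.
have := IH _ (ltnW kM) nk2.
rewrite [val k.+1 (stop _ _ _) n]/= [stop _ _ _ _]/stop (lev_div nk2).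
case: (leP (amax _ k n./2) lam) => H; last first.
  have -> : (amax (alpha M a) k.+1 n <= lam) = false.
    by apply/negbTE; rewrite -ltNge /= lt_max H.
  by rewrite oppr0 if_same addr0.
move=> E; rewrite E -[X in if _ then X = _ else cabs X <= _]/(val k.+1 a n).
case: ifPn => //; rewrite -ltNge /= lt_max ltNge H/= => H'.
apply: (le_trans (cabs_val_alpha a n kM)).
have := le_trans (amax_ge (alpha M a) k n./2) H.
have : alpha M a k.+1 n <= alpha M a k.+1 n./2.*2 + alpha M a k.+1 n./2.*2.+1.
  rewrite -[X in alpha _ _ _ X <= _](odd_double_half n).
  by case: odd; rewrite ?add1n ?add0n ?lerDl ?lerDr alpha_ge0.
rewrite (alphaE a n./2 kM) /avg2; lra.
Qed.

(** The coefficients of [conv c] on the path to [l] read [a] only at ancestors of [l], and the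
    running maximum at these is at most the one at [l]. *)
Lemma val_conv_stop M a c lam l : (l %/ 2 ^ M = 1)%N ->
  amax (alpha M a) M l <= lam ->
  val M (conv c (stop M a lam)) l = val M (conv c a) l.
Proof.
move=> lM Hl; have l0 : (0 < l)%N by case: l lM {Hl} => //; rewrite div0n.
apply: eq_val => j /andP[j0 jM].
have n0 : (0 < l %/ 2 ^ j)%N.
  rewrite divn_gt0 ?expn_gt0// (leq_trans (_ : _ <= 2 ^ M)%N) ?leq_exp2l//.
  by have := leq_trunc_div l (2 ^ M); rewrite lM mul1n.
apply: eq_conv => // i ij.
have : (0 < l %/ 2 ^ j %/ 2 ^ i)%N by rewrite divn_gt0 ?expn_gt0// dvdn_leq.
rewrite -divnMA -expnD => n1.
have sM : (j + i <= M)%N.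
  rewrite leqNgt; apply/negP => Ms; move: n1; rewrite -(subnKC (ltnW Ms)) expnD divnMA lM.
  by rewrite divn_small// -{1}(expn0 2) ltn_exp2l// subn_gt0.
rewrite /stop (@lev_div (M - (j + i))); last first.
  by rewrite -divnMA -expnD subnKC.
rewrite ifT//; apply: le_trans Hl.
by have := amax_anc (alpha M a) (M - (j + i)) (j + i) l; rewrite subnK.
Qed.

(* Outside [{A > lam}], where [A] is the maximal function, [conv c] does not see
   the stopping, hence it is of weak type on the stopped sequence. *)
Lemma weak_type M a c lam (D : R) : 0 < lam -> 0 <= D ->
  (forall b, l2 M (conv c b) <= D * l2 M b) ->
  Ex M (fun l => (lam < cabs (val M (conv c a) l))%R%:R) 1 <=
  Ex M (fun l => (1 + 4 * D) * (lam < amax (alpha M a) M l)%R%:R +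
    D * (cabs (val M a l) ^+ 2 * (lam ^- 2 * (amax (alpha M a) M l <= lam)%R%:R))) 1.
Proof.
move=> lam0 D0 HD; set A := amax (alpha M a) M.
pose s := stop M a lam.
have H1 : Ex M (fun l => (lam < cabs (val M (conv c a) l))%R%:R) 1 <=
    Ex M (fun l => (lam < A l)%R%:R + lam ^- 2 * cabs (val M (conv c s) l) ^+ 2) 1.
  apply: Ex_le => l lM.
  have h : 0 <= lam ^- 2 * cabs (val M (conv c s) l) ^+ 2.
    by rewrite mulr_ge0 ?invr_ge0 ?sqr_ge0.
  case: (ltP lam (A l)) => Al; first by rewrite ler_wpDr// lern1 leq_b1.
  rewrite add0r; case: (ltP lam (cabs _)) => // Tl.
  rewrite val_conv_stop// mulrC ler_pdivlMr ?exprn_gt0// mul1r.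
  by rewrite ler_sqr ?nnegrE ?cabs_ge0 ?ltW.
apply: (le_trans H1); rewrite ExD ExZ -/(l2 M (conv c s)).
(* The factor 4 is the square of the 2 in [val_stop]. *)
have H2 : l2 M s <= Ex M (fun l => cabs (val M a l) ^+ 2 * (A l <= lam)%R%:R +
     4 * lam ^+ 2 * (lam < A l)%R%:R) 1.
  apply: Ex_le => l lM; have := @val_stop M a lam M l (ltW lam0) (leqnn M) lM.
  rewrite -/s -/(A l); case: (leP (A l) lam) => Al.
    by move=> ->; rewrite mulr1 mulr0 addr0.
  rewrite mulr0 add0r mulr1 => H.
  have -> : 4 * lam ^+ 2 = (2 * lam) ^+ 2 by ring.
  by rewrite ler_sqr ?nnegrE ?cabs_ge0 ?mulr_ge0// ltW.
have H3 : lam ^- 2 * l2 M (conv c s) <= lam ^- 2 * (D * Ex M (fun l =>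
    cabs (val M a l) ^+ 2 * (A l <= lam)%R%:R + 4 * lam ^+ 2 * (lam < A l)%R%:R) 1).
  rewrite ler_wpM2l ?invr_ge0 ?sqr_ge0// (le_trans (HD s))//.
  by rewrite ler_wpM2l.
apply: (@le_trans _ _ _ _ _ (lerD (lexx _) H3)).
rewrite mulrA -ExZ -ExD; apply: Ex_le => l _.
move: (cabs _) (_%:R) (_%:R) => x y z.
rewrite le_eqVlt; apply/orP; left; apply/eqP; field; lra.
Qed.

(** At each leaf the weak type bounds sum to two geometric series over the levels: lam^q for lam <
    A, and lam^(q-2) for lam >= A, the latter convergent because q < 2. As |val| <= A, both
    contribute at most a multiple of A^q, and [doob] returns from A to |val|. *)
Lemma Bd2_Bd q c : 1 < q -> q < 2 -> Bd 2 c -> Bd q c.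
Proof.
move=> q1 q2 [D D0 HD].
have {}HD M b : l2 M (conv c b) <= D * l2 M b.
  have := HD M b; have E x : Ex M (fun l => cabs (val M x l) `^ 2) 1 = l2 M x.
    by apply: Ex_eq => l _; rewrite (powR_mulrn 2)// cabs_ge0.
  by rewrite !E.
pose K := (1 - 2 `^ (- (2 - q)))^-1.
pose Q := 2 `^ q * ((1 + 4 * D) * 2 + D * K).
have K0 : 0 <= K.
  rewrite invr_ge0 subr_ge0 powRN invf_le1 ?powR_gt0//.
  by rewrite -[X in X <= _](powRr0 2) ler_powR//; lra.
have Q0 : 0 <= Q.
  by rewrite mulr_ge0 ?powR_ge0// addr_ge0 ?mulr_ge0// addr_ge0// mulr_ge0.
exists (Q * (q / (q - 1)) `^ q); first by rewrite mulr_ge0 ?powR_ge0.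
move=> M a; set A := amax (alpha M a) M.
have A0 l : 0 <= A l by rewrite (le_trans (alpha_ge0 M a M l))// amax_ge.
have Aa l : cabs (val M a l) <= A l by rewrite -alpha_leaf amax_ge.
(* The grid of levels needs a bottom [r]; its cost r^q is an arbitrary [e > 0], and [Q] does not
   depend on it. *)
suff main r : 0 < r -> Ex M (fun l => cabs (val M (conv c a) l) `^ q) 1 <=
    r `^ q + Q * Ex M (fun l => A l `^ q) 1.
  have {}main : Ex M (fun l => cabs (val M (conv c a) l) `^ q) 1 <=
      Q * Ex M (fun l => A l `^ q) 1.
    apply/ler_addgt0Pl => e e0; have := main (e `^ q^-1) (powR_gt0 _ e0).
    by rewrite -powRrM mulVf ?(powRr1 (ltW e0))// gt_eqF//; lra.
  apply: (le_trans main); rewrite -mulrA ler_wpM2l//.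
  have := @doob q M (alpha M a) q1 (alpha_ge0 M a) (fun k n => @alphaE M a k n).
  by under [in X in _ <= X -> _]Ex_eq do rewrite alpha_leaf.
move=> r0.
(* The grid also needs a top: the leaves have indices below 2^(M+1), so a finite sum [S] exceeds
   every value. *)
have [n Hn] : exists n, forall l, (l %/ 2 ^ M = 1)%N ->
    cabs (val M (conv c a) l) <= r * 2 ^+ n.
  pose S := \sum_(l < 2 ^ M.+1) cabs (val M (conv c a) l).
  exists (Num.truncn (S / r)).+1 => l lM.
  have lS : cabs (val M (conv c a) l) <= S.
    have lM' : (l < 2 ^ M.+1)%N.
      rewrite expnS -ltn_divLR ?expn_gt0//; last by rewrite lM.
    rewrite /S (bigD1 (Ordinal lM'))//= lerDl sumr_ge0// => i _; exact: cabs_ge0.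
  rewrite (le_trans lS)// mulrC -ler_pdivrMr//.
  have : S / r < (Num.truncn (S / r)).+1%:R by exact: truncnS_gt.
  move/ltW/le_trans; apply.
  rewrite -natrX ler_nat; exact/ltnW/ltn_expl.
pose lam k := r * 2 ^+ k.
have lam0 k : 0 < lam k by rewrite mulr_gt0// exprn_gt0.
apply: (@le_trans _ _ (Ex M (fun l => r `^ q + \sum_(k < n) (2 * lam k) `^ q *
    (lam k < cabs (val M (conv c a) l))%R%:R) 1)).
  apply: Ex_le => l lM; apply: powR_layer_cake => //; first lra; first exact: cabs_ge0.
  exact: Hn.
rewrite ExD Ex_cst lerD2l Ex_sum.
apply: (@le_trans _ _ (\sum_(k < n) Ex M (fun l => (2 * lam k) `^ q *
   ((1 + 4 * D) * (lam k < A l)%R%:R +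
    D * (cabs (val M a l) ^+ 2 * (lam k ^- 2 * (A l <= lam k)%R%:R)))) 1)).
  apply: ler_sum => k _; rewrite !ExZ ler_wpM2l ?powR_ge0//.
  exact: weak_type.
rewrite -Ex_sum -ExZ; apply: Ex_le => l _.
under eq_bigr => k _.
  have -> : (2 * lam k) `^ q * ((1 + 4 * D) * (lam k < A l)%R%:R +
    D * (cabs (val M a l) ^+ 2 * (lam k ^- 2 * (A l <= lam k)%R%:R))) =
    2 `^ q * (1 + 4 * D) * (lam k `^ q * (lam k < A l)%R%:R) +
    2 `^ q * D * cabs (val M a l) ^+ 2 * (lam k `^ (- (2 - q)) * (A l <= lam k)%R%:R).
    rewrite opprB powRB; last by rewrite (gt_eqF (lam0 k)) implybT.
    rewrite powRM ?(ltW (lam0 k))// (powR_mulrn 2) ?(ltW (lam0 k))//.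
    by rewrite mulrDr; congr (_ + _); ring.
  over.
rewrite big_split /= -!mulr_sumr.
have S1 := @sum_grid_lt R q (A l) r n (ltW q1) r0.
have d0 : 0 < 2 - q by lra.
have S2 := @sum_grid_ge R (2 - q) (A l) r n d0 r0.
have {}S1 : \sum_(i < n) lam i `^ q * (lam i < A l)%R%:R <= 2 * A l `^ q.
  apply: (le_trans S1); case: (r < A l); rewrite ?mul1r ?mul0r.
    by rewrite gerBl powR_ge0.
  by rewrite mulr_ge0 ?powR_ge0.
have {}S2 : cabs (val M a l) ^+ 2 * (\sum_(i < n) lam i `^ (- (2 - q)) *
    (A l <= lam i)%R%:R) <= K * A l `^ q.
  apply: (@le_trans _ _ (A l ^+ 2 * (K * (Num.max r (A l)) `^ (- (2 - q))))).
    apply: ler_pM => //; first exact: sqr_ge0.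
    - by apply: sumr_ge0 => i _; rewrite mulr_ge0 ?powR_ge0 ?ler0n.
    - by rewrite ler_sqr ?nnegrE ?cabs_ge0.
  rewrite mulrCA ler_wpM2l//.
  have [->|An0] := eqVneq (A l) 0; first by rewrite expr0n/= mul0r powR_ge0.
  have Ap : 0 < A l by rewrite lt0r An0 A0.
  apply: (@le_trans _ _ (A l ^+ 2 * (A l `^ (- (2 - q))))).
    rewrite ler_wpM2l ?sqr_ge0// !powRN lef_pV2 ?posrE ?powR_gt0 ?lt_max ?r0//.
    by rewrite ge0_ler_powR ?nnegrE ?le_max ?lexx ?orbT// ltW.
  rewrite -(powR_mulrn 2)// -powRD; last by rewrite An0 implybT.
  by rewrite subKr.
rewrite /Q.
have -> : 2 `^ q * ((1 + 4 * D) * 2 + D * K) * A l `^ q =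
  2 `^ q * (1 + 4 * D) * (2 * A l `^ q) + 2 `^ q * D * (K * A l `^ q) by ring.
have c1 : 0 <= 2 `^ q * (1 + 4 * D) by rewrite mulr_ge0 ?powR_ge0//; lra.
have c2 : 0 <= 2 `^ q * D by rewrite mulr_ge0 ?powR_ge0.
by rewrite -[X in _ + X <= _]mulrA lerD// ler_wpM2l.
Qed.

End Stopping.

(** * From [L^p] to [L^2] *)

Section Chains.
Variable R : realType.
Implicit Types (p q : R) (a c x y : nat -> R[i]) (g : nat -> R[i]).

(** * Reduction of the L^2 bound to single chains *)

(** The squared L^2 norm of a Haar sum carried by one chain: its m-th interval has relative measure
    2^-m. *)
Definition wnorm x N : R := \sum_(m < N) 2 ^- m * cabs (x m) ^+ 2.

Lemma wnorm_ge0 x N : 0 <= wnorm x N.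
Proof.
by apply: sumr_ge0 => i _; rewrite mulr_ge0 ?sqr_ge0 ?invr_ge0 ?exprn_ge0.
Qed.

Definition subtree (F : nat -> R) M n : R := \sum_(k < M) Ex k F n.

Lemma subtreeS F M n :
  subtree F M.+1 n = F n + (subtree F M n.*2 + subtree F M n.*2.+1) / 2.
Proof.
rewrite /subtree big_ord_recl Ex0; congr (_ + _).
rewrite -big_split mulr_suml; apply: eq_bigr => i _.
by rewrite lift0 ExS.
Qed.

(** The subtree of [n] consists of the left chain from [n] and of the subtrees hanging from it at
    right children. Their roots are odd, so each starts a new chain. *)
Lemma subtree_chain F M n : subtree F M n = \sum_(m < M) 2 ^- m *
  (F (2 ^ m * n)%N + subtree F (M - m.+1) (2 ^ m * n).*2.+1 / 2).
Proof.
elim: M n => [|M IH] n; first by rewrite /subtree !big_ord0.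
rewrite subtreeS IH big_ord_recl expn0 mul1n subn1 /= expr0 invr1 mul1r.
rewrite mulrDl [RHS]addrAC -addrA; congr (_ + (_ + _)).
rewrite mulr_suml; apply: eq_bigr => i _.
rewrite /bump leq0n add1n exprS subSS expnS invfM.
rewrite -mul2n mulnCA (mulnA 2%N (2 ^ i)%N) mul2n; ring.
Qed.

(** Strong induction on the depth: the chain of an odd node obeys the hypothesis, and the subtrees
    that hang from it have odd roots and smaller depth. *)
Lemma chain_Bd2 c (A : R) : 0 <= A ->
  (forall x N, wnorm (cauchy c x) N <= A * wnorm x N) -> Bd 2 c.
Proof.
move=> A0 HA; exists A => // M a.
have E b : Ex M (fun l => cabs (val M b l) `^ 2) 1 =
    subtree (fun n => cabs (b n) ^+ 2) M 1.
  rewrite /subtree -l2E; apply: Ex_eq => l _.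
  by rewrite (powR_mulrn 2)// cabs_ge0.
rewrite !E {E}.
suff: forall n, odd n -> subtree (fun n => cabs (conv c a n) ^+ 2) M n <=
    A * subtree (fun n => cabs (a n) ^+ 2) M n by apply.
have [N] := ubnP M; elim: N M => // N IH M MN n nodd.
rewrite !(subtree_chain _ M) mulr_sumr.
under eq_bigr do rewrite mulrDr.
under [X in _ <= X]eq_bigr do rewrite !mulrDr.
rewrite !big_split /= lerD//.
  rewrite -mulr_sumr; apply: le_trans (HA (fun i => a (2 ^ i * n)%N) M).
  by rewrite le_eqVlt; apply/orP; left; apply/eqP/eq_bigr => i _; rewrite conv_chain.
apply: ler_sum => m _; rewrite [X in _ <= X]mulrCA ler_wpM2l ?invr_ge0 ?exprn_ge0//.
rewrite mulrA ler_wpM2r ?invr_ge0// IH//=; last by rewrite odd_double.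
by have := ltn_ord m; lia.
Qed.

(* The signs are the binary digits of [e]. *)
Fixpoint rad K g e : R[i] :=
  if K is K'.+1 then rad K' g e./2 + (if odd e then - g K' else g K') else 0.

Lemma rad_double K g e : rad K.+1 g e.*2 = rad K g e + g K.
Proof. by rewrite /= odd_double doubleK. Qed.

Lemma rad_doubleS K g e : rad K.+1 g e.*2.+1 = rad K g e - g K.
Proof. by rewrite /= odd_double uphalf_double. Qed.

Lemma val_rad M K (F : nat -> nat -> R[i]) e l :
  val M (fun n => rad K (fun i => F i n) e) l = rad K (fun i => val M (F i) l) e.
Proof.
elim: K e => [|K IH] e /=; first exact: val0.
rewrite valD IH; case: odd => //; rewrite -mulN1r -valZ.
by congr (_ + _); apply: eq_val => j _; rewrite mulN1r.
Qed.

Lemma conv_rad c K (F : nat -> nat -> R[i]) e n :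
  conv c (fun n => rad K (fun i => F i n) e) n = rad K (fun i => conv c (F i) n) e.
Proof.
elim: K e => [|K IH] e /=; first by rewrite /conv big1// => i _; rewrite mulr0.
rewrite -IH /conv; case: odd; last by rewrite -big_split; apply: eq_bigr => i _; rewrite mulrDr.
by rewrite -sumrB; apply: eq_bigr => i _; rewrite mulrBr.
Qed.

(** * Khinchine's inequality *)

Lemma rad2 K g : Ex K (fun e => cabs (rad K g e) ^+ 2) 1 = \sum_(i < K) cabs (g i) ^+ 2.
Proof.
elim: K => [|K IH]; first by rewrite big_ord0 Ex0 [rad _ _ _]/= cabs0 expr0n.
rewrite ExSr big_ord_recr -IH -[X in _ = _ + X](Ex_cst K _ 1) -ExD.
apply: Ex_eq => e _; rewrite /avg2 rad_double rad_doubleS cabs_parallelogram.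
by rewrite mulrC mulKf.
Qed.

Lemma rad4 K g : Ex K (fun e => cabs (rad K g e) ^+ 4) 1 <=
  3 * (\sum_(i < K) cabs (g i) ^+ 2) ^+ 2.
Proof.
elim: K => [|K IH].
  by rewrite big_ord0 Ex0 [rad _ _ _]/= cabs0 !expr0n/= mulr0.
rewrite ExSr big_ord_recr; set S := \sum_(i < K) _ in IH *.
apply: (@le_trans _ _ (Ex K (fun e => cabs (rad K g e) ^+ 4 +
    (6 * cabs (g K) ^+ 2) * cabs (rad K g e) ^+ 2 + cabs (g K) ^+ 4) 1)).
  apply: Ex_le => e _; rewrite /avg2 rad_double rad_doubleS ler_pdivrMr//.
  by apply: le_trans (cabs_parallelogram4 _ _) _; rewrite le_eqVlt; apply/orP; left; apply/eqP; ring.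
rewrite !ExD ExZ rad2 Ex_cst -/S.
have E4 : cabs (g K) ^+ 4 = (cabs (g K) ^+ 2) ^+ 2 by ring.
rewrite E4 /=; move: (cabs (g K) ^+ 2) => t.
have := sqr_ge0 t.
have -> : 3 * (S + t) ^+ 2 = 3 * S ^+ 2 + 6 * t * S + 3 * t ^+ 2 by ring.
lra.
Qed.

(** The quadratic minorant is rescaled by s = 3 S, the best scale for second moment S and fourth
    moment at most 3 S^2: the bracket is then 1/3 - 1/6 = 1/6. *)
Lemma khinchine p K g : 1 <= p -> p <= 2 ->
  6^-1 * (\sum_(i < K) cabs (g i) ^+ 2) `^ (p / 2) <=
  Ex K (fun e => cabs (rad K g e) `^ p) 1.
Proof.
move=> p1 p2; set S := \sum_(i < K) _.
have S0 : 0 <= S by apply: sumr_ge0 => i _; rewrite sqr_ge0.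
have [->|Sn0] := eqVneq S 0.
  rewrite powR0 ?mulr0; last by rewrite mulf_neq0//; lra.
  by apply: Ex_ge0 => l; rewrite powR_ge0.
have Sp : 0 < S by rewrite lt0r Sn0.
have s0 : 0 < 3 * S by rewrite mulr_gt0.
have qh : 2^-1 <= p / 2 by lra.
have q1 : p / 2 <= 1 by lra.
apply: (@le_trans _ _ (Ex K (fun e => (3 * S) `^ (p / 2) *
   ((3 * S)^-1 * cabs (rad K g e) ^+ 2 - ((3 * S) ^- 2 / 2) * cabs (rad K g e) ^+ 4)) 1)).
  rewrite ExZ ExB !ExZ rad2 -/S powRM// mulrC.
  have h3 : 1 <= 3 `^ (p / 2) :> R.
    by rewrite -[X in X <= _](powRr0 3) ler_powR//; lra.
  apply: ler_pM; rewrite ?powR_ge0 ?invr_ge0//.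
    by rewrite ler_peMl ?powR_ge0.
  apply: (@le_trans _ _ ((3 * S)^-1 * S - (3 * S) ^- 2 / 2 * (3 * S ^+ 2))).
    by rewrite le_eqVlt; apply/orP; left; apply/eqP; field; lra.
  rewrite lerD2l lerN2 ler_wpM2l ?rad4//.
  by rewrite mulr_ge0 ?invr_ge0 ?sqr_ge0.
apply: Ex_le => e _; set z := cabs _.
have z0 : 0 <= z by exact: cabs_ge0.
have := powR_rescale qh q1 s0 (sqr_ge0 z).
have -> : (z ^+ 2) `^ (p / 2) = z `^ p.
  by rewrite -(powR_mulrn 2)// -powRrM mulrC divfK.
apply: le_trans; rewrite ler_wpM2l ?powR_ge0// le_eqVlt; apply/orP; left; apply/eqP.
by field; lra.
Qed.

Lemma Ex_powR_le q M X n : 0 < q -> q < 1 -> (forall l, 0 <= X l) ->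
  Ex M (fun l => X l `^ q) n <= (Ex M X n) `^ q.
Proof.
move=> q0 q1 X0; have qi : 1 < q^-1 by rewrite invf_gt1.
have E0 : 0 <= Ex M (fun l => X l `^ q) n by apply: Ex_ge0 => l; exact: powR_ge0.
have := Ex_jensen M n qi (fun l => powR_ge0 (X l) q).
have -> : Ex M (fun l => (X l `^ q) `^ q^-1) n = Ex M X n.
  by apply: Ex_eq => l _; rewrite -powRrM mulfV ?powRr1// gt_eqF.
move=> /(ge0_ler_powR (ltW q0)); rewrite !nnegrE -powRrM mulVf ?gt_eqF// powRr1//.
by apply; rewrite ?powR_ge0// Ex_ge0.
Qed.

(* [copies s x] starts a copy of the chain [x] at every node of level [s]. *)
Definition copies s x n : R[i] :=
  let k := trunc_log 2 n in
  if (s <= k)%N && (2 ^ (k - s) %| n)%N then x (k - s)%N else 0.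

Lemma trunc_log_mul2X m n : (0 < n)%N -> trunc_log 2 (2 ^ m * n) = (m + trunc_log 2 n)%N.
Proof.
move=> n0; apply: trunc_log_eq => //.
have := trunc_logP (isT : (1 < 2)%N) n0; have := @trunc_log_ltn 2 n isT.
by rewrite -addnS !expnD !leq_mul2l ltn_mul2l expn_gt0 /= => -> ->; rewrite orbT.
Qed.

(** The chain of an odd node of level k <= s meets level s exactly once, so there [copies s x] is
    [x] delayed by s - k; multiplication by a power series commutes with delays. On a chain starting
    below level s both sides vanish. *)
Lemma conv_copies c s x n : (0 < n)%N ->
  conv c (copies s x) n = copies s (cauchy c x) n.
Proof.
move=> n0; have [m [r [rodd ->]]] := odd_part n0.
have r0 : (0 < r)%N by case: r rodd {n0}.
set k := trunc_log 2 r.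
have E (z : nat -> R[i]) i : copies s z (2 ^ i * r) =
    if (k <= s <= k + i)%N then z (k + i - s)%N else 0.
  rewrite /copies trunc_log_mul2X// -/k addnC.
  case: (leqP s (k + i)) => si; rewrite ?andbF//= andbT.
  rewrite pfactor_dvdn ?muln_gt0 ?expn_gt0// logn2_odd//.
  by congr (if _ then _ else _); apply/idP/idP; lia.
rewrite conv_chain// (@eq_cauchy _ _ _ (fun i => if (k <= s <= k + i)%N then x (k + i - s)%N else 0)); last first.
  by move=> i _; rewrite E.
rewrite E; case: (leqP k s) => [ks|ks]; last first.
  by rewrite /cauchy big1// => i _; rewrite mulr0.
rewrite /cauchy /=; case: leqP => sm; last first.
  rewrite big1// => i _; rewrite ifF ?mulr0//; apply/negbTE; rewrite -ltnNge.
  by apply: leq_ltn_trans sm; rewrite leq_add2l leq_subr.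
have le : ((k + m - s).+1 <= m.+1)%N by lia.
rewrite [RHS](big_ord_widen _ (fun i => c i * x (k + m - s - i)%N) le) [RHS]big_mkcond.
apply: eq_bigr => i _; have := ltn_ord i; rewrite !ltnS => im.
case: leqP => h; case: leqP => h' //; rewrite ?mulr0//; first by congr (_ * x _); lia.
  by exfalso; lia.
by exfalso; lia.
Qed.

(** Divisibility by 2^m means that the last m steps of the descent all go left. *)
Lemma Ex_dvd m n : Ex m (fun l => (2 ^ m %| l)%N%:R) n = 2 ^- m :> R.
Proof.
elim: m n => [|m IH] n; first by rewrite Ex0 expn0 dvd1n expr0 invr1.
rewrite ExSr exprS invfM -(IH n) -ExZ; apply: Ex_eq => l _.
have h1 : (2 ^ m.+1 %| l.*2)%N = (2 ^ m %| l)%N.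
  by rewrite expnS -mul2n dvdn_pmul2l.
have h2 : (2 ^ m.+1 %| l.*2.+1)%N = false.
  apply/negP => /dvdnP[k]; rewrite expnS mulnCA.
  by move: (k * 2 ^ m)%N => t; lia.
by rewrite /avg2 h1 h2 addr0 mulrC.
Qed.

(** The copies live on disjoint intervals filling level [s], so their mean energy is that of one
    chain. *)
Lemma l2_copies s x M : l2 M (copies s x) = wnorm x (M - s).
Proof.
rewrite l2E /wnorm; elim: M => [|M IH]; first by rewrite sub0n !big_ord0.
rewrite big_ord_recr IH /=; case: (leqP s M) => sM; last first.
  have -> : (M.+1 - s = 0)%N by lia. have -> : (M - s = 0)%N by lia.
  rewrite !big_ord0 add0r -[RHS](Ex_cst M 0 1); apply: Ex_eq => l lM.
  by rewrite /copies (lev_div lM) (leqNgt s) sM cabs0 expr0n.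
rewrite subSn// big_ord_recr/=; congr (_ + _).
transitivity (Ex s (fun n => Ex (M - s) (fun l => cabs (x (M - s)%N) ^+ 2 *
    (2 ^ (M - s) %| l)%N%:R) n) 1); last first.
  rewrite mulrC -[RHS](Ex_cst s _ 1).
  by apply: Ex_eq => l _; rewrite ExZ Ex_dvd.
rewrite -[X in Ex X _ _ = _](subnKC sM) Ex_add.
rewrite -!Ex_add; apply: Ex_eq => l; rewrite subnKC// => lM.
rewrite /copies (lev_div lM) sM; case: (_ %| _)%N; rewrite ?mulr1 ?mulr0//.
by rewrite cabs0 expr0n.
Qed.

(** * Values taken by the copies of a chain *)

(** The value of the chain sum after [m] steps to the left. *)
Definition psum y m : R[i] := \sum_(i < m) y i.

Lemma psumS y m : psum y m.+1 = psum y m + y m.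
Proof. by rewrite /psum big_ord_recr. Qed.

(* The last [j] digits of [l] describe a descent of [j] steps, which leaves the
   chain of left children at the first digit 1: [firstone y j l] is the squared
   value that a Haar sum along this chain, with coefficients [y], takes there. *)
Fixpoint firstone y j l : R :=
  if j is j'.+1 then firstone y j' l./2 +
    (odd l && (2 ^ j' %| l./2)%N)%:R * cabs (psum y j' - y j') ^+ 2
  else 0.

Lemma firstone_dvd y j l : (2 ^ j %| l)%N -> firstone y j l = 0.
Proof.
elim: j l => [//|j IH] l /=.
move=> /dvdnP[k ->]; rewrite expnS mulnCA mul2n doubleK odd_double mul0r addr0.
by rewrite IH// dvdn_mull.
Qed.

Lemma firstone_ge0 y j l : 0 <= firstone y j l.
Proof. by elim: j l => [//|j IH] l /=; rewrite addr_ge0 ?IH// mulr_ge0 ?sqr_ge0 ?ler0n. Qed.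

Lemma firstone_le y j l : firstone y j l <= \sum_(i < j) cabs (psum y i - y i) ^+ 2.
Proof.
elim: j l => [|j IH] l /=; first by rewrite big_ord0.
by rewrite big_ord_recr lerD//= ler_piMl ?sqr_ge0// lern1 leq_b1.
Qed.

(** The energy on the paths that have left the chain within [j] steps: leaving at step i has
    probability 2^-(i+1). *)
Definition vmass y j : R := \sum_(i < j) 2 ^- i.+1 * cabs (psum y i - y i) ^+ 2.

Lemma Ex_firstone y j n : Ex j (firstone y j) n = vmass y j.
Proof.
elim: j n => [|j IH] n; first by rewrite /vmass big_ord0.
rewrite /vmass big_ord_recr -/(vmass y j) -(IH n) ExSr.
transitivity (Ex j (fun l => firstone y j l +
    (2^-1 * cabs (psum y j - y j) ^+ 2) * (2 ^ j %| l)%N%:R) n).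
  apply: Ex_eq => l _; rewrite /avg2 /= odd_double doubleK uphalf_double /=.
  by field.
by rewrite ExD ExZ Ex_dvd (exprS 2 j) invfM /=; congr (_ + _); ring.
Qed.

Lemma val_copies_lvl s y l : (l %/ 2 ^ s = 1)%N -> val s (copies s y) l = 0.
Proof.
move=> ls; rewrite -[RHS](val0 R s l); apply: eq_val => j /andP[j0 js].
rewrite /copies (@lev_div (s - j)); last by rewrite -divnMA -expnD subnKC.
by rewrite leqNgt ifF//; apply/negbTE; rewrite negb_and negbK; apply/orP; left; lia.
Qed.

Lemma val_copies_left s y j l : (l %/ 2 ^ (s + j) = 1)%N -> (2 ^ j %| l)%N ->
  val (s + j) (copies s y) l = psum y j.
Proof.
elim: j l => [|j IH] l.
  by rewrite addn0 => ls _; rewrite val_copies_lvl// /psum big_ord0.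
move=> ls /dvdnP[k lk]; rewrite addnS psumS.
have lE : l = (k * 2 ^ j)%N.*2 by rewrite lk expnS mulnCA mul2n.
have lj : (k * 2 ^ j %/ 2 ^ (s + j) = 1)%N.
  by move: ls; rewrite lE -mul2n addnS expnS divnMl.
rewrite lE val_double IH ?dvdn_mull//; congr (_ + _).
by rewrite /copies (lev_div lj) leq_addr addKn dvdn_mull.
Qed.

Lemma val_copies_firstone s y j l : (l %/ 2 ^ (s + j) = 1)%N -> ~~ (2 ^ j %| l)%N ->
  cabs (val (s + j) (copies s y) l) ^+ 2 = firstone y j l.
Proof.
elim: j l => [|j IH] l; first by rewrite expn0 dvd1n.
move=> ls ndv.
have lj : (l./2 %/ 2 ^ (s + j) = 1)%N.
  by rewrite -divn2 -divnMA -expnS -addnS.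
rewrite addnS /=; case: (boolP (2 ^ j %| l./2)%N) => dj; last first.
  rewrite andbF mul0r addr0 -IH// /copies (lev_div lj) leq_addr addKn (negbTE dj).
  by rewrite oppr0 if_same addr0.
have ol : odd l.
  apply: contraNT ndv => /negbTE el; rewrite -(odd_double_half l) el add0n.
  by rewrite -mul2n expnS dvdn_pmul2l.
rewrite ol firstone_dvd// add0r mul1r val_copies_left//.
by rewrite /copies (lev_div lj) leq_addr addKn dj.
Qed.

(** Copies start at level [s] only, so a path that has left its copy meets no further nonzero
    coefficient. *)
Lemma val_copies_below s y j i l : (l %/ 2 ^ (s + j + i) = 1)%N ->
  ~~ (2 ^ j %| l %/ 2 ^ i)%N ->
  val (s + j + i) (copies s y) l = val (s + j) (copies s y) (l %/ 2 ^ i).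
Proof.
elim: i l => [|i IH] l; first by rewrite expn0 divn1 addn0.
move=> ls; have lj : (l./2 %/ 2 ^ (s + j + i) = 1)%N.
  by rewrite -divn2 -divnMA -expnS -addnS.
rewrite expnS divnMA divn2 => nd; rewrite addnS /= IH//.
suff -> : copies s y l./2 = 0 by rewrite oppr0 if_same addr0.
rewrite /copies (lev_div lj) ifF//.
apply/negbTE; apply: contra nd => /andP[_ /dvdnP[k ->]].
by rewrite -addnA addKn expnD mulnA mulnK ?expn_gt0// dvdn_mull.
Qed.

(** The left side depends on one block of [j] digits only, at the price of counting 0 for paths
    still on the chain; this makes the contributions of successive blocks independent. *)
Lemma firstone_le_val s y j i l : (l %/ 2 ^ (s + j + i) = 1)%N ->
  firstone y j (l %/ 2 ^ i) <= cabs (val (s + j + i) (copies s y) l) ^+ 2.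
Proof.
move=> ls; have [dv|ndv] := boolP (2 ^ j %| l %/ 2 ^ i)%N.
  by rewrite firstone_dvd// sqr_ge0.
rewrite val_copies_below// val_copies_firstone//.
by rewrite -divnMA -expnD addnC.
Qed.

(** * Sums over independent blocks of digits *)

(** For a leaf [l] of level [K * La], the term of index [i] is read at the ancestor of level
    [(i + 1) * La], the end of the i-th block. *)
Definition blocksum (W : nat -> R) La K l : R :=
  \sum_(i < K) W (l %/ 2 ^ ((K - i.+1) * La))%N.

Lemma blocksumS W La K l :
  blocksum W La K.+1 l = blocksum W La K (l %/ 2 ^ La)%N + W l.
Proof.
rewrite /blocksum big_ord_recr/= subnn mul0n expn0 divn1; congr (_ + _).
apply: eq_bigr => i _; rewrite -divnMA -expnD; congr (W (_ %/ 2 ^ _)%N).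
by rewrite -mulSn; congr (_ * _)%N; have := ltn_ord i; lia.
Qed.

(* The summands of [blocksum] are independent with mean [m] and bounded by [B]. *)
Lemma blocksum_moments W La K (m B : R) : (forall l, 0 <= W l) ->
  (forall l, W l <= B) -> (forall n, Ex La W n = m) ->
  Ex (K * La) (blocksum W La K) 1 = K%:R * m /\
  Ex (K * La) (fun l => blocksum W La K l ^+ 2) 1 <=
    (K%:R * m) ^+ 2 + K%:R * (B * m).
Proof.
move=> W0 WB Wm; elim: K => [|K [IH1 IH2]].
  rewrite mul0n !Ex0 /blocksum !big_ord0 !mul0r; split => //.
  by rewrite !expr0n/= addr0.
have step l n : (l %/ 2 ^ La = n)%N ->
    blocksum W La K.+1 l = blocksum W La K n + W l.
  by move=> <-; rewrite blocksumS.
rewrite mulSn addnC !Ex_add; split.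
  transitivity (Ex (K * La) (fun n => blocksum W La K n + m) 1).
    apply: Ex_eq => n _; rewrite (Ex_eq (fun l => @step l n)) ExD Ex_cst.
    by rewrite Wm.
  by rewrite ExD Ex_cst IH1 -[K.+1%:R]natr1 mulrDl mul1r.
apply: (@le_trans _ _ (Ex (K * La) (fun n => blocksum W La K n ^+ 2 +
    (2 * m) * blocksum W La K n + B * m) 1)).
  apply: Ex_le => n _.
  apply: (@le_trans _ _ (Ex La (fun l => blocksum W La K n ^+ 2 +
      (2 * blocksum W La K n) * W l + B * W l) n)).
    apply: Ex_le => l /step ->; rewrite sqrrD lerD//.
      by rewrite lerD2l -mulr_natl mulrA.
    by rewrite expr2 ler_wpM2r.
  by rewrite !ExD !ExZ Ex_cst Wm mulrAC.
rewrite !ExD !ExZ Ex_cst IH1 -[K.+1%:R]natr1.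
have -> : (K%:R + 1) * m = K%:R * m + m by ring.
rewrite mulrDl mul1r; have := sqr_ge0 m.
have -> : (K%:R * m + m) ^+ 2 = (K%:R * m) ^+ 2 + 2 * m * (K%:R * m) + m ^+ 2 by ring.
lra.
Qed.

(** A quantitative law of large numbers: once K m >= B, the second moment is at most twice (K m)^2,
    and the quadratic minorant at scale 2 K m gives 1/2 - 1/4 = 1/4. *)
Lemma blocksum_powR_ge q W La (m B : R) : 2^-1 <= q -> q <= 1 -> 0 < m ->
  (forall l, 0 <= W l) -> (forall l, W l <= B) -> (forall n, Ex La W n = m) ->
  exists2 K, (0 < K)%N &
    4^-1 * (K%:R * m) `^ q <= Ex (K * La) (fun l => blocksum W La K l `^ q) 1.
Proof.
move=> q0 q1 m0 W0 WB Wm; pose K := (Num.truncn (B / m)).+1; exists K => //.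
have [E1 E2] := blocksum_moments K W0 WB Wm.
have B0 : 0 <= B by rewrite (le_trans (W0 0%N)).
have BK : B <= K%:R * m by rewrite -ler_pdivrMr// ltW// truncnS_gt.
have K0 : 0 < K%:R * m by rewrite mulr_gt0// ltr0n.
set k := K%:R * m in E1 E2 BK K0 *.
have s0 : 0 < 2 * k by rewrite mulr_gt0.
apply: (@le_trans _ _ (Ex (K * La) (fun l => (2 * k) `^ q *
   ((2 * k)^-1 * blocksum W La K l - ((2 * k) ^- 2 / 2) * blocksum W La K l ^+ 2)) 1)).
  rewrite ExZ ExB !ExZ E1 powRM ?(ltW K0)// mulrC.
  have h2 : 1 <= 2 `^ q :> R.
    by rewrite -[X in X <= _](powRr0 2) ler_powR//; lra.
  apply: ler_pM; rewrite ?powR_ge0 ?invr_ge0//.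
    by rewrite ler_peMl ?powR_ge0.
  apply: (@le_trans _ _ ((2 * k)^-1 * k - (2 * k) ^- 2 / 2 * (2 * k ^+ 2))).
    by rewrite le_eqVlt; apply/orP; left; apply/eqP; field; lra.
  rewrite lerD2l lerN2 ler_wpM2l//.
    by rewrite mulr_ge0 ?invr_ge0 ?sqr_ge0.
  rewrite (le_trans E2)// mulr2n mulrDl mul1r lerD2l.
  by rewrite mulrCA expr2 ler_wpM2r// ltW.
apply: Ex_le => l _; set z := blocksum _ _ _ _.
have z0 : 0 <= z by apply: sumr_ge0 => i _; exact: W0.
apply: le_trans (powR_rescale q0 q1 s0 z0).
by rewrite ler_wpM2l ?powR_ge0// le_eqVlt; apply/orP; left; apply/eqP; field; lra.
Qed.

End Chains.

(** * From the L^p bound to the L^2 bound on a chain *)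

Section BdChain.
Local Open Scope classical_set_scope.
Variable R : realType.
Implicit Types (p q : R) (a c x y : nat -> R[i]) (D X : R).

Definition bd_at p c D := forall M a,
  Ex M (fun l => cabs (val M (conv c a) l) `^ p) 1 <=
  D * Ex M (fun l => cabs (val M a l) `^ p) 1.

Lemma sqr_powR_half (z p : R) : 0 <= z -> (z ^+ 2) `^ (p / 2) = z `^ p.
Proof. by move=> z0; rewrite -(powR_mulrn 2)// -powRrM mulrC divfK. Qed.

(** [K] copies with random signs compare (K m)^(p/2) with (K X)^(p/2), so that [K] cancels. The
    constant 24 is 4 from [blocksum_powR_ge] times 6 from [khinchine]. *)
Lemma bd_vmass p c D x X La : 1 < p -> p < 2 -> 0 <= D -> bd_at p c D ->
  (forall N, wnorm x N <= X) ->
  vmass (cauchy c x) La <= (24 * D) `^ (p / 2)^-1 * X.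
Proof.
move=> p1 p2 D0 HD xX; set y := cauchy c x; set m := vmass y La.
have X0 : 0 <= X by rewrite (le_trans _ (xX 0%N)) ?wnorm_ge0.
have [m0|m0] := leP m 0; first by rewrite (le_trans m0) ?mulr_ge0 ?powR_ge0.
pose q := p / 2.
have q0 : 0 < q by rewrite divr_gt0//; lra.
have q1 : q < 1 by rewrite ltr_pdivrMr//; lra.
have qh : 2^-1 <= q by rewrite /q; lra.
have [K K0 HK] := blocksum_powR_ge qh (ltW q1) m0 (firstone_ge0 y La)
  (firstone_le y La) (Ex_firstone y La).
pose F i := copies (i * La) x.
have lower : Ex (K * La) (fun l => blocksum (firstone y La) La K l `^ q) 1 <=
    6 * Ex (K * La) (fun l => Ex K (fun e => cabs (val (K * La)
      (conv c (fun n => rad K (fun i => F i n) e)) l) `^ p) 1) 1.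
  rewrite -ExZ; apply: Ex_le => l lM.
  rewrite -ler_pdivrMl//.
  have -> : Ex K (fun e => cabs (val (K * La)
      (conv c (fun n => rad K (fun i => F i n) e)) l) `^ p) 1 =
     Ex K (fun e => cabs (rad K (fun i => val (K * La) (copies (i * La) y) l) e) `^ p) 1.
    apply: Ex_eq => e _; congr (cabs _ `^ p); rewrite -val_rad.
    apply: eq_val => j jM; rewrite conv_rad; congr rad; apply/funext => i.
    rewrite conv_copies// divn_gt0 ?expn_gt0//.
    have := leq_trunc_div l (2 ^ (K * La)); rewrite lM mul1n; apply: leq_trans.
    by rewrite leq_exp2l//; case/andP: jM.
  apply: le_trans (khinchine K (fun i => val (K * La) (copies (i * La) y) l) (ltW p1) (ltW p2)).
  rewrite ler_wpM2l ?invr_ge0// ge0_ler_powR ?(ltW q0) ?nnegrE//.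
  - by apply: sumr_ge0 => i _; exact: firstone_ge0.
  - by apply: sumr_ge0 => i _; exact: sqr_ge0.
  apply: ler_sum => i _.
  have KE : (i * La + La + (K - i.+1) * La = K * La)%N.
    by rewrite -mulSnr -mulnDl subnKC.
  have := @firstone_le_val _ (i * La) y La ((K - i.+1) * La) l.
  by rewrite KE; apply.
have upper : Ex (K * La) (fun l => Ex K (fun e => cabs (val (K * La)
      (fun n => rad K (fun i => F i n) e) l) `^ p) 1) 1 <= (K%:R * X) `^ q.
  have step l : Ex K (fun e => cabs (val (K * La)
      (fun n => rad K (fun i => F i n) e) l) `^ p) 1 <=
      (\sum_(i < K) cabs (val (K * La) (F i) l) ^+ 2) `^ q.
    rewrite -(rad2 K (fun i => val (K * La) (F i) l)); apply: le_trans (Ex_powR_le _ _ q0 q1 _); last first.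
      by move=> e; exact: sqr_ge0.
    by apply: Ex_le => e _; rewrite sqr_powR_half ?cabs_ge0// val_rad.
  apply: (le_trans (Ex_le (fun l _ => step l))).
  apply: (le_trans (Ex_powR_le _ _ q0 q1 _)).
    by move=> l; apply: sumr_ge0 => i _; exact: sqr_ge0.
  rewrite Ex_sum ge0_ler_powR ?(ltW q0) ?nnegrE ?mulr_ge0//.
    by apply: sumr_ge0 => i _; apply: Ex_ge0 => l; exact: sqr_ge0.
  apply: (@le_trans _ _ (\sum_(i < K) X)); last by rewrite sumr_const card_ord mulr_natl.
  apply: ler_sum => i _; rewrite -/(l2 (K * La) (F i)) l2_copies; exact: xX.
have bound : (K%:R * m) `^ q <= 24 * D * (K%:R * X) `^ q.
  rewrite ler_pdivrMl// in HK.
  have -> : 24 * D * (K%:R * X) `^ q = 4 * (6 * (D * (K%:R * X) `^ q)) by ring.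
  apply: (le_trans HK); rewrite ler_wpM2l//.
  apply: (le_trans lower); rewrite ler_wpM2l//.
  apply: (@le_trans _ _ (D * Ex (K * La) (fun l => Ex K (fun e => cabs (val (K * La)
      (fun n => rad K (fun i => F i n) e) l) `^ p) 1) 1)); last by rewrite ler_wpM2l.
  (* After exchanging the means, the hypothesis on [c] applies for each fixed choice of signs. *)
  rewrite Ex_exchange [X in _ <= _ * X]Ex_exchange -ExZ.
  by apply: Ex_le => e _; exact: HD.
have Kp : 0 < K%:R :> R by rewrite ltr0n.
have {}bound : m `^ q <= 24 * D * X `^ q.
  move: bound; rewrite !powRM ?ler0n ?(ltW m0)// mulrCA ler_pM2l//.
  exact: powR_gt0.
have := ge0_ler_powR (_ : 0 <= q^-1) _ _ bound.
rewrite invr_ge0 !nnegrE (ltW q0) powR_ge0 !mulr_ge0 ?powR_ge0//.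
move=> /(_ isT isT isT).
by rewrite powRM ?mulr_ge0 ?powR_ge0// -!powRrM mulfV ?gt_eqF// !powRr1// ltW.
Qed.

(** Only the leftmost leaf is retained, of weight 2^-M and value [psum]. The bound is crude, but it
    reaches the energy that [bd_vmass] does not see. *)
Lemma bd_psum p c D x X M : 1 < p -> p < 2 -> 0 <= D -> bd_at p c D ->
  (forall N, wnorm x N <= X) ->
  2 ^- M * cabs (psum (cauchy c x) M) `^ p <= D * X `^ (p / 2).
Proof.
move=> p1 p2 D0 HD xX; set y := cauchy c x.
pose q := p / 2.
have q0 : 0 < q by rewrite divr_gt0//; lra.
have q1 : q < 1 by rewrite ltr_pdivrMr//; lra.
have X0 : 0 <= X by rewrite (le_trans _ (xX 0%N)) ?wnorm_ge0.
apply: (@le_trans _ _ (Ex M (fun l => cabs (val M (conv c (copies 0 x)) l) `^ p) 1)).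
  rewrite mulrC -(Ex_dvd R M 1) -ExZ; apply: Ex_le => l lM.
  have -> : val M (conv c (copies 0 x)) l = val M (copies 0 y) l.
    apply: eq_val => j jM; rewrite conv_copies// divn_gt0 ?expn_gt0//.
    have := leq_trunc_div l (2 ^ M); rewrite lM mul1n; apply: leq_trans.
    by rewrite leq_exp2l//; case/andP: jM.
  have [dv|_] := boolP (2 ^ M %| l)%N; last by rewrite mulr0 powR_ge0.
  by rewrite mulr1 -(@val_copies_left _ 0 y M l)// add0n.
apply: (le_trans (HD _ _)); rewrite ler_wpM2l//.
apply: (@le_trans _ _ (Ex M (fun l => (cabs (val M (copies 0 x) l) ^+ 2) `^ q) 1)).
  by apply: Ex_le => l _; rewrite sqr_powR_half ?cabs_ge0.
apply: (le_trans (Ex_powR_le _ _ q0 q1 _)); first by move=> l; exact: sqr_ge0.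
rewrite ge0_ler_powR ?(ltW q0) ?nnegrE//.
  by apply: Ex_ge0 => l; exact: sqr_ge0.
by rewrite -/(l2 M (copies 0 x)) l2_copies.
Qed.

Lemma wnorm_vmass y L :
  wnorm y L = vmass y L + 2 ^- L * cabs (psum y L) ^+ 2.
Proof.
elim: L => [|L IH].
  by rewrite /wnorm /vmass /psum !big_ord0 cabs0 expr0n/= mulr0 addr0.
rewrite /wnorm big_ord_recr -/(wnorm y L) IH /vmass big_ord_recr -/(vmass y L) psumS.
rewrite /= -!addrA; congr (_ + _); rewrite (exprS 2 L) invfM.
have := cabs_parallelogram (psum y L) (y L).
set A := cabs (_ + _) ^+ 2; set B := cabs (_ - _) ^+ 2 => H.
have -> : B = 2 * (cabs (psum y L) ^+ 2 + cabs (y L) ^+ 2) - A by lra.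
by field.
Qed.

Lemma geometric_le0 (z k r : R) (L : nat) : 0 <= r -> r < 1 ->
  (forall M, (L <= M)%N -> z <= k * r ^+ M) -> z <= 0.
Proof.
move=> r0 r1 H; have : (fun M => k * r ^+ M) @ \oo --> k * 0.
  by apply: cvgM; [exact: cvg_cst|apply: cvg_expr; rewrite ger0_norm].
rewrite mulr0 => cv; rewrite -(cvg_lim _ cv)//; apply: limr_ge; first exact: cvgP cv.
by near=> M; apply: H; near: M; exact: nbhs_infty_ge.
Unshelve. all: by end_near. Qed.

(** By [wnorm_vmass] it remains to bound the energy still on the chain by 9 A, whence 10 = 1 + 9. As
    2 S_M = S_(M+1) + (S_M - y_M), with the last term controlled by [vmass], the quantity z_M = 2^-M
    |S_M| drops by at most a th^(M+1) at each step; since it tends to 0, its value is at most the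
    sum of the later drops. *)
Lemma bd_wnorm p c D x X : 1 < p -> p < 2 -> 0 <= D -> bd_at p c D ->
  (forall N, wnorm x N <= X) ->
  forall N, wnorm (cauchy c x) N <= 10 * (24 * D) `^ (p / 2)^-1 * X.
Proof.
move=> p1 p2 D0 HD xX N; set y := cauchy c x; set A := (24 * D) `^ (p / 2)^-1 * X.
have X0 : 0 <= X by rewrite (le_trans _ (xX 0%N)) ?wnorm_ge0.
have A0 : 0 <= A by rewrite mulr_ge0 ?powR_ge0.
have vA La : vmass y La <= A by exact: bd_vmass.
rewrite wnorm_vmass -mulrA -/A.
suff : 2 ^- N * cabs (psum y N) ^+ 2 <= 9 * A by have := vA N; lra.
pose th : R := Num.sqrt 2^-1.
have th2 : th ^+ 2 = 2^-1 by rewrite sqr_sqrtr ?invr_ge0.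
have th0 : 0 <= th by exact: sqrtr_ge0.
(* This gives th / (1 - th) <= 3, so the drops from [N] on sum to at most 3 a th^N; the square of 3
   is the 9 above. *)
have th1 : th <= 3 / 4.
  by rewrite -ler_sqr ?nnegrE ?divr_ge0// th2; lra.
pose a := Num.sqrt A.
have a2 : a ^+ 2 = A by rewrite sqr_sqrtr.
have a0 : 0 <= a by exact: sqrtr_ge0.
pose z M := 2 ^- M * cabs (psum y M).
have z0 M : 0 <= z M by rewrite mulr_ge0 ?invr_ge0 ?exprn_ge0 ?cabs_ge0.
have thM M : (th ^+ M) ^+ 2 = 2 ^- M by rewrite -exprM mulnC exprM th2 exprVn.
have vb M : 2 ^- M.+1 * cabs (psum y M - y M) <= a * th ^+ M.+1.
  rewrite -ler_sqr ?nnegrE ?mulr_ge0 ?invr_ge0 ?exprn_ge0 ?cabs_ge0//.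
  have := vA M.+1; rewrite /vmass big_ord_recr /= => H.
  have : 2 ^- M.+1 * cabs (psum y M - y M) ^+ 2 <= A.
    apply: le_trans H; rewrite lerDr sumr_ge0// => i _.
    by rewrite mulr_ge0 ?sqr_ge0 ?invr_ge0 ?exprn_ge0.
  move=> {}H; rewrite !exprMn a2 thM expr2 -mulrA mulrC.
  by rewrite ler_wpM2r// invr_ge0 exprn_ge0.
have zS M : z M <= z M.+1 + a * th ^+ M.+1.
  apply: le_trans (lerD (lexx _) (vb M)).
  have -> : z M = 2 ^- M.+1 * (2 * cabs (psum y M)).
    by rewrite /z (exprS 2 M) invfM; field.
  rewrite /z -mulrDr psumS ler_wpM2l ?invr_ge0 ?exprn_ge0//.
  have -> : 2 * cabs (psum y M) = cabs (psum y M + y M + (psum y M - y M)).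
    by rewrite mulr_natl /cabs -normcMn; congr Normc.normc; ring.
  exact: cabsD.
have tele M : (N <= M)%N -> z N <= z M + 3 * a * (th ^+ N - th ^+ M).
  elim: M => [|M IH]; first by rewrite leqn0 => /eqP ->; rewrite subrr mulr0 addr0.
  rewrite leq_eqVlt => /predU1P[->|]; first by rewrite subrr mulr0 addr0.
  rewrite ltnS => /IH; have := zS M; rewrite exprS.
  have : 0 <= a * th ^+ M by rewrite mulr_ge0 ?exprn_ge0.
  have -> : a * (th * th ^+ M) = th * (a * th ^+ M) by ring.
  have -> : 3 * a * (th ^+ N - th ^+ M) = 3 * (a * th ^+ N) - 3 * (a * th ^+ M) by ring.
  have -> : 3 * a * (th ^+ N - th * th ^+ M) =
    3 * (a * th ^+ N) - 3 * (th * (a * th ^+ M)) by ring.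
  move: (a * th ^+ M) (a * th ^+ N) => u v u0; nra.
(* [bd_psum] gives |S_M| = O(2^(M/p)), hence z_M = O(rho^M). *)
pose rho : R := 2 `^ (p^-1 - 1).
have pi : p^-1 < 1 by rewrite invf_lt1//; lra.
have pi0 : 0 < p^-1 by rewrite invr_gt0; lra.
have rho1 : rho < 1.
  rewrite /rho -(opprB 1) powRN invf_lt1 ?powR_gt0//.
  rewrite -[X in X < _](powRr0 2).
  have := @gt0_ltr_powR R (1 - p^-1) _ 1 2; rewrite powR1 powRr0; apply; rewrite ?nnegrE; lra.
have zM M : z M <= (D * X `^ (p / 2)) `^ p^-1 * rho ^+ M.
  have := bd_psum M p1 p2 D0 HD xX; rewrite -/y.
  move=> /(ge0_ler_powR (ltW pi0)); rewrite !nnegrE !mulr_ge0 ?powR_ge0 ?invr_ge0 ?exprn_ge0//.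
  move=> /(_ isT isT); rewrite [X in X <= _]powRM ?powR_ge0 ?invr_ge0 ?exprn_ge0//.
  have -> : (cabs (psum y M) `^ p) `^ p^-1 = cabs (psum y M).
    by rewrite -powRrM mulfV ?(powRr1 (cabs_ge0 _))// gt_eqF//; lra.
  move=> H.
  have rE : rho ^+ M = ((2 ^- M) `^ p^-1)^-1 * 2 ^- M.
    rewrite /rho powRB; last by rewrite pnatr_eq0 implybT.
    rewrite powRr1// exprMn exprVn; congr (_ * _).
    rewrite -powR_invn// -powRrM mulNr powRN invrK -powR_mulrn ?powR_ge0//.
    by rewrite -powRrM mulrC.
  rewrite rE mulrA /z mulrC ler_wpM2r ?invr_ge0 ?exprn_ge0//.
  rewrite ler_pdivlMr ?powR_gt0 ?invr_gt0 ?exprn_gt0//.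
  by rewrite mulrC.
have zN : z N - 3 * a * th ^+ N <= 0.
  apply: (@geometric_le0 _ ((D * X `^ (p / 2)) `^ p^-1) rho N) => //; first exact: powR_ge0.
  move=> M NM; have := tele M NM; have := zM M.
  have : 0 <= a * th ^+ M by rewrite mulr_ge0 ?exprn_ge0.
  have -> : 3 * a * (th ^+ N - th ^+ M) = 3 * a * th ^+ N - 3 * (a * th ^+ M) by ring.
  lra.
have {}zN : z N ^+ 2 <= (3 * a * th ^+ N) ^+ 2.
  have h : 0 <= 3 * a * th ^+ N by rewrite !mulr_ge0// exprn_ge0.
  by rewrite ler_sqr ?nnegrE//; lra.
move: zN; rewrite /z !exprMn a2 thM expr2 -mulrA mulrC.
rewrite ler_pM2r ?invr_gt0 ?exprn_gt0// mulrC => H.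
by apply: (le_trans H); lra.
Qed.

Lemma Bd_Bd2 p c : 1 < p -> p < 2 -> Bd p c -> Bd 2 c.
Proof.
move=> p1 p2 [D D0 HD]; apply: (@chain_Bd2 _ c (10 * (24 * D) `^ (p / 2)^-1)).
  by rewrite mulr_ge0 ?powR_ge0.
(* [bd_wnorm] needs a bound on the whole sequence; entries of index [N] and above do not affect the
   first [N] coefficients of the product. *)
move=> x N; pose x' m := if (m < N)%N then x m else 0.
have -> : wnorm (cauchy c x) N = wnorm (cauchy c x') N.
  apply: eq_bigr => i _; congr (_ * cabs _ ^+ 2); apply: eq_cauchy => j ji.
  by rewrite /x' (leq_ltn_trans ji).
apply: (bd_wnorm p1 p2 D0 HD) => M.
have bump k : (N <= k)%N -> wnorm x' k = wnorm x N.
  move=> Nk; rewrite -(subnKC Nk) /wnorm; elim: (k - N)%N => [|j IH].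
    by rewrite addn0; apply: eq_bigr => i _; rewrite /x' ltn_ord.
  have x0 : x' (N + j)%N = 0 by rewrite /x' ltnNge leq_addr.
  by rewrite addnS big_ord_recr IH [X in x' X]/= x0 cabs0 expr0n/= mulr0 addr0.
have [NM|MN] := leqP N M; first by rewrite bump.
rewrite -(bump N)// /wnorm -(subnKC (ltnW MN)) big_split_ord lerDl sumr_ge0// => i _.
by rewrite mulr_ge0 ?sqr_ge0 ?invr_ge0 ?exprn_ge0.
Qed.

End BdChain.

(** * Haar sums as functions on the interval *)

Section Dyadic.
Variable R : realType.
Local Open Scope classical_set_scope.
Implicit Types (t : R) (n M k : nat) (a : nat -> R[i]).

Definition dy n : set R :=
  `](hj n)%:R / 2 ^+ hk n, (hj n).+1%:R / 2 ^+ hk n]%classic.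

Definition mid n : R := (hj n).*2.+1%:R / 2 ^+ (hk n).+1.

Lemma hk_double n : (0 < n)%N -> hk n.*2 = (hk n).+1.
Proof.
move=> n0; rewrite /hk trunc_log2S ?doubleK//.
by rewrite -addnn; case: n n0 => // n _; rewrite addSn addnS.
Qed.

Lemma hk_doubleS n : (0 < n)%N -> hk n.*2.+1 = (hk n).+1.
Proof.
move=> n0; rewrite /hk trunc_log2S ?uphalf_double//=.
  by rewrite uphalf_double.
by rewrite ltnS double_gt0.
Qed.

Lemma hj_double n : (0 < n)%N -> hj n.*2 = (hj n).*2.
Proof. by move=> n0; rewrite /hj hk_double// expnS mul2n doubleB. Qed.

Lemma hj_doubleS n : (0 < n)%N -> hj n.*2.+1 = (hj n).*2.+1.
Proof.
move=> n0; rewrite /hj hk_doubleS// expnS mul2n doubleB subSn//.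
by rewrite leq_double; exact: trunc_logP.
Qed.

Lemma dyE n t : dy n t = (((hj n)%:R < 2 ^+ hk n * t) && (2 ^+ hk n * t <= (hj n).+1%:R)) :> Prop.
Proof.
have h : 0 < 2 ^+ hk n :> R by rewrite exprn_gt0.
rewrite /dy /= in_itv /= ltr_pdivrMr// ler_pdivlMr//.
by rewrite [t * _]mulrC.
Qed.

Lemma midE n t : (mid n < t) = ((hj n).*2.+1%:R < 2 * (2 ^+ hk n * t)).
Proof. by rewrite /mid ltr_pdivrMr ?exprn_gt0// exprS mulrC mulrA. Qed.

Lemma dy_double n t : (0 < n)%N -> dy n.*2 t <-> dy n t /\ t <= mid n.
Proof.
move=> n0; rewrite !dyE hk_double// hj_double// exprS (leNgt t) midE -leNgt.
rewrite -addnn -!natr1 !natrD -!mulrA.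
move: ((hj n)%:R : R) (2 ^+ hk n * t) => j x.
split=> [/andP[? ?]|[/andP[? ?] ?]].
- split; last lra.
  by apply/andP; split; lra.
- by apply/andP; split; lra.
Qed.

Lemma dy_doubleS n t : (0 < n)%N -> dy n.*2.+1 t <-> dy n t /\ mid n < t.
Proof.
move=> n0; rewrite !dyE hk_doubleS// hj_doubleS// exprS midE.
rewrite -addnn -!natr1 !natrD -!mulrA.
move: ((hj n)%:R : R) (2 ^+ hk n * t) => j x.
split=> [/andP[? ?]|[/andP[? ?] ?]].
- split; last lra.
  by apply/andP; split; lra.
- by apply/andP; split; lra.
Qed.

Lemma dy1 : dy 1 = @Iset R.
Proof. by rewrite /dy /Iset /hj /hk /= expr0 !divr1. Qed.

Lemma dy_split n : (0 < n)%N -> dy n = dy n.*2 `|` dy n.*2.+1.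
Proof.
move=> n0; apply/seteqP; split => t.
  move=> nt; case: (ltP (mid n) t) => mt; [right; exact/dy_doubleS|left; exact/dy_double].
by move=> [/dy_double[]|/dy_doubleS[]].
Qed.

Lemma dy_disj n : (0 < n)%N -> [disjoint dy n.*2 & dy n.*2.+1].
Proof.
move=> n0; apply/disj_setPS => t [/(dy_double _ n0)[_ h] /(dy_doubleS _ n0)[_ h']].
by move: (lt_le_trans h' h); rewrite ltxx.
Qed.

Lemma measurable_dy n : measurable (dy n).
Proof. exact: measurable_itv. Qed.

Lemma mu_dy n : @lebesgue_measure R (dy n) = (2 ^- hk n)%:E.
Proof.
rewrite /dy lebesgue_measure_itv /= lte_fin ifT.
  by rewrite -EFinB -mulrBl -natr1 addrAC subrr add0r mul1r.
by rewrite ltr_pM2r ?invr_gt0 ?exprn_gt0// ltr_nat.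
Qed.

(** Bisection. It is total in [t], but only on I is it the index of the interval of level [M] that
    contains [t]. *)
Fixpoint leaf M t : nat :=
  if M is M'.+1 then ((leaf M' t).*2 + (mid (leaf M' t) < t)%R)%N else 1%N.

Lemma leaf_gt0 M t : (0 < leaf M t)%N.
Proof. by elim: M => [//|M IH] /=; rewrite addn_gt0 double_gt0 IH. Qed.

Lemma leaf_half M t : (leaf M.+1 t)./2 = leaf M t.
Proof. by rewrite /= addnC half_bit_double. Qed.

Lemma leaf_div M j t : (leaf (M + j) t %/ 2 ^ j)%N = leaf M t.
Proof.
elim: j => [|j IH]; first by rewrite addn0 expn0 divn1.
by rewrite addnS expnS divnMA divn2 leaf_half.
Qed.

Lemma leaf_div1 M t : (leaf M t %/ 2 ^ M = 1)%N.
Proof. by rewrite -[M in leaf M]add0n leaf_div. Qed.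

Lemma hk_leaf M t : hk (leaf M t) = M.
Proof. exact: lev_div (leaf_div1 M t). Qed.

Lemma dy_leaf M t : Iset t -> dy (leaf M t) t.
Proof.
move=> It; elim: M => [|M IH]; first by rewrite /= dy1.
rewrite /=; case: ltP => h; rewrite ?addn1 ?addn0.
  by apply/dy_doubleS => //; exact: leaf_gt0.
by apply/dy_double => //; exact: leaf_gt0.
Qed.

Lemma dy_half n t : (1 < n)%N -> dy n t -> dy n./2 t.
Proof.
move=> n1; have h0 : (0 < n./2)%N by rewrite half_gt0.
rewrite -{1}(odd_double_half n); case: odd; rewrite ?add1n ?add0n.
  by move=> /(dy_doubleS _ h0)[].
by move=> /(dy_double _ h0)[].
Qed.

Lemma leaf_dy n t : (0 < n)%N -> dy n t -> leaf (hk n) t = n.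
Proof.
have [N] := ubnP n; elim: N n => // N IH n nN n0 nt.
have [n1|n1] := ltnP 1 n; last by have -> : n = 1%N by lia.
have h0 : (0 < n./2)%N by rewrite half_gt0.
have hn : (n./2 < N)%N by lia.
have -> : hk n = (hk n./2).+1 by rewrite /hk trunc_log2S.
rewrite /= (IH _ hn h0 (dy_half n1 nt)); move: nt; rewrite -{1 4}(odd_double_half n); case: odd; rewrite ?add1n ?add0n.
  by move=> /(dy_doubleS _ h0)[_ ->]; rewrite addn1.
by move=> /(dy_double _ h0)[_]; rewrite leNgt => /negbTE ->; rewrite addn0.
Qed.

Lemma dy_I n t : (0 < n)%N -> dy n t -> Iset t.
Proof.
have [N] := ubnP n; elim: N n => // N IH n nN n0 nt.
have [n1|n1] := ltnP 1 n; last by rewrite -dy1; have <- : n = 1%N by lia.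
have h0 : (0 < n./2)%N by rewrite half_gt0.
have hn : (n./2 < N)%N by lia.
exact: (IH _ hn h0 (dy_half n1 nt)).
Qed.

Lemma dyP n t : (0 < n)%N -> Iset t -> dy n t <-> leaf (hk n) t = n.
Proof. by move=> n0 It; split => [/leaf_dy -> //|<-]; exact: dy_leaf. Qed.

Definition HP M a t : R[i] := val M a (leaf M t).

Lemma HPS M a t : HP M.+1 a t = HP M a t +
  (if mid (leaf M t) < t then - a (leaf M t) else a (leaf M t)).
Proof.
rewrite /HP; case: ltP => h.
  by rewrite [leaf M.+1 t]/= h addn1 val_doubleS.
by rewrite [leaf M.+1 t]/= (le_gtF h) addn0 val_double.
Qed.

Lemma HPD M a b t : HP M (fun n => a n + b n) t = HP M a t + HP M b t.
Proof. exact: valD. Qed.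

Lemma HPZ M r a t : HP M (fun n => r * a n) t = r * HP M a t.
Proof. exact: valZ. Qed.

Lemma HP_eq M a b t : (forall n, (0 < n)%N -> (hk n < M)%N -> a n = b n) -> HP M a t = HP M b t.
Proof.
move=> ab; elim: M ab => [//|M IH] ab; rewrite !HPS IH.
  by rewrite ab ?leaf_gt0// hk_leaf.
by move=> n n0 nM; apply: ab => //; exact: ltnW.
Qed.

Definition dirac1 n m : R[i] := if m == n then 1 else 0.

Lemma haar_dy n t : (0 < n)%N ->
  haar n t = if (leaf (hk n) t == n) && ((0 < t) && (t <= 1))
             then (if mid n < t then -1 else 1) else 0 :> R[i].
Proof.
move=> n0; rewrite /haar /dil.
have -> : ((0 < t) && (t <= 1)) = (t \in @Iset R).
  by rewrite mem_setE /Iset in_itv.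
have e1 : (0 < 2 ^+ hk n * t - (hj n)%:R) && (2 ^+ hk n * t - (hj n)%:R <= 1) =
    (leaf (hk n) t == n) && (t \in @Iset R).
  apply/idP/idP => [/andP[h1 h2]|/andP[/eqP ln /set_mem It]].
    have nt : dy n t by rewrite dyE -natr1; apply/andP; split; lra.
    by rewrite (leaf_dy n0 nt) eqxx mem_set//; exact: dy_I nt.
  have : dy n t by apply/dyP.
  by rewrite dyE -natr1 => /andP[? ?]; apply/andP; split; lra.
rewrite e1; case: ifP => // h; move: e1; rewrite h => /andP[h1 h2].
rewrite /haar0 h1 h2 midE -addnn -[(_ + _).+1%:R]natr1 natrD.
case: (ltP 2^-1) => h3; first by rewrite ifT//; lra.
by rewrite ifF//; apply/negbTE; rewrite -leNgt; lra.
Qed.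

Lemma HP_dirac M n t : (0 < n)%N -> Iset t ->
  HP M (dirac1 n) t = if (hk n < M)%N then haar n t else 0.
Proof.
move=> n0 It; have It' : (0 < t) && (t <= 1) by move: It; rewrite /Iset /= in_itv.
elim: M => [//|M IH]; rewrite HPS IH /dirac1 ltnS haar_dy// It' andbT.
have [hM|hM] := eqVneq (hk n) M.
  rewrite hM leqnn ltnn add0r.
  by case: eqP => [->//|_]; rewrite oppr0 if_same.
have -> : (leaf M t == n) = false.
  by apply/negP => /eqP E; move: hM; rewrite -E hk_leaf eqxx.
by rewrite oppr0 if_same addr0 [(hk n <= M)%N]leq_eqVlt (negbTE hM).
Qed.

End Dyadic.

(** * Integrals, dyadic averages and Haar coefficients *)

Section Averages.
Variable R : realType.
Local Open Scope classical_set_scope.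
Local Notation mu := (@mu R).
Local Notation I := (@Iset R).
Implicit Types (t : R) (n M k : nat) (a : nat -> R[i]) (p : R).
Implicit Types (g : R -> R) (f u v : R -> R[i]).

Lemma mI : measurable I. Proof. exact: measurable_itv. Qed.
Local Hint Extern 0 (measurable (@Iset _)) => exact: mI : core.
Local Hint Extern 0 (measurable (dy _)) => exact: measurable_dy : core.

Lemma integral_dy_cst (r : R) n :
  (\int[mu]_(t in @dy R n) r%:E)%E = (r * 2 ^- hk n)%:E.
Proof. by rewrite integral_cst//= mu_dy. Qed.

Lemma measurable_leaf d (T : measurableType d) (X : nat -> T) M :
  measurable_fun I (fun t => X (leaf M t)).
Proof.
rewrite -dy1; suff H k n : (0 < n)%N ->
    measurable_fun (@dy R n) (fun t => X (leaf (hk n + k) t)).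
  by have := H M 1%N isT; rewrite /hk/= add0n.
elim: k n => [|k IH] n n0.
  apply: (@eq_measurable_fun _ _ _ _ _ (fun=> X n)) => [t /set_mem nt|].
    by rewrite addn0 leaf_dy.
  exact: measurable_cst.
rewrite dy_split//; apply/measurable_funU => //; split.
  by have := IH n.*2; rewrite double_gt0 hk_double// addSnnS; apply.
by have := IH n.*2.+1; rewrite hk_doubleS// addSnnS; apply.
Qed.

(** The bridge between means over the tree and Lebesgue integrals, by induction on the distance to
    the leaves. *)
Lemma integral_leaf (X : nat -> R) M :
  (\int[mu]_(t in I) (X (leaf M t))%:E)%E = (Ex M X 1)%:E.
Proof.
suff H k n : (0 < n)%N ->
    (\int[mu]_(t in @dy R n) (X (leaf (hk n + k) t))%:E)%E = (2 ^- hk n * Ex k X n)%:E.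
  by have := H M 1%N isT; rewrite dy1 /hk/= add0n expr0 invr1 mul1r.
elim: k n => [|k IH] n n0.
  under eq_integral => t nt do rewrite addn0 (leaf_dy n0 (set_mem nt)).
  by rewrite integral_dy_cst mulrC.
rewrite [in LHS]dy_split// integral_setU//.
- have := IH n.*2; rewrite double_gt0 hk_double// addSnnS => -> //.
  have := IH n.*2.+1; rewrite hk_doubleS// addSnnS => -> //.
  by rewrite -EFinD ExS /avg2 (exprS 2 (hk n)) invfM; congr (_%:E); field.
- rewrite -dy_split//; apply/measurable_EFinP.
  apply: measurable_funS (measurable_leaf X (hk n + k.+1)) => // t.
  exact: dy_I.
- exact: dy_disj.
Qed.

Lemma integrable_leaf (X : nat -> R) M : mu.-integrable I (fun t => (X (leaf M t))%:E).
Proof.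
apply/integrableP; split; first by apply/measurable_EFinP; exact: (measurable_leaf X M).
by rewrite (integral_leaf (fun l => `|X l|)) ltry.
Qed.

Definition av g n : R := 2 ^+ hk n * fine (\int[mu]_(t in @dy R n) (g t)%:E)%E.

Lemma integrable_dy g n : (0 < n)%N -> mu.-integrable I (EFin \o g) ->
  mu.-integrable (@dy R n) (EFin \o g).
Proof. by move=> n0; apply: integrableS => // t; exact: dy_I. Qed.

Lemma avE g n : (0 < n)%N -> mu.-integrable I (EFin \o g) -> av g n = avg2 (av g) n.
Proof.
move=> n0 ig; rewrite /avg2 /av hk_double// hk_doubleS// [in LHS]dy_split//.
rewrite integral_setU//; last 2 first.
- by rewrite -dy_split//; apply: measurable_int (integrable_dy n0 ig).
- exact: dy_disj.
rewrite fineD; last 2 first.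
- by apply: integrable_fin_num => //; apply: integrable_dy => //; rewrite double_gt0.
- by apply: integrable_fin_num => //; exact: integrable_dy.
by rewrite exprS; field.
Qed.

Lemma av_Ex g M n : (0 < n)%N -> mu.-integrable I (EFin \o g) ->
  av g n = Ex M (av g) n.
Proof.
move=> n0 ig; elim: M n n0 => [//|M IH] n n0.
by rewrite ExS /avg2 -!IH// ?double_gt0// avE.
Qed.

Lemma av1 g : av g 1 = fine (\int[mu]_(t in I) (g t)%:E)%E.
Proof. by rewrite /av dy1 /hk/= expr0 mul1r. Qed.

Lemma eq_av g h n : (forall t, @dy R n t -> g t = h t) -> av g n = av h n.
Proof. by move=> gh; congr (_ * fine _); apply: eq_integral => t /set_mem /gh ->. Qed.

Lemma av_cst (r : R) n : av (fun=> r) n = r.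
Proof.
by rewrite /av integral_dy_cst /= mulrCA mulfV ?mulr1.
Qed.

Lemma avD g h n : (0 < n)%N -> mu.-integrable I (EFin \o g) ->
  mu.-integrable I (EFin \o h) -> av (fun t => g t + h t) n = av g n + av h n.
Proof.
move=> n0 ig ih; rewrite /av.
have [ig' ih'] := (integrable_dy n0 ig, integrable_dy n0 ih).
under eq_integral do rewrite EFinD.
by rewrite integralD// fineD ?mulrDr//; apply: integrable_fin_num.
Qed.

Lemma avZ g (r : R) n : (0 < n)%N -> mu.-integrable I (EFin \o g) ->
  av (fun t => r * g t) n = r * av g n.
Proof.
move=> n0 ig; rewrite /av; have ig' := integrable_dy n0 ig.
under eq_integral do rewrite EFinM.
rewrite integralZl// fineM//; first by rewrite mulrCA.
exact: integrable_fin_num.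
Qed.

Lemma integrableD_fun g h : mu.-integrable I (EFin \o g) ->
  mu.-integrable I (EFin \o h) -> mu.-integrable I (EFin \o (fun t => g t + h t)).
Proof.
move=> ig ih; rewrite (_ : EFin \o _ = ((EFin \o g) \+ (EFin \o h))%E)//.
exact: integrableD.
Qed.

Lemma integrableZ_fun g (r : R) : mu.-integrable I (EFin \o g) ->
  mu.-integrable I (EFin \o (fun t => r * g t)).
Proof.
move=> ig; rewrite (_ : EFin \o _ = (fun t => r%:E * (EFin \o g) t)%E)//.
exact: integrableZl.
Qed.

Lemma av_le g h n : (0 < n)%N -> mu.-integrable I (EFin \o g) ->
  mu.-integrable I (EFin \o h) -> (forall t, I t -> g t <= h t) -> av g n <= av h n.
Proof.
move=> n0 ig ih gh; have [ig' ih'] := (integrable_dy n0 ig, integrable_dy n0 ih).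
rewrite ler_wpM2l ?exprn_ge0// fine_le ?integrable_fin_num//.
by apply: le_integral => // t /set_mem nt; rewrite lee_fin gh//; exact: dy_I nt.
Qed.

Definition cmeas f := measurable_fun I (fun t => complex.Re (f t)) /\
  measurable_fun I (fun t => complex.Im (f t)).

Definition cint f := mu.-integrable I (fun t => (complex.Re (f t))%:E) /\
  mu.-integrable I (fun t => (complex.Im (f t))%:E).

Lemma cmeasP (f : R -> R[i]) (X : nat -> R[i]) M : (forall t, I t -> f t = X (leaf M t)) -> cmeas f.
Proof.
move=> fX; split.
  apply: (@eq_measurable_fun _ _ _ _ _ (fun t => complex.Re (X (leaf M t)))).
    by move=> t /set_mem /fX ->.
  exact: (measurable_leaf (fun l => complex.Re (X l))).
apply: (@eq_measurable_fun _ _ _ _ _ (fun t => complex.Im (X (leaf M t)))).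
  by move=> t /set_mem /fX ->.
exact: (measurable_leaf (fun l => complex.Im (X l))).
Qed.

Lemma cmeas_HP M a : cmeas (HP M a).
Proof. exact: (@cmeasP _ (val M a) M). Qed.

Lemma cmeasD f u : cmeas f -> cmeas u -> cmeas (fun t => f t + u t).
Proof.
move=> [f1 f2] [u1 u2]; split.
  under eq_fun do rewrite cReD; exact: measurable_funD.
under eq_fun do rewrite cImD; exact: measurable_funD.
Qed.

Lemma cmeasZ (r : R[i]) f : cmeas f -> cmeas (fun t => r * f t).
Proof.
move=> [f1 f2]; split.
  have -> : (fun t => complex.Re (r * f t)) =
      (fun t => complex.Re r * complex.Re (f t) - complex.Im r * complex.Im (f t)).
    by apply/funext => t; rewrite cReM.
  by apply: measurable_funB; apply: measurable_funM => //; exact: measurable_cst.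
have -> : (fun t => complex.Im (r * f t)) =
    (fun t => complex.Re r * complex.Im (f t) + complex.Im r * complex.Re (f t)).
  by apply/funext => t; rewrite cImM.
by apply: measurable_funD; apply: measurable_funM => //; exact: measurable_cst.
Qed.

Lemma cmeasB f u : cmeas f -> cmeas u -> cmeas (fun t => f t - u t).
Proof.
move=> mf mu'; have := cmeasD mf (cmeasZ (-1) mu').
by under eq_fun do rewrite mulN1r.
Qed.

Lemma measurable_cabs f : cmeas f -> measurable_fun I (fun t => cabs (f t)).
Proof.
move=> [f1 f2].
have -> : (fun t => cabs (f t)) =
    (fun t => (complex.Re (f t) ^+ 2 + complex.Im (f t) ^+ 2) `^ 2^-1).
  apply/funext => t; rewrite powR12_sqrt ?addr_ge0 ?sqr_ge0//.
  by rewrite -cabs_sqr sqrtr_sqr ger0_norm ?cabs_ge0.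
apply: (measurableT_comp (measurable_powR _)).
by apply: measurable_funD; exact: measurable_funX.
Qed.

Lemma measurable_cabs_powR p f : cmeas f ->
  measurable_fun I (fun t => ((cabs (f t)) `^ p)%:E).
Proof.
move=> mf; apply/measurable_EFinP.
exact: (measurableT_comp (measurable_powR _)) (measurable_cabs mf).
Qed.

Definition Np p f : \bar R := (\int[mu]_(t in I) ((cabs (f t)) `^ p)%:E)%E.

Lemma Np_ge0 p f : (0 <= Np p f)%E.
Proof. by apply: integral_ge0 => t _; rewrite lee_fin powR_ge0. Qed.

Lemma Np_HP p M a : Np p (HP M a) = (Ex M (fun l => cabs (val M a l) `^ p) 1)%:E.
Proof. exact: (integral_leaf (fun l => cabs (val M a l) `^ p)). Qed.

Lemma inLpP p f : inLp p f <-> cmeas f /\ (Np p f < +oo)%E.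
Proof. by split=> [[]|[[]]]. Qed.

Lemma NpD p f u : cmeas f -> cmeas u -> 0 <= p ->
  (Np p (fun t => f t + u t)%R <= (2 `^ p)%:E * (Np p f + Np p u))%E.
Proof.
move=> mf mu' p0.
rewrite -ge0_integralD//; last 4 first.
- by move=> t _; rewrite lee_fin powR_ge0.
- exact: measurable_cabs_powR.
- by move=> t _; rewrite lee_fin powR_ge0.
- exact: measurable_cabs_powR.
rewrite -ge0_integralZl//; last 2 first.
- by apply: emeasurable_funD; exact: measurable_cabs_powR.
- by move=> t _; rewrite adde_ge0// lee_fin powR_ge0.
apply: ge0_le_integral => //.
- by move=> t _; rewrite lee_fin powR_ge0.
- by apply: measurable_cabs_powR; exact: cmeasD.
- apply: emeasurable_funM => //.
  by apply: emeasurable_funD; exact: measurable_cabs_powR.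
- move=> t It; rewrite -EFinD -EFinM lee_fin.
  apply: le_trans (powRDle p0 (cabs_ge0 _) (cabs_ge0 _)).
  by rewrite ge0_ler_powR ?nnegrE ?addr_ge0 ?cabs_ge0// cabsD.
Qed.

Lemma NpZ p (r : R[i]) f : cmeas f -> 0 <= p ->
  Np p (fun t => r * f t) = ((cabs r `^ p)%:E * Np p f)%E.
Proof.
move=> mf p0; rewrite -ge0_integralZl//.
- by apply: eq_integral => t _; rewrite cabsM powRM ?cabs_ge0// EFinM.
- exact: measurable_cabs_powR.
- by move=> t _; rewrite lee_fin powR_ge0.
- by rewrite lee_fin powR_ge0.
Qed.

Lemma NpN p f : Np p (fun t => - f t) = Np p f.
Proof. by apply: eq_integral => t _; rewrite cabsN. Qed.

Lemma NpB p f u : cmeas f -> cmeas u -> 0 <= p ->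
  (Np p (fun t => f t - u t)%R <= (2 `^ p)%:E * (Np p f + Np p u))%E.
Proof.
move=> mf mu' p0; rewrite -(NpN p u).
have mN : cmeas (fun t => - u t).
  by have := cmeasZ (-1) mu'; under eq_fun do rewrite mulN1r.
exact: NpD.
Qed.

Lemma Np_sym p f u : Np p (fun t => f t - u t) = Np p (fun t => u t - f t).
Proof. by rewrite -NpN; apply: eq_integral => t _; rewrite opprB. Qed.

Lemma Np_fin p f : inLp p f -> Np p f \is a fin_num.
Proof. by move=> /inLpP[_ h]; rewrite ge0_fin_numE// Np_ge0. Qed.

Lemma inLpD p f u : 0 <= p -> inLp p f -> inLp p u -> inLp p (fun t => f t + u t).
Proof.
move=> p0 /[dup] /inLpP[mf _] /Np_fin fp /[dup] /inLpP[mu' _] /Np_fin up.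
apply/inLpP; split; first exact: cmeasD.
apply: (le_lt_trans (NpD mf mu' p0)).
by rewrite ltey_eq fin_numM// fin_numD fp up.
Qed.

Lemma inLpZ p (r : R[i]) f : 0 <= p -> inLp p f -> inLp p (fun t => r * f t).
Proof.
move=> p0 /[dup] /inLpP[mf _] /Np_fin fp.
apply/inLpP; split; first exact: cmeasZ.
by rewrite NpZ// ltey_eq fin_numM.
Qed.

Lemma inLpB p f u : 0 <= p -> inLp p f -> inLp p u -> inLp p (fun t => f t - u t).
Proof.
move=> p0 fp up; have := inLpD p0 fp (inLpZ (-1) p0 up).
by under eq_fun do rewrite mulN1r.
Qed.

Lemma inLp_HP p M a : inLp p (HP M a).
Proof. by apply/inLpP; split; [exact: cmeas_HP|rewrite Np_HP ltry]. Qed.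

Lemma le1DpowR p (x : R) : 1 <= p -> 0 <= x -> x <= 1 + x `^ p.
Proof.
move=> p1 x0; have [x1|/ltW x1] := lerP x 1.
  by rewrite (le_trans x1)// lerDl powR_ge0.
by apply: (@le_trans _ _ (x `^ p)); [rewrite le1r_powR|rewrite lerDr].
Qed.

Lemma integrable_cabs_powR p f : inLp p f ->
  mu.-integrable I (EFin \o (fun t => cabs (f t) `^ p)).
Proof.
move=> /inLpP[mf fp]; apply/integrableP; split; first exact: measurable_cabs_powR.
rewrite (le_lt_trans _ fp)//; apply: ge0_le_integral => //.
- by apply: measurableT_comp => //; exact: measurable_cabs_powR.
- exact: measurable_cabs_powR.
- by move=> t _ /=; rewrite ger0_norm ?powR_ge0.
Qed.

Lemma integrable_1DpowR p f : inLp p f ->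
  mu.-integrable I (EFin \o (fun t => 1 + cabs (f t) `^ p)).
Proof.
move=> fp; apply: integrableD_fun; last exact: integrable_cabs_powR.
exact: (@integrable_leaf (fun=> 1) 0).
Qed.

Lemma integrable_cabs p f : 1 <= p -> inLp p f ->
  mu.-integrable I (EFin \o (fun t => cabs (f t))).
Proof.
move=> p1 fp; have /inLpP[mf _] := fp.
apply: le_integrable (integrable_1DpowR fp) => //.
  by apply/measurable_EFinP; exact: measurable_cabs.
move=> t It /=; rewrite lee_fin !ger0_norm ?cabs_ge0 ?addr_ge0 ?powR_ge0//.
by rewrite le1DpowR ?cabs_ge0.
Qed.

Lemma inLp_cint p f : 1 <= p -> inLp p f -> cint f.
Proof.
move=> p1 fp; have /inLpP[[m1 m2] _] := fp; split.
  apply: le_integrable (integrable_cabs p1 fp) => //; first exact/measurable_EFinP.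
  by move=> t It /=; rewrite lee_fin [X in _ <= X]ger0_norm ?cabs_ge0 ?cabs_Re.
apply: le_integrable (integrable_cabs p1 fp) => //; first exact/measurable_EFinP.
by move=> t It /=; rewrite lee_fin [X in _ <= X]ger0_norm ?cabs_ge0 ?cabs_Im.
Qed.

Local Open Scope complex_scope.

Definition avc f n : R[i] :=
  (av (fun t => complex.Re (f t)) n) +i* (av (fun t => complex.Im (f t)) n).

Local Close Scope complex_scope.

(** The Haar coefficient, that is the integral of [f] against h_n divided by the length of I_n. *)
Definition coef f n : R[i] := (avc f n.*2 - avc f n.*2.+1) / 2.

Lemma cplx_eq (z w : R[i]) : complex.Re z = complex.Re w -> complex.Im z = complex.Im w -> z = w.
Proof. by case: z w => [? ?] [? ?] /= -> ->. Qed.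

Lemma avc_lin (r s : R[i]) f u n : (0 < n)%N -> cint f -> cint u ->
  avc (fun t => r * f t + s * u t) n = r * avc f n + s * avc u n.
Proof.
move=> n0 [f1 f2] [u1 u2]; apply: cplx_eq.
  rewrite cReD !cReM /=.
  under [LHS]eq_av => t _.
    rewrite cReD !cReM -!mulNr; over.
  rewrite avD//; [|apply: integrableD_fun; exact: integrableZ_fun ..].
  by rewrite !avD// ?avZ// ?mulNr//; exact: integrableZ_fun.
rewrite cImD !cImM /=.
under [LHS]eq_av => t _.
  rewrite cImD !cImM; over.
rewrite avD//; [|apply: integrableD_fun; exact: integrableZ_fun ..].
by rewrite !avD// ?avZ//; exact: integrableZ_fun.
Qed.

Lemma avcB f u n : (0 < n)%N -> cint f -> cint u ->
  avc (fun t => f t - u t) n = avc f n - avc u n.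
Proof.
move=> n0 if_ iu; have := avc_lin 1 (-1) n0 if_ iu.
by under eq_fun do rewrite mul1r mulN1r; rewrite mul1r mulN1r.
Qed.

Lemma avc_split f n : (0 < n)%N -> cint f ->
  avc f n = (avc f n.*2 + avc f n.*2.+1) / 2.
Proof.
move=> n0 [f1 f2].
have -> : (avc f n.*2 + avc f n.*2.+1) / 2 = (2^-1)%:C%C * (avc f n.*2 + avc f n.*2.+1).
  by rewrite mulrC fmorphV rmorph_nat.
apply: cplx_eq; rewrite ?cReM ?cImM ?cReD ?cImD /= mul0r ?subr0 ?addr0; rewrite avE// /avg2 mulrC//.
Qed.

Lemma avc_double f n : (0 < n)%N -> cint f -> avc f n.*2 = avc f n + coef f n.
Proof. by move=> n0 cf; rewrite (avc_split n0 cf) /coef; field. Qed.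

Lemma avc_doubleS f n : (0 < n)%N -> cint f -> avc f n.*2.+1 = avc f n - coef f n.
Proof. by move=> n0 cf; rewrite (avc_split n0 cf) /coef; field. Qed.

(** The partial Haar sums of a mean-zero function are its conditional expectations on the dyadic
    levels. *)
Lemma val_coef f k l : cint f -> avc f 1 = 0 -> (l %/ 2 ^ k = 1)%N ->
  val k (coef f) l = avc f l.
Proof.
move=> cf f0; elim: k l => [|k IH] l; first by rewrite expn0 divn1 => ->.
rewrite expnS divnMA divn2 => lk.
have l0 : (0 < l./2)%N by case: (l./2) lk => //; rewrite div0n.
rewrite /= IH// -[in RHS](odd_double_half l); case: odd; rewrite ?add1n ?add0n.
  by rewrite avc_doubleS.
by rewrite avc_double.
Qed.

Lemma avc_HP M a n : (0 < n)%N -> (hk n <= M)%N -> avc (HP M a) n = val (hk n) a n.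
Proof.
move=> n0; set d := (M - hk n)%N => nM; have Md : (M = hk n + d)%N by rewrite subnKC.
rewrite {nM}Md; move: d => d; elim: d n n0 => [|d IH] n n0.
  rewrite addn0; have E t : @dy R n t -> HP (hk n) a t = val (hk n) a n.
    by move=> nt; rewrite /HP leaf_dy.
  by apply: cplx_eq => /=; rewrite -[RHS](av_cst _ n); apply: eq_av => t /E ->.
have iH : cint (HP (hk n + d.+1) a).
  by apply: (@inLp_cint 1) => //; exact: inLp_HP.
rewrite (avc_split n0 iH).
have := IH n.*2; rewrite double_gt0 hk_double// addSnnS => -> //.
have := IH n.*2.+1; rewrite hk_doubleS// addSnnS => -> //.
by rewrite val_double val_doubleS; field.
Qed.

Lemma coef_HP M a n : (0 < n)%N -> coef (HP M a) n = if (hk n < M)%N then a n else 0.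
Proof.
move=> n0; case: ltnP => nM.
  rewrite /coef !avc_HP ?hk_double ?hk_doubleS ?double_gt0//.
  by rewrite val_double val_doubleS; field.
have E j : (0 < j)%N -> (j./2 = n)%N -> avc (HP M a) j = val M a (n %/ 2 ^ (hk n - M)).
  move=> j0 jn; have kj : hk j = (hk n).+1.
    by rewrite /hk trunc_log2S ?jn// -half_gt0 jn.
  have K t : @dy R j t -> HP M a t = val M a (n %/ 2 ^ (hk n - M)).
    move=> jt; rewrite /HP; congr val.
    have := leaf_dy j0 jt; rewrite kj => lj.
    have ln : leaf (hk n) t = n by rewrite -leaf_half lj jn.
    by have := leaf_div M (hk n - M) t; rewrite subnKC// ln => ->.
  by apply: cplx_eq => /=; rewrite -[RHS](av_cst _ j); apply: eq_av => t /K ->.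
have h2 : n.*2.+1./2 = n by rewrite /= uphalf_double.
by rewrite /coef (E n.*2) ?double_gt0 ?doubleK// (E n.*2.+1)// subrr mul0r.
Qed.

(** The mean [z] is paired with itself: |z|^2 is the average of the scalar product of [z] and [f],
    which is at most |z| |f| pointwise. *)
Lemma cabs_avc f n : (0 < n)%N -> cint f ->
  mu.-integrable I (EFin \o (fun t => cabs (f t))) ->
  cabs (avc f n) <= av (fun t => cabs (f t)) n.
Proof.
move=> n0 [f1 f2] iF; set z := avc f n.
have [->|z0] := eqVneq z 0.
  rewrite cabs0 mulr_ge0 ?exprn_ge0// fine_ge0// integral_ge0// => t _.
  by rewrite lee_fin cabs_ge0.
have cz : 0 < cabs z.
  by rewrite lt0r cabs_ge0 andbT; apply: contra z0 => /eqP/cabs_eq0 ->.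
rewrite -(ler_pM2l cz) -expr2 cabs_sqr -avZ//.
have -> : complex.Re z ^+ 2 + complex.Im z ^+ 2 =
   av (fun t => complex.Re z * complex.Re (f t) + complex.Im z * complex.Im (f t)) n.
  by rewrite avD ?avZ//; exact: integrableZ_fun.
apply: av_le => //.
- by apply: integrableD_fun; exact: integrableZ_fun.
- exact: integrableZ_fun.
- move=> t It; rewrite (le_trans (ler_norm _))//.
  rewrite -ler_sqr ?nnegrE ?mulr_ge0 ?cabs_ge0// real_normK ?num_real//.
  rewrite exprMn !cabs_sqr -subr_ge0.
  have -> : (complex.Re z ^+ 2 + complex.Im z ^+ 2) *
      (complex.Re (f t) ^+ 2 + complex.Im (f t) ^+ 2) -
      (complex.Re z * complex.Re (f t) + complex.Im z * complex.Im (f t)) ^+ 2 =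
      (complex.Re z * complex.Im (f t) - complex.Im z * complex.Re (f t)) ^+ 2 by ring.
  exact: sqr_ge0.
Qed.

Lemma avc_jensen p f n : 1 < p -> (0 < n)%N -> inLp p f ->
  cabs (avc f n) `^ p <= av (fun t => cabs (f t) `^ p) n.
Proof.
move=> p1 n0 fp; set m := cabs (avc f n); have m0 : 0 <= m := cabs_ge0 _.
have p1' := ltW p1.
have ic := integrable_cabs p1' fp; have ip := integrable_cabs_powR fp.
have H : m <= av (fun t => cabs (f t)) n by apply: cabs_avc => //; exact: (inLp_cint p1').
have : av (fun t => (p * m `^ (p - 1)) * cabs (f t)) n <=
    av (fun t => cabs (f t) `^ p + (p - 1) * m `^ p) n.
  apply: av_le => //; first exact: integrableZ_fun.
    by apply: integrableD_fun => //; exact: (@integrable_leaf (fun=> _) 0).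
  by move=> t It; rewrite young_tangent ?cabs_ge0.
rewrite avZ// avD//; last exact: (@integrable_leaf (fun=> (p - 1) * m `^ p) 0).
rewrite av_cst => H2.
have : p * m `^ p <= p * m `^ (p - 1) * av (fun t => cabs (f t)) n.
  rewrite -(mulr_powRB1 m0 (_ : 0 < p)); last lra.
  by rewrite [m * _]mulrC mulrA ler_wpM2l// mulr_ge0 ?powR_ge0//; lra.
lra.
Qed.

(** Averages, hence Haar coefficients, are continuous on L^p, and so survive limits. *)
Lemma cabs_avc_Np p f n : 1 < p -> (0 < n)%N -> inLp p f ->
  ((cabs (avc f n) `^ p)%:E <= (2 ^+ hk n)%:E * Np p f)%E.
Proof.
move=> p1 n0 fp; apply: (@le_trans _ _ (av (fun t => cabs (f t) `^ p) n)%:E).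
  by rewrite lee_fin avc_jensen.
rewrite /av EFinM lee_wpmul2l ?lee_fin ?exprn_ge0// fineK; last first.
  by apply: integrable_fin_num => //; apply: integrable_dy => //; exact: integrable_cabs_powR.
apply: ge0_subset_integral => //.
- by apply: measurable_cabs_powR; case/inLpP: fp.
- by move=> t _; rewrite lee_fin powR_ge0.
- by move=> t; exact: dy_I.
Qed.

Lemma Np_HP_coef p M f : 1 < p -> inLp p f -> avc f 1 = 0 ->
  (Np p (HP M (coef f)) <= Np p f)%E.
Proof.
move=> p1 fp f0; have cf := inLp_cint (ltW p1) fp.
have -> : Np p f = (av (fun t => cabs (f t) `^ p) 1)%:E.
  by rewrite av1 fineK//; exact: Np_fin.
rewrite Np_HP lee_fin (@av_Ex _ M)//; last exact: integrable_cabs_powR.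
apply: Ex_le => l lM; rewrite val_coef// avc_jensen//.
by case: l lM => //; rewrite div0n.
Qed.

Lemma inLp0P p f : 1 <= p -> inLp0 p f <-> inLp p f /\ avc f 1 = 0.
Proof.
move=> p1; split=> [[fp h1 h2]|[fp f0]].
  by split => //; apply: cplx_eq; rewrite /= av1 ?h1 ?h2.
have [c1 c2] := inLp_cint p1 fp; split => //.
- have F : (\int[mu]_(x in I) (complex.Re (f x))%:E)%E \is a fin_num.
    exact: integrable_fin_num.
  have := congr1 (@complex.Re R) f0; rewrite /= av1 => h.
  by rewrite -(fineK F) h.
- have F : (\int[mu]_(x in I) (complex.Im (f x))%:E)%E \is a fin_num.
    exact: integrable_fin_num.
  have := congr1 (@complex.Im R) f0; rewrite /= av1 => h.
  by rewrite -(fineK F) h.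
Qed.

Lemma inLp0_HP p M a : 1 <= p -> inLp0 p (HP M a).
Proof.
move=> p1; apply/inLp0P => //; split; first exact: inLp_HP.
by rewrite avc_HP// /hk/=.
Qed.

Lemma inLp0_lin p (r s : R[i]) f u : 1 <= p -> inLp0 p f -> inLp0 p u ->
  inLp0 p (fun t => r * f t + s * u t).
Proof.
move=> p1 /(inLp0P _ p1)[fp f0] /(inLp0P _ p1)[up u0].
have p0 : 0 <= p by lra.
apply/(inLp0P _ p1); split; first exact: (inLpD p0 (inLpZ r p0 fp) (inLpZ s p0 up)).
rewrite (avc_lin r s _ (inLp_cint p1 fp) (inLp_cint p1 up))//.
by rewrite f0 u0 !mulr0 addr0.
Qed.

Lemma inLp0B p f u : 1 <= p -> inLp0 p f -> inLp0 p u -> inLp0 p (fun t => f t - u t).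
Proof.
move=> p1 fp up; have := inLp0_lin 1 (-1) p1 fp up.
by under eq_fun do rewrite mul1r mulN1r.
Qed.

Lemma coef_lin (r s : R[i]) f u n : (0 < n)%N -> cint f -> cint u ->
  coef (fun t => r * f t + s * u t) n = r * coef f n + s * coef u n.
Proof.
move=> n0 cf cu; rewrite /coef !avc_lin ?double_gt0//.
by field.
Qed.

Lemma coefB f u n : (0 < n)%N -> cint f -> cint u ->
  coef (fun t => f t - u t) n = coef f n - coef u n.
Proof.
by move=> n0 cf cu; rewrite /coef !avcB ?double_gt0//; field.
Qed.

End Averages.

(** * Density of Haar sums and completeness *)

Section Convergence.
Variable R : realType.
Local Open Scope classical_set_scope.
Local Notation mu := (@mu R).
Local Notation I := (@Iset R).
Implicit Types (t : R) (n M k : nat) (a : nat -> R[i]) (p : R).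
Implicit Types (g : R -> R) (f u v : R -> R[i]).
Local Hint Extern 0 (measurable (@Iset _)) => exact: mI : core.
Local Hint Extern 0 (measurable (dy _)) => exact: measurable_dy : core.

Lemma ge0_squeeze0 (x y : R^nat) : (forall n, 0 <= x n <= y n) ->
  y @ \oo --> (0 : R) -> x @ \oo --> (0 : R).
Proof.
move=> xy y0; apply: (squeeze_cvgr _ (cvg_cst 0) y0).
by near=> n; exact: xy.
Unshelve. all: by end_near. Qed.

Lemma dist_squeeze (x y : R^nat) (l : R) : (forall n, `|x n - l| <= y n) ->
  y @ \oo --> (0 : R) -> x @ \oo --> l.
Proof.
move=> xy y0; apply/cvgrPdist_le => e e0; near=> n.
rewrite distrC; apply: le_trans (xy n) _.
have : `|0 - y n| <= e by near: n; move/cvgrPdist_le : y0; apply.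
by rewrite sub0r normrN; apply: le_trans; exact: ler_norm.
Unshelve. all: by end_near. Qed.

Lemma powR_dist p (x y : R) : 1 < p -> 0 <= x -> 0 <= y ->
  `|y `^ p - x `^ p| <= p * (Num.max x y) `^ (p - 1) * `|y - x|.
Proof.
move=> p1; wlog xy : x y / x <= y => [H x0 y0|x0 y0].
  have /orP[xy|xy] := le_total x y; first exact: H xy x0 y0.
  by rewrite maxC distrC [X in _ <= _ * X]distrC; exact: H xy y0 x0.
rewrite (max_idPr xy) ger0_norm ?subr_ge0//; last first.
  by rewrite ge0_ler_powR ?nnegrE//; lra.
rewrite ger0_norm ?subr_ge0// mulrBr -mulrA [X in _ <= p * X - _]mulrC mulr_powRB1//; last lra.
have := young_tangent p1 x0 y0; lra.
Qed.

Lemma cvg_powR p (x : R^nat) (l : R) : 1 < p -> (forall n, 0 <= x n) -> 0 <= l ->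
  x @ \oo --> l -> (fun n => x n `^ p) @ \oo --> l `^ p.
Proof.
move=> p1 x0 l0 xl; have p0 : 0 <= p - 1 by lra.
have xd : (fun n => `|x n - l|) @ \oo --> (0 : R).
  have -> : (0 : R) = `|l - l| by rewrite subrr normr0.
  by apply: cvg_norm; apply: cvgB => //; exact: cvg_cst.
have d0 : (fun n => p * (l + 1) `^ (p - 1) * `|x n - l|) @ \oo --> (0 : R).
  rewrite -[X in _ --> X](mulr0 (p * (l + 1) `^ (p - 1))).
  by apply: cvgM => //; exact: cvg_cst.
apply/cvgrPdist_le => e e0; near=> n.
rewrite distrC; apply: le_trans (powR_dist p1 l0 (x0 n)) _.
apply: (@le_trans _ _ (p * (l + 1) `^ (p - 1) * `|x n - l|)).
  rewrite ler_wpM2r// ler_wpM2l//; first lra.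
  rewrite ge0_ler_powR ?nnegrE ?le_max ?l0//; first lra.
  rewrite ge_max; apply/andP; split; first lra.
  have : `|0 - `|x n - l| | <= 1 by near: n; move/cvgrPdist_le : xd; apply.
  by rewrite sub0r normrN normr_id => /(le_trans (ler_norm _)); lra.
have : `|0 - p * (l + 1) `^ (p - 1) * `|x n - l| | <= e.
  by near: n; move/cvgrPdist_le : d0; apply.
by rewrite sub0r normrN; apply: le_trans; exact: ler_norm.
Unshelve. all: by end_near. Qed.

Lemma fatou_le (g : nat -> R -> \bar R) (h : R -> \bar R) (K : \bar R) :
  (forall n, measurable_fun I (g n)) -> (forall n t, I t -> (0 <= g n t)%E) ->
  measurable_fun I h -> {ae mu, forall t, I t -> g ^~ t @ \oo --> h t} ->
  (forall n, (\int[mu]_(t in I) g n t <= K)%E) -> (\int[mu]_(t in I) h t <= K)%E.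
Proof.
move=> mg g0 mh gh gK.
have -> : (\int[mu]_(t in I) h t = \int[mu]_(t in I) limn_einf (g ^~ t))%E.
  apply: ae_eq_integral => //.
    have -> : (fun t => limn_einf (g ^~ t)) =
        (fun t => (- limn_esup (fun n => - g n t))%E).
      by apply/funext => t; rewrite (limn_esupN (g ^~ t)) oppeK.
    apply: measurableT_comp => //.
    apply: measurable_fun_limn_esup => n.
    by apply: (@measurableT_comp _ _ _ _ _ _ -%E _ (g n)) => //; exact: mg.
  case: gh => A [mA A0 HA]; exists A; split => // t /= Ht; apply: HA => /= Ht'.
  by apply: Ht => It; rewrite (cvg_limn_einf_sup (Ht' It)).1.
have F : (\int[mu]_(t in I) limn_einf (g ^~ t) <=
    limn_einf (fun n => \int[mu]_(t in I) g n t))%E by exact: fatou.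
apply: (le_trans F).
rewrite limn_einf_lim; apply: lime_le; first exact: is_cvg_einfs.
near=> n; apply: le_trans (gK n).
by apply: ereal_inf_lbound; exists n => //=.
Unshelve. all: by end_near. Qed.

Lemma two_cvg0 : (fun n => 2 * 2 ^- n : R) @ \oo --> (0 : R).
Proof.
rewrite -[X in _ --> X](mulr0 2); apply: cvgM; first exact: cvg_cst.
under eq_fun do rewrite -exprVn.
by apply: cvg_expr; rewrite ger0_norm ?invr_ge0// invf_lt1// ltr1n.
Qed.

(** Lebesgue differentiation along the dyadic intervals containing [t], which shrink nicely to
    [t]. *)
Lemma av_cvg g : mu.-integrable I (EFin \o g) ->
  {ae mu, forall t, I t -> (fun M => av g (leaf M t)) @ \oo --> g t}.
Proof.
move=> ig; pose gI := g \_ I.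
have locg : locally_integrable setT gI by exact: integrable_locally.
(* Nice shrinking is demanded at every real [t], hence the balls off I. On I the ball contains the
   dyadic interval and has four times its measure, which is the constant 4 below. *)
pose E t M : set R := if t \in I then @dy R (leaf M t) else ball t (2 * 2 ^- M : R).
have tw0 M : 0 < 2 * 2 ^- M :> R by rewrite mulr_gt0// invr_gt0 exprn_gt0.
have dyE' M t : I t -> forall s, dy (leaf M t) s -> ball t (2 * 2 ^- M : R) s.
  move=> It s; have := dy_leaf M It; rewrite !dyE hk_leaf.
  have P0 : 0 < 2 ^+ M :> R by rewrite exprn_gt0.
  rewrite -natr1 => /andP[h1 h2] /andP[h3 h4].
  rewrite /ball /= -(ltr_pM2l P0) mulrCA mulfV ?gt_eqF// mulr1.
  rewrite -[X in X * _](ger0_norm (ltW P0)) -normrM mulrBr ltr_norml; lra.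
have nsE t : nicely_shrinking t (E t).
  split=> [M|].
    by rewrite /E; case: ifP => _; [exact: measurable_dy|exact: measurable_ball].
  exists (4, fun M => PosNum (tw0 M)); split => //=; first exact: two_cvg0.
    move=> M; rewrite /E; case: ifP => [tI|_] //.
    exact: (dyE' M t (set_mem tI)).
  move=> M; rewrite lebesgue_measure_ball ?(ltW (tw0 M))// /E; case: ifP => [_|_].
    by rewrite mu_dy hk_leaf -EFinM lee_fin -mulr_natr; lra.
  rewrite lebesgue_measure_ball ?(ltW (tw0 M))// -EFinM lee_fin.
  by move: (2 * 2 ^- M) (tw0 M) => x x0; rewrite mulr2n; lra.
have [A [mA A0 HA]] := lebesgue_differentiation locg.
exists A; split => // t /= Ht; apply: HA => /= lt; apply: Ht => It.
have := nice_lebesgue_differentiation nsE locg lt.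
rewrite /gI patchT ?mem_set// => H.
have {H} : (fun M => (av g (leaf M t))%:E) @ \oo --> (g t)%:E.
  apply: cvg_trans H; apply: near_eq_cvg; near=> M.
  rewrite /E mem_set// mu_dy hk_leaf inver gt_eqF ?invr_gt0 ?exprn_gt0// invrK.
  rewrite /av hk_leaf EFinM fineK.
    congr (_ * _)%E; apply: eq_integral => s /set_mem ds.
    by rewrite /gI patchT// mem_set//; apply: dy_I ds; exact: leaf_gt0.
  by apply: integrable_fin_num => //; apply: integrable_dy => //; exact: leaf_gt0.
exact: fine_cvg.
Unshelve. all: by end_near. Qed.

Lemma cabs_le_ReIm (z : R[i]) : cabs z <= `|complex.Re z| + `|complex.Im z|.
Proof.
rewrite -ler_sqr ?nnegrE ?cabs_ge0 ?addr_ge0// cabs_sqr sqrrD !real_normK ?num_real//.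
by rewrite addrAC lerDl mulrn_wge0// mulr_ge0.
Qed.

Lemma cabs_dist (z w : R[i]) : `|cabs z - cabs w| <= cabs (z - w).
Proof.
rewrite ler_norml; apply/andP; split.
  have := cabsD (w - z) z; rewrite subrK -[cabs (w - z)]cabsN opprB; lra.
have := cabsD (z - w) w; rewrite subrK; lra.
Qed.

Lemma ae_imply (P Q : R -> Prop) : (forall t, P t -> Q t) ->
  {ae mu, forall t, P t} -> {ae mu, forall t, Q t}.
Proof.
move=> PQ [A [mA A0 HA]]; exists A; split => // t /= nQ; apply: HA => /= Pt.
exact/nQ/PQ.
Qed.

Lemma ae_and (P Q : R -> Prop) : {ae mu, forall t, P t} -> {ae mu, forall t, Q t} ->
  {ae mu, forall t, P t /\ Q t}.
Proof.
move=> [A [mA A0 HA]] [B [mB B0 HB]]; exists (A `|` B); split.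
- exact: measurableU.
- exact: null_set_setU.
- move=> t /= nPQ; have [Pt|/HA] := pselect (P t); last by left.
  by right; apply: HB => /= Qt; apply: nPQ.
Qed.

Lemma avc_cvg f : cint f ->
  {ae mu, forall t, I t -> (fun M => cabs (f t - avc f (leaf M t))) @ \oo --> (0 : R)}.
Proof.
move=> [/av_cvg h1 /av_cvg h2]; apply: ae_imply (ae_and h1 h2) => t [{}h1 {}h2] It.
have {}h1 := h1 It; have {}h2 := h2 It.
apply: (@ge0_squeeze0 _ (fun M => `|complex.Re (f t) - av (fun s => complex.Re (f s)) (leaf M t)| +
   `|complex.Im (f t) - av (fun s => complex.Im (f s)) (leaf M t)|)).
  by move=> n; rewrite cabs_ge0 (le_trans (cabs_le_ReIm _))// cReD cImD cReN cImN.
rewrite -[X in _ --> X]addr0; apply: cvgD.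
  have -> : (0 : R) = `|complex.Re (f t) - complex.Re (f t)| by rewrite subrr normr0.
  by apply: cvg_norm; apply: cvgB => //; exact: cvg_cst.
have -> : (0 : R) = `|complex.Im (f t) - complex.Im (f t)| by rewrite subrr normr0.
by apply: cvg_norm; apply: cvgB => //; exact: cvg_cst.
Qed.

(* Fatou's lemma is applied to [2^p (|f|^p + |E_M f|^p) - |f - E_M f|^p]. *)
Lemma Np_dense p f (e : R) M0 : 1 < p -> inLp p f -> avc f 1 = 0 -> 0 < e ->
  exists2 M, (M0 <= M)%N & (Np p (fun t => (f t - HP M (coef f) t)%R) <= e%:E)%E.
Proof.
move=> p1 fp f0 e0; have p1' := ltW p1; have p0 : 0 <= p by lra.
have cf := inLp_cint p1' fp; have /inLpP[mf _] := fp.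
apply: contrapT => no.
have {}no n : (e%:E <= Np p (fun t => (f t - HP (M0 + n) (coef f) t)%R))%E.
  rewrite leNgt; apply/negP => h; apply: no; exists (M0 + n)%N; first exact: leq_addr.
  exact: ltW.
pose G n t := 2 `^ p * (cabs (f t) `^ p + cabs (HP (M0 + n) (coef f) t) `^ p).
pose H n t := cabs (f t - HP (M0 + n) (coef f) t) `^ p.
have iH n : mu.-integrable I (EFin \o H n).
  apply: integrable_cabs_powR; exact: inLpB p0 fp (inLp_HP _ _ _).
have iG n : mu.-integrable I (EFin \o G n).
  apply: integrableZ_fun; apply: integrableD_fun; first exact: integrable_cabs_powR.
  exact: (integrable_cabs_powR (inLp_HP _ _ _)).
pose N := fine (Np p f).
have NE : Np p f = N%:E by rewrite fineK// Np_fin.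
have bound n : (\int[mu]_(t in I) (G n t - H n t)%:E <= (2 `^ p * (N + N) - e)%:E)%E.
  under eq_integral do rewrite EFinB.
  rewrite integralB//; [|exact: iG|exact: iH].
  rewrite (EFinB (2 `^ p * (N + N)) e); apply: leeB; last exact: no.
  rewrite /G; under eq_integral do rewrite EFinM.
  rewrite integralZl//; last first.
    apply: integrableD_fun; first exact: integrable_cabs_powR.
    exact: (integrable_cabs_powR (inLp_HP _ _ _)).
  rewrite EFinM lee_wpmul2l ?lee_fin ?powR_ge0//.
  under eq_integral do rewrite EFinD.
  rewrite integralD//; last 2 first.
  - exact: integrable_cabs_powR.
  - exact: (integrable_cabs_powR (inLp_HP _ _ _)).
  rewrite EFinD -NE leeD2l// (le_trans (Np_HP_coef (M0 + n) p1 fp f0))//.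
have ih : mu.-integrable I (EFin \o (fun t => 2 `^ p * (cabs (f t) `^ p + cabs (f t) `^ p))).
  by apply: integrableZ_fun; apply: integrableD_fun; exact: integrable_cabs_powR.
have := @fatou_le (fun n t => (G n t - H n t)%:E)
  (fun t => (2 `^ p * (cabs (f t) `^ p + cabs (f t) `^ p))%:E) _ _ _ _ _ bound.
have -> : (\int[mu]_(t in I) (2 `^ p * (cabs (f t) `^ p + cabs (f t) `^ p))%:E)%E =
    (2 `^ p * (N + N))%:E.
  under eq_integral do rewrite EFinM.
  rewrite integralZl//; last by apply: integrableD_fun; exact: integrable_cabs_powR.
  under eq_integral do rewrite EFinD.
  by rewrite integralD ?EFinM ?EFinD -?NE//; exact: integrable_cabs_powR.
rewrite lee_fin => FF.
suff : 2 `^ p * (N + N) <= 2 `^ p * (N + N) - e by lra.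
apply: FF.
- move=> n; under eq_fun do rewrite EFinB; apply: emeasurable_funB.
    exact: measurable_int (iG n).
  exact: measurable_int (iH n).
- move=> n t It; rewrite lee_fin subr_ge0 /G /H.
  have := powRDle p0 (cabs_ge0 (f t)) (cabs_ge0 (HP (M0 + n) (coef f) t)).
  apply: le_trans; rewrite ge0_ler_powR ?nnegrE ?addr_ge0 ?cabs_ge0//.
  exact: cabsB.
- exact: measurable_int ih.
- apply: ae_imply (avc_cvg cf) => t + It => /(_ It) h.
  have HPE n : HP (M0 + n) (coef f) t = avc f (leaf (M0 + n) t).
    by rewrite /HP val_coef// leaf_div1.
  have {}h : (fun n => cabs (f t - HP (M0 + n) (coef f) t)) @ \oo --> (0 : R).
    have -> : (fun n => cabs (f t - HP (M0 + n) (coef f) t)) =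
        (fun n => cabs (f t - avc f (leaf (n + M0) t))).
      by apply/funext => n; rewrite HPE addnC.
    by rewrite (cvg_shiftn M0 (fun M => cabs (f t - avc f (leaf M t)))).
  have h' : (fun n => cabs (HP (M0 + n) (coef f) t)) @ \oo --> cabs (f t).
    apply: dist_squeeze h => n; rewrite (le_trans (cabs_dist _ _))//.
    by rewrite -[X in X <= _]cabsN opprB.
  apply: cvg_EFin; first by near=> n.
  rewrite -[X in _ --> X]subr0; apply: cvgB; last first.
    rewrite -[X in _ --> X](_ : 0 `^ p = 0); last by rewrite powR0//; lra.
    by apply: cvg_powR h => // n; exact: cabs_ge0.
  apply: cvgM; first exact: cvg_cst.
  apply: cvgD; first exact: cvg_cst.
  by apply: cvg_powR h' => //; [move=> n|]; exact: cabs_ge0.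
Unshelve. all: by end_near. Qed.

End Convergence.

(** * Completeness of L^p *)

Section Completeness.
Variable R : realType.
Local Open Scope classical_set_scope.
Local Notation mu := (@mu R).
Local Notation I := (@Iset R).
Implicit Types (t : R) (n M k : nat) (a : nat -> R[i]) (p : R).
Implicit Types (g : R -> R) (f u v : R -> R[i]).
Local Hint Extern 0 (measurable (@Iset _)) => exact: mI : core.
Local Hint Extern 0 (measurable (dy _)) => exact: measurable_dy : core.

Lemma Np0_aeq p f u : cmeas f -> cmeas u -> 0 < p ->
  Np p (fun t => f t - u t) = 0%E -> aeq f u.
Proof.
move=> mf mu' p0 h.
have mfu : measurable_fun I (fun t => (cabs (f t - u t) `^ p)%:E).
  by apply: measurable_cabs_powR; exact: cmeasB.
have [A [mA A0 HA]] : ae_eq mu I (fun t => (cabs (f t - u t) `^ p)%:E) (cst 0%E).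
  apply/ae_eq_integral_abs => //; rewrite -[RHS]h.
  by apply: eq_integral => t _; rewrite /= ger0_norm ?powR_ge0.
exists A; split => // t /= nfu.
apply: HA => /= H; apply: nfu => It.
have := H It => -[] /powR_eq0_eq0 /cabs_eq0 /eqP.
by rewrite subr_eq0 => /eqP.
Qed.

Lemma eq_ae_av g g' n : (0 < n)%N -> mu.-integrable I (EFin \o g) ->
  mu.-integrable I (EFin \o g') -> {ae mu, forall t, I t -> g t = g' t} ->
  av g n = av g' n.
Proof.
move=> n0 ig ig' gg'; congr (_ * fine _); apply: ae_eq_integral => //.
- exact: measurable_int (integrable_dy n0 ig).
- exact: measurable_int (integrable_dy n0 ig').
- by apply: ae_imply gg' => t + nt => -> //; exact: dy_I nt.
Qed.

Lemma aeq_avc f u n : (0 < n)%N -> cint f -> cint u -> aeq f u -> avc f n = avc u n.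
Proof.
move=> n0 [f1 f2] [u1 u2] fu; apply: cplx_eq => /=.
  by apply: eq_ae_av => //; apply: ae_imply fu => t + It => ->.
by apply: eq_ae_av => //; apply: ae_imply fu => t + It => ->.
Qed.

Lemma aeq_coef f u n : (0 < n)%N -> cint f -> cint u -> aeq f u -> coef f n = coef u n.
Proof. by move=> n0 cf cu fu; rewrite /coef !(aeq_avc _ cf cu)// double_gt0. Qed.

Lemma aeq_Np p f u : cmeas f -> cmeas u -> aeq f u -> Np p f = Np p u.
Proof.
move=> mf mu' fu; apply: ae_eq_integral => //; try exact: measurable_cabs_powR.
by apply: ae_imply fu => t + It => ->.
Qed.

Lemma aeq_eqI f u : (forall t, I t -> f t = u t) -> aeq f u.
Proof.
move=> fu; exists set0; split => //.
by move=> t /= nfu; exfalso; apply: nfu => It; exact: fu.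
Qed.

(** Subtracting the tail bound 2 c 2^-j makes the sequence nondecreasing, which reduces the claim to
    bounded monotone sequences. *)
Lemma geometric_cvg (x : R^nat) (c : R) :
  (forall j, `|x j.+1 - x j| <= c * 2 ^- j) -> cvgn x.
Proof.
move=> H; pose y j := x j - 2 * c * 2 ^- j.
have c0 : 0 <= c by have := le_trans (normr_ge0 _) (H 0%N); rewrite expr0 invr1 mulr1.
have S j : 2 ^- j.+1 = 2^-1 * 2 ^- j :> R by rewrite (exprS 2 j) invfM.
have yS j : y j <= y j.+1.
  have := H j; rewrite ler_norml /y S => /andP[h _].
  move: h; move: (2 ^- j) => s h; nra.
have zS j : x j + 2 * c * 2 ^- j <= x 0%N + 2 * c.
  elim: j => [|j IH]; first by rewrite expr0 invr1 mulr1.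
  apply: le_trans IH; have := H j; rewrite ler_norml S => /andP[_ h].
  move: h; move: (2 ^- j) => s h; nra.
have yc : cvgn y.
  apply: nondecreasing_is_cvgn; first exact/nondecreasing_seqP.
  exists (x 0%N + 2 * c) => _ [j _ <-]; apply: le_trans (zS j).
  have : 0 <= 2 * c * 2 ^- j by rewrite !mulr_ge0// invr_ge0 exprn_ge0.
  rewrite /y; lra.
have -> : x = y \+ (fun j => 2 * c * 2 ^- j).
  by apply/funext => j /=; rewrite /y subrK.
apply: is_cvgD => //; apply: is_cvgM; first exact: is_cvg_cst.
have -> : (fun j => 2 ^- j) = (fun j => 2^-1 ^+ j) :> R^nat.
  by apply/funext => j; rewrite exprVn.
by apply/cvg_ex; exists 0; apply: cvg_expr; rewrite ger0_norm ?invr_ge0// invf_lt1// ltr1n.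
Qed.

Lemma cabs_cvg (x : nat -> R[i]) (z w : R[i]) :
  (fun n => complex.Re (x n)) @ \oo --> complex.Re z ->
  (fun n => complex.Im (x n)) @ \oo --> complex.Im z ->
  (fun n => cabs (x n - w)) @ \oo --> cabs (z - w).
Proof.
move=> h1 h2; apply: (@dist_squeeze _ _ (fun n => `|complex.Re (x n) - complex.Re z| +
   `|complex.Im (x n) - complex.Im z|)).
  move=> n; rewrite (le_trans (cabs_dist _ _))//.
  by rewrite opprB addrA subrK (le_trans (cabs_le_ReIm _))// cReD cImD cReN cImN.
rewrite -[X in _ --> X]addr0; apply: cvgD.
  have -> : (0 : R) = `|complex.Re z - complex.Re z| by rewrite subrr normr0.
  by apply: cvg_norm; apply: cvgB => //; exact: cvg_cst.
have -> : (0 : R) = `|complex.Im z - complex.Im z| by rewrite subrr normr0.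
by apply: cvg_norm; apply: cvgB => //; exact: cvg_cst.
Qed.

(* Along a subsequence with [Np p (G_(k_(j+1)) - G_(k_j)) <= 4^-jp] the series
   [\sum_j (2^j |G_(k_(j+1)) - G_(k_j)|)^p] is finite almost everywhere, so the
   increments are almost everywhere [O(2^-j)]. *)
Lemma Lp_complete p (G : nat -> R -> R[i]) : 1 < p -> (forall k, cmeas (G k)) ->
  (forall e : R, 0 < e -> exists N, forall m n, (N <= m)%N -> (N <= n)%N ->
     (Np p (fun t => (G m t - G n t)%R) <= e%:E)%E) ->
  exists2 g : R -> R[i], cmeas g & forall e : R, 0 < e ->
    exists N, forall n, (N <= n)%N -> (Np p (fun t => (g t - G n t)%R) <= e%:E)%E.
Proof.
move=> p1 mG cG; have p0 : 0 <= p by lra.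
pose dl j : R := (4 ^- j) `^ p.
have dl0 j : 0 < dl j by rewrite powR_gt0// invr_gt0 exprn_gt0.
have [N0 HN0] := choice (fun j => cG _ (dl0 j)).
pose k j := (j + \sum_(i < j.+1) N0 i)%N.
have kj j : (j <= k j)%N by exact: leq_addr.
have kN i j : (i <= j)%N -> (N0 i <= k j)%N.
  move=> ij; have ij' : (i < j.+1)%N by [].
  by rewrite /k (bigD1 (Ordinal ij'))//= addnCA leq_addr.
pose D j t := cabs (G (k j.+1) t - G (k j) t).
have mD j : cmeas (fun t => G (k j.+1) t - G (k j) t) by exact: cmeasB.
pose h j t : \bar R := (((2 ^+ j) `^ p)%:E * ((D j t) `^ p)%:E)%E.
have h0 j t : (0 <= h j t)%E by rewrite mule_ge0 ?lee_fin ?powR_ge0.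
have mh j : measurable_fun I (h j).
  apply: emeasurable_funM => //; exact: measurable_cabs_powR.
have ih j : (\int[mu]_(t in I) h j t <= (2 ^- j)%:E)%E.
  rewrite /h ge0_integralZl//; last 2 first.
  - exact: measurable_cabs_powR.
  - by move=> t _; rewrite lee_fin powR_ge0.
  apply: (@le_trans _ _ (((2 ^+ j) `^ p)%:E * (dl j)%:E)%E).
    rewrite lee_wpmul2l ?lee_fin ?powR_ge0//.
    by apply: HN0; rewrite kN// ltnW.
  rewrite -EFinM lee_fin /dl -powRM ?exprn_ge0 ?invr_ge0 ?exprn_ge0//.
  have -> : 2 ^+ j * 4 ^- j = 2 ^- j :> R.
    have -> : 4 = 2 * 2 :> R by ring.
    by rewrite exprMn invfM mulrA mulfV ?mul1r// expf_neq0.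
  have ltj : 0 < (2 ^- j : R) <= 1.
    by rewrite invr_gt0 exprn_gt0//= invf_le1 ?exprn_gt0// exprn_ege1// ler1n.
  by rewrite ge1r_powR// ltW.
pose H t := (\sum_(0 <= j <oo) h j t)%E.
have mH : measurable_fun I H by apply: ge0_emeasurable_sum => // j t *; exact: h0.
have iH : mu.-integrable I H.
  apply/integrableP; split => //.
  under eq_integral => t _.
    rewrite gee0_abs; last by apply: nneseries_ge0 => *; exact: h0.
    over.
  rewrite integral_nneseries//; apply: (@le_lt_trans _ _ 2%:E); last by rewrite ltry.
  apply: lime_le.
    by apply: is_cvg_nneseries => j _ _; apply: integral_ge0 => t _; exact: h0.
  near=> n; apply: (@le_trans _ _ (\sum_(0 <= j < n) (2 ^- j)%:E)%E).
    by apply: lee_sum => j _; exact: ih.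
  rewrite sumEFin lee_fin big_mkord.
  suff : \sum_(i < n) 2 ^- i = 2 - 2 * 2 ^- n :> R.
    by move=> ->; rewrite gerBl mulr_ge0// invr_ge0 exprn_ge0.
  elim: {+}n => [|m IH]; first by rewrite big_ord0 expr0 invr1 mulr1 subrr.
  by rewrite big_ord_recr IH /= (exprS 2 m) invfM; field.
have ae_cvg : {ae mu, forall t, I t -> cvgn (fun j => complex.Re (G (k j) t)) /\
    cvgn (fun j => complex.Im (G (k j) t))}.
  have aeH : {ae mu, forall t, I t -> H t \is a fin_num} by exact: integrable_ae.
  apply: ae_imply aeH => t + It => /(_ It) Hfin.
  pose c := (fine (H t)) `^ p^-1.
  have Dc j : D j t <= c * 2 ^- j.
    rewrite ler_pdivlMr ?exprn_gt0//.
    have : (h j t <= H t)%E.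
      have := @nneseries_lim_ge R (fun j => h j t) xpredT 0 (j.+1) (fun n _ _ => h0 n t).
      apply: le_trans; rewrite big_nat_recr//= leeDr// sume_ge0// => *; exact: h0.
    rewrite -(fineK Hfin) /h -EFinM lee_fin.
    rewrite -powRM ?exprn_ge0 ?cabs_ge0// => Hj.
    have := ge0_ler_powR (_ : 0 <= p^-1) _ _ Hj.
    rewrite invr_ge0 !nnegrE powR_ge0 p0 => /(_ isT isT).
    rewrite -powRrM mulfV; last by rewrite gt_eqF//; lra.
    rewrite powRr1 ?mulr_ge0 ?exprn_ge0 ?cabs_ge0// mulrC; apply.
    by rewrite fine_ge0// nneseries_ge0// => *; exact: h0.
  split; apply: (@geometric_cvg _ c) => j; apply: le_trans (Dc j).
    by rewrite -cReN -cReD cabs_Re.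
  by rewrite -cImN -cImD cabs_Im.
(* The upper limit is measurable and defined everywhere, and agrees with the limit where there is
   one. *)
pose g1 t := fine (limn_esup (fun j => (complex.Re (G (k j) t))%:E)).
pose g2 t := fine (limn_esup (fun j => (complex.Im (G (k j) t))%:E)).
have mg1 : measurable_fun I g1.
  apply: (@measurableT_comp _ _ _ _ _ _ fine); first exact: fine_measurable.
  apply: measurable_fun_limn_esup => n; apply/measurable_EFinP; exact: (mG _).1.
have mg2 : measurable_fun I g2.
  apply: (@measurableT_comp _ _ _ _ _ _ fine); first exact: fine_measurable.
  apply: measurable_fun_limn_esup => n; apply/measurable_EFinP; exact: (mG _).2.
pose g t : R[i] := Complex (g1 t) (g2 t).
have mg : cmeas g by split.
have esup (x : R^nat) : cvgn x -> x @ \oo --> fine (limn_esup (fun j => (x j)%:E)).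
  move=> cx; have : (fun j => (x j)%:E) @ \oo --> (limn x)%:E.
    by apply: cvg_EFin => //; near=> n.
  by move=> /cvg_limn_einf_sup[_ ->].
exists g => // e e0; have [N HN] := cG e e0; exists N => n nN.
apply: (@fatou_le _ (fun j t => (cabs (G (k (j + N)%N) t - G n t) `^ p)%:E)).
- by move=> j; apply: measurable_cabs_powR; exact: cmeasB.
- by move=> j t _; rewrite lee_fin powR_ge0.
- by apply: measurable_cabs_powR; exact: cmeasB.
- apply: ae_imply ae_cvg => t + It => /(_ It) [/esup h1 /esup h2].
  apply: cvg_EFin; first by near=> j.
  rewrite (cvg_shiftn N (fun j => cabs (G (k j) t - G n t) `^ p)).
  apply: cvg_powR => //; [by move=> j; exact: cabs_ge0|exact: cabs_ge0|].
  exact: cabs_cvg.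
- move=> j; apply: HN => //; apply: leq_trans (kj _); exact: leq_addl.
Unshelve. all: by end_near. Qed.

End Completeness.

(** * The operator mapping [h_n] to [f_n] *)

Section Multiplier.
Variable R : realType.
Local Open Scope classical_set_scope.
Local Notation mu := (@mu R).
Local Notation I := (@Iset R).
Implicit Types (t : R) (n M k : nat) (a b c d : nat -> R[i]) (p : R).
Implicit Types (f g u v : R -> R[i]).
Local Hint Extern 0 (measurable (@Iset _)) => exact: mI : core.

Definition trunc M a n : R[i] := if (hk n < M)%N then a n else 0.

Lemma HP_trunc M j a t : HP (M + j) (trunc M a) t = HP M a t.
Proof.
elim: j => [|j IH].
  by rewrite addn0; apply: HP_eq => n _ nM; rewrite /trunc nM.
by rewrite addnS HPS IH /trunc hk_leaf ltnNge leq_addr /= oppr0 if_same addr0.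
Qed.

Lemma Np2_HP M a : Np 2 (HP M a) = (l2 M a)%:E.
Proof.
rewrite Np_HP; congr (_%:E); apply: Ex_eq => l _.
by rewrite (powR_mulrn 2)// cabs_ge0.
Qed.

Lemma l2_mono M j a : l2 M a <= l2 (M + j) a.
Proof.
elim: j => [|j IH]; first by rewrite addn0.
apply: (le_trans IH); rewrite addnS l2S lerDl.
by apply: Ex_ge0 => l; exact: sqr_ge0.
Qed.

Lemma l2_trunc M K a : l2 M (trunc K a) <= l2 K a.
Proof.
apply: (le_trans (l2_mono M K (trunc K a))); rewrite addnC.
rewrite -lee_fin -!Np2_HP le_eqVlt; apply/orP; left; apply/eqP.
by apply: eq_integral => t _; rewrite HP_trunc.
Qed.

Lemma l2_tail M j a : l2 (M + j) (fun n => a n - trunc M a n) = l2 (M + j) a - l2 M a.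
Proof.
elim: j => [|j IH].
  rewrite addn0 subrr l2E big1// => k _.
  rewrite -[RHS](Ex_cst k 0 1); apply: Ex_eq => l lk.
  by rewrite /trunc /hk (lev_div lk) ltn_ord subrr cabs0 expr0n.
rewrite addnS !l2S IH addrAC; congr (_ + _ + _); apply: Ex_eq => l lM.
by rewrite /trunc /hk (lev_div lM) ltnNge leq_addr /= subr0.
Qed.

Lemma Np_l2 p M a : 1 < p -> p <= 2 -> (Np p (HP M a) <= (l2 M a `^ (p / 2))%:E)%E.
Proof.
move=> p1 p2; rewrite Np_HP lee_fin.
have -> : Ex M (fun l => cabs (val M a l) `^ p) 1 =
   Ex M (fun l => (cabs (val M a l) ^+ 2) `^ (p / 2)) 1.
  by apply: Ex_eq => l _; rewrite sqr_powR_half ?cabs_ge0.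
have [->|pn2] := eqVneq p 2.
  rewrite divff// powRr1 ?l2_ge0//; apply: Ex_le => l _.
  by rewrite powRr1// sqr_ge0.
apply: Ex_powR_le; [lra| |by move=> l; exact: sqr_ge0].
by rewrite ltr_pdivrMr// mul1r lt_neqAle pn2.
Qed.

(** By orthogonality, squared L^2 distances of partial sums are increments of the bounded monotone
    sequence [l2 M a]; [Np_l2] passes to L^p. *)
Lemma HP_cauchy p a (B : R) : 1 < p -> p <= 2 -> (forall M, l2 M a <= B) ->
  forall e : R, 0 < e -> exists N, forall m n, (N <= m)%N -> (N <= n)%N ->
    (Np p (fun t => (HP m a t - HP n a t)%R) <= e%:E)%E.
Proof.
move=> p1 p2 aB e e0; pose S M := l2 M a.
have Smono : {homo S : m n / (m <= n)%N >-> m <= n}.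
  by move=> m n mn; rewrite -(subnKC mn); exact: l2_mono.
have cS : cvgn S.
  by apply: nondecreasing_is_cvgn => //; exists B => _ [M _ <-]; exact: aB.
have SL M : S M <= limn S by exact: nondecreasing_cvgn_le.
pose dl := e `^ (p / 2)^-1.
have dl0 : 0 < dl by exact: powR_gt0.
have [N _ HN] : \forall n \near \oo, `|limn S - S n| <= dl by move/cvgrPdist_le : cS; apply.
exists N.
suff H m n : (N <= m)%N -> (m <= n)%N ->
    (Np p (fun t => (HP m a t - HP n a t)%R) <= e%:E)%E.
  move=> m n Nm Nn; have /orP[mn|nm] := leq_total m n; first exact: H.
  by rewrite Np_sym; exact: H.
move=> Nm mn; rewrite Np_sym.
have -> : Np p (fun t => HP n a t - HP m a t) = Np p (HP n (fun n => a n - trunc m a n)).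
  apply: eq_integral => t _; congr ((cabs _ `^ _)%:E).
  have -> : HP m a t = HP n (trunc m a) t by have := HP_trunc m (n - m) a t; rewrite subnKC.
  rewrite -(mulN1r (HP n (trunc m a) t)) -HPZ -HPD.
  by apply: HP_eq => l _ _; rewrite mulN1r.
apply: (le_trans (Np_l2 _ _ p1 p2)); rewrite -(subnKC mn) l2_tail lee_fin subnKC//.
have -> : e = dl `^ (p / 2).
  by rewrite /dl -powRrM mulVf ?powRr1 ?(ltW e0)//; rewrite gt_eqF//; lra.
rewrite ge0_ler_powR ?nnegrE ?subr_ge0 ?(ltW dl0)//; first lra.
  exact: Smono.
have := HN m Nm; rewrite ler_norml => /andP[_].
have := SL n; rewrite -/(S n) -/(S m); lra.
Qed.

Lemma le_addgt0_eq0 (x y : R) : 0 <= x -> (forall e : R, 0 < e -> x <= y * e) -> x = 0.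
Proof.
move=> x0 H; apply/eqP; rewrite eq_le x0 andbT; apply/ler_addgt0Pl => e e0.
have k0 : 0 < `|y| + 1 by rewrite ltr_wpDl.
rewrite addr0; apply: (le_trans (H _ (divr_gt0 e0 k0))).
rewrite mulrA ler_pdivrMr// mulrC ler_wpM2l ?(ltW e0)//.
by have := ler_norm y; lra.
Qed.

Lemma avc_limit p g b n : 1 < p -> (0 < n)%N -> inLp p g ->
  (forall e : R, 0 < e -> exists2 M, (hk n <= M)%N &
     (Np p (fun t => (g t - HP M b t)%R) <= e%:E)%E) ->
  avc g n = val (hk n) b n.
Proof.
move=> p1 n0 gp H; have p1' := ltW p1.
have : cabs (avc g n - val (hk n) b n) `^ p = 0.
  apply: (@le_addgt0_eq0 _ (2 ^+ hk n)); first exact: powR_ge0.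
  move=> e e0; have [M nM HM] := H e e0.
  rewrite -(avc_HP b n0 nM) -avcB//; last 2 first.
  - exact: (inLp_cint p1').
  - exact: (inLp_cint p1' (inLp_HP p M b)).
  have gM : inLp p (fun t => g t - HP M b t).
    by apply: inLpB (inLp_HP p M b) => //; lra.
  rewrite -lee_fin; apply: (le_trans (cabs_avc_Np p1 n0 gM)).
  by rewrite EFinM lee_wpmul2l ?lee_fin ?exprn_ge0.
by move/powR_eq0_eq0/cabs_eq0/eqP; rewrite subr_eq0 => /eqP.
Qed.

Lemma convD c a b n : conv c (fun n => a n + b n) n = conv c a n + conv c b n.
Proof. by rewrite /conv -big_split; apply: eq_bigr => i _; rewrite mulrDr. Qed.

Lemma convZ c (r : R[i]) a n : conv c (fun n => r * a n) n = r * conv c a n.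
Proof. by rewrite /conv mulr_sumr; apply: eq_bigr => i _; rewrite mulrCA. Qed.

Lemma eq_conv_pos c a b n : (0 < n)%N -> (forall m, (0 < m)%N -> (hk m <= hk n)%N -> a m = b m) ->
  conv c a n = conv c b n.
Proof.
move=> n0 ab; apply: eq_conv => // i ii; apply: ab.
  by rewrite divn_gt0 ?expn_gt0// dvdn_leq.
by apply: leq_trunc_log => //; exact: leq_div.
Qed.

Lemma Bd_l2 c : Bd 2 c -> exists2 D : R, 0 <= D & forall M a, l2 M (conv c a) <= D * l2 M a.
Proof.
move=> [D D0 HD]; exists D => // M a; rewrite -lee_fin EFinM -!Np2_HP !Np_HP.
by rewrite -EFinM lee_fin; exact: HD.
Qed.

Lemma Bd_Np p c : Bd p c -> exists2 D : R, 0 <= D &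
  forall M a, (Np p (HP M (conv c a)) <= D%:E * Np p (HP M a))%E.
Proof.
by move=> [D D0 HD]; exists D => // M a; rewrite !Np_HP -EFinM lee_fin.
Qed.

(** Even for a finite Haar sum the image has infinitely many coefficients; its partial sums converge
    by the L^2 bound. The L^p bound makes the contribution of the rest of [u] small uniformly in the
    level, so the partial sums are Cauchy in L^p. *)
Lemma mult_exists p c u : 1 < p -> p <= 2 -> Bd p c -> Bd 2 c -> inLp0 p u ->
  exists g, inLp0 p g /\ forall n, (0 < n)%N -> coef g n = conv c (coef u) n.
Proof.
move=> p1 p2 /Bd_Np[D D0 HD] /Bd_l2[D2 D20 HD2]; have p1' := ltW p1.
have p0 : 0 <= p by lra.
move=> /(inLp0P _ p1')[up u0]; have cu := inLp_cint p1' up.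
set b := conv c (coef u).
have mH M a : cmeas (HP M a) := cmeas_HP M a.
pose q := 2 `^ p; have q0 : 0 < q by exact: powR_gt0.
have cauchy_b (e : R) : 0 < e -> exists N, forall m n, (N <= m)%N -> (N <= n)%N ->
    (Np p (fun t => (HP m b t - HP n b t)%R) <= e%:E)%E.
  move=> e0; pose eta := e / (4 * q * q * (D + 1)).
  have k0 : 0 < 4 * q * q * (D + 1) by rewrite !mulr_gt0//; lra.
  have eta0 : 0 < eta by rewrite divr_gt0.
  have [K _ HK] := Np_dense 0 p1 up u0 eta0.
  pose w t := u t - HP K (coef u) t.
  have wp : inLp p w by exact: inLpB p0 up (inLp_HP _ _ _).
  have w0 : avc w 1 = 0.
    rewrite avcB// ?u0 ?avc_HP ?sub0r ?oppr0//.
    exact: (inLp_cint p1' (inLp_HP p K _)).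
  have cw n : (0 < n)%N -> coef w n = coef u n - trunc K (coef u) n.
    move=> n0; rewrite coefB// ?coef_HP//.
    exact: (inLp_cint p1' (inLp_HP p K _)).
  pose bs := conv c (trunc K (coef u)); pose bt := conv c (coef w).
  have bE M t : HP M b t = HP M bt t + HP M bs t.
    rewrite -HPD; apply: HP_eq => n n0 _; rewrite /bt /bs -convD.
    by apply: eq_conv_pos => // m m0 _; rewrite cw// subrK.
  have small M : (Np p (HP M bt) <= (D * eta)%:E)%E.
    apply: (le_trans (HD _ _)); rewrite EFinM.
    apply: lee_wpmul2l; first by rewrite lee_fin.
    exact: le_trans (Np_HP_coef M p1 wp w0) HK.
  have e20 : 0 < e / (2 * q) by rewrite divr_gt0// mulr_gt0.
  have [N HN] := @HP_cauchy p bs (D2 * l2 K (coef u)) p1 p2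
    (fun M => le_trans (HD2 M _) (ler_wpM2l D20 (l2_trunc M K _))) _ e20.
  exists N => m n Nm Nn.
  have -> : Np p (fun t => HP m b t - HP n b t) =
     Np p (fun t => (HP m bt t - HP n bt t) + (HP m bs t - HP n bs t)).
    by apply: eq_integral => t _; rewrite !bE; congr ((cabs _ `^ _)%:E); ring.
  apply: (le_trans (NpD _ _ p0)); [exact: cmeasB|exact: cmeasB|].
  apply: (@le_trans _ _ (q%:E * ((q * (D * eta + D * eta))%:E + (e / (2 * q))%:E))%E).
    rewrite lee_wpmul2l ?lee_fin ?powR_ge0// leeD//; last exact: HN.
    apply: (le_trans (NpB _ _ p0)) => //.
    by rewrite EFinM lee_wpmul2l ?lee_fin ?powR_ge0// EFinD leeD.
  rewrite -EFinD -EFinM lee_fin.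
  have -> : q * (q * (D * eta + D * eta) + e / (2 * q)) = 2 * q * q * D * eta + e / 2.
    by field; lra.
  have -> : 2 * q * q * D * eta = (e / 2) * (D / (D + 1)).
    by rewrite /eta; field; apply/andP; split; lra.
  have : (e / 2) * (D / (D + 1)) <= e / 2 * 1.
    by rewrite ler_wpM2l ?divr_ge0 ?(ltW e0)// ler_pdivrMr; lra.
  lra.
have [g mg Hg] := Lp_complete p1 (fun M => mH M b) cauchy_b.
have gp : inLp p g.
  apply/inLpP; split => //; have [N /(_ N (leqnn _)) HN] := Hg 1 ltr01.
  have -> : Np p g = Np p (fun t => (g t - HP N b t) + HP N b t).
    by apply: eq_integral => t _; rewrite subrK.
  apply: (le_lt_trans (NpD _ _ p0)); [exact: cmeasB|by []|].
  apply: (@le_lt_trans _ _ (q%:E * (1%:E + Np p (HP N b)))%E).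
    by rewrite lee_wpmul2l ?lee_fin ?powR_ge0// leeD2r.
  by rewrite Np_HP -EFinD -EFinM ltry.
have gE n : (0 < n)%N -> avc g n = val (hk n) b n.
  move=> n0; apply: (avc_limit p1 n0 gp) => e e0; have [N HN] := Hg e e0.
  exists (maxn (hk n) N); first exact: leq_maxl.
  by apply: HN; exact: leq_maxr.
exists g; split; first by apply/(inLp0P _ p1'); split => //; rewrite gE// /hk.
move=> n n0; rewrite /coef !gE ?double_gt0// hk_double// hk_doubleS//.
by rewrite val_double val_doubleS; field.
Qed.

Lemma coef_inj p f u : 1 < p -> inLp0 p f -> inLp0 p u ->
  (forall n, (0 < n)%N -> coef f n = coef u n) -> aeq f u.
Proof.
move=> p1 fp up fu; have p1' := ltW p1.
have [fp' f0] := (inLp0P _ p1').1 fp; have [up' u0] := (inLp0P _ p1').1 up.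
have [wp w0] := (inLp0P _ p1').1 (inLp0B p1' fp up).
have [mf _] := (inLpP _ _).1 fp'; have [mu' _] := (inLpP _ _).1 up'.
apply: (@Np0_aeq _ p) => //; first lra.
have cw n : (0 < n)%N -> coef (fun t => f t - u t) n = 0.
  move=> n0; rewrite coefB ?fu ?subrr//; exact: (inLp_cint p1').
have W : Np p (fun t => f t - u t) \is a fin_num by exact: Np_fin.
rewrite -(fineK W); congr (_%:E).
apply: (@le_addgt0_eq0 _ 1); first by rewrite fine_ge0// Np_ge0.
move=> e e0; rewrite mul1r -lee_fin fineK//.
have [M _] := Np_dense 0 p1 wp w0 e0; apply: le_trans.
rewrite le_eqVlt; apply/orP; left; apply/eqP; apply: eq_integral => t _.
have -> : HP M (coef (fun t => f t - u t)) t = HP M (fun=> 0) t.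
  by apply: HP_eq => n n0 _; rewrite cw.
by rewrite /HP val0 subr0.
Qed.

(** The factor 2^p is that of the triangle inequality [NpD] for p-th powers. *)
Lemma mult_bound p c (D : R) u g : 1 < p -> 0 <= D ->
  (forall M a, (Np p (HP M (conv c a)) <= D%:E * Np p (HP M a))%E) ->
  inLp0 p u -> inLp0 p g -> (forall n, (0 < n)%N -> coef g n = conv c (coef u) n) ->
  (Np p g <= (2 `^ p * D)%:E * Np p u)%E.
Proof.
move=> p1 D0 HD /(inLp0P _ (ltW p1))[up u0] /(inLp0P _ (ltW p1))[gp g0] gu.
have p0 : 0 <= p by lra.
have [mg _] := (inLpP _ _).1 gp.
apply/lee_addgt0Pr => e e0.
have q0 : 0 < 2 `^ p :> R by exact: powR_gt0.
have [M _ HM] := Np_dense 0 p1 gp g0 (divr_gt0 e0 q0).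
have -> : Np p g = Np p (fun t => HP M (coef g) t + (g t - HP M (coef g) t)).
  by apply: eq_integral => t _; rewrite addrC subrK.
apply: (le_trans (NpD _ _ p0)); [exact: cmeas_HP|by apply: cmeasB => //; exact: cmeas_HP|].
rewrite ge0_muleDr ?Np_ge0// leeD//.
  rewrite EFinM -muleA lee_wpmul2l ?lee_fin ?powR_ge0//.
  have -> : Np p (HP M (coef g)) = Np p (HP M (conv c (coef u))).
    apply: eq_integral => t _; congr ((cabs _ `^ _)%:E).
    by apply: HP_eq => n n0 _; exact: gu.
  apply: (le_trans (HD _ _)); apply: lee_wpmul2l; first by rewrite lee_fin.
  exact: Np_HP_coef.
apply: (@le_trans _ _ ((2 `^ p)%:E * (e / 2 `^ p)%:E)%E).
  by rewrite lee_wpmul2l ?lee_fin ?powR_ge0.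
by rewrite -EFinM mulrCA mulfV ?mulr1// gt_eqF.
Qed.

Lemma inLp0_eqI p f u : (forall t, I t -> f t = u t) -> inLp0 p f -> inLp0 p u.
Proof.
move=> fu [[m1 m2 h] h1 h2].
have E (F : R[i] -> \bar R) : (\int[mu]_(t in I) F (u t) = \int[mu]_(t in I) F (f t))%E.
  by apply: eq_integral => t /set_mem It; rewrite fu.
split; last 2 first.
- by rewrite -[RHS]h1; exact: (E (fun z => (complex.Re z)%:E)).
- by rewrite -[RHS]h2; exact: (E (fun z => (complex.Im z)%:E)).
split; last by rewrite (E (fun z => (cabs z `^ p)%:E)).
- by apply: eq_measurable_fun m1 => t /set_mem It; rewrite fu.
- by apply: eq_measurable_fun m2 => t /set_mem It; rewrite fu.
Qed.

Lemma haar_HP n t : (0 < n)%N -> I t -> haar n t = HP (hk n).+1 (@dirac1 R n) t.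
Proof. by move=> n0 It; rewrite HP_dirac// ltnSn. Qed.

Lemma inLp0_haar p n : 1 <= p -> (0 < n)%N -> inLp0 p (@haar R n).
Proof.
move=> p1 n0; apply: inLp0_eqI (inLp0_HP (hk n).+1 (@dirac1 R n) p1) => t It.
by rewrite haar_HP.
Qed.

Lemma avc_eqI f u n : (0 < n)%N -> (forall t, I t -> f t = u t) -> avc f n = avc u n.
Proof.
move=> n0 fu; apply: cplx_eq; apply: eq_av => t /(dy_I n0) It; by rewrite fu.
Qed.

Lemma coef_haar n m : (0 < n)%N -> (0 < m)%N -> coef (@haar R n) m = dirac1 R n m.
Proof.
move=> n0 m0.
have -> : coef (@haar R n) m = coef (HP (hk n).+1 (@dirac1 R n)) m.
  by rewrite /coef !(@avc_eqI (@haar R n) (HP (hk n).+1 (@dirac1 R n))) ?double_gt0// => t It; rewrite haar_HP.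
rewrite coef_HP//; case: ltnP => // mn; rewrite /dirac1.
by case: eqP mn => // ->; rewrite ltnn.
Qed.

(** * Dilations and translations of a chaos *)

Definition chaos_coef c f := forall t, I t -> exists N, forall M, (N <= M)%N ->
  f t = \sum_(k < M) c k * haar (2 ^ k) t.

Lemma hj_mul2X i n : (0 < n)%N -> hj (2 ^ i * n) = (2 ^ i * hj n)%N.
Proof.
by move=> n0; rewrite /hj /hk trunc_log_mul2X// expnD mulnBr.
Qed.

Lemma haar_chain i n t : (0 < n)%N ->
  haar (2 ^ i * n)%N t = haar (2 ^ i) (2 ^+ hk n * t - (hj n)%:R) :> R[i].
Proof.
move=> n0; rewrite /haar /dil hj_mul2X// /hk trunc_log_mul2X//.
have -> : hj (2 ^ i) = 0%N by rewrite /hj /hk trunc_expnK// subnn.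
rewrite trunc_expnK// subr0 exprD -mulrA -(natrX _ 2) natrM mulrBr.
by rewrite natrX.
Qed.

Lemma haar_out i n t : (0 < n)%N -> ~ dy n t -> haar (2 ^ i * n)%N t = 0 :> R[i].
Proof.
move=> n0 nt; rewrite haar_chain// /haar /dil.
have -> : hj (2 ^ i) = 0%N by rewrite /hj /hk trunc_expnK// subnn.
rewrite /hk trunc_expnK// subr0 -/(hk n) ifF//; apply/negP => /andP[h1 h2]; apply: nt.
have P0 : 0 < 2 ^+ i :> R by rewrite exprn_gt0.
have P1 : 1 <= 2 ^+ i :> R by rewrite exprn_ege1// ler1n.
rewrite dyE -natr1; move: h1 h2; rewrite pmulr_rgt0// => h1 h2.
apply/andP; split; [lra|nra].
Qed.

Lemma conv_dirac c n m : (0 < n)%N -> (0 < m)%N -> forall M, (hk m < M)%N ->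
  conv c (dirac1 R n) m = \sum_(i < M - hk n) c i * dirac1 R (2 ^ i * n)%N m.
Proof.
move=> n0 m0 M mM; set B := (M - hk n)%N.
(* Both sums are truncations of one finitely supported sum, at the 2-adic valuation of [m] and at
   [M - hk n]; they are compared through a common longer range [L]. *)
have E i : (i < (logn 2 m).+1)%N -> dirac1 R n (m %/ 2 ^ i)%N = dirac1 R (2 ^ i * n)%N m.
  rewrite ltnS -pfactor_dvdn// => im; rewrite /dirac1 eq_sym eqn_div ?expn_gt0// eq_sym.
  by rewrite mulnC.
pose F i := c i * dirac1 R (2 ^ i * n)%N m.
have wide K L : (K <= L)%N -> (forall i, (K <= i)%N -> F i = 0) ->
    \sum_(i < K) F i = \sum_(i < L) F i.
  move=> KL H; rewrite (big_ord_widen _ F KL) big_mkcond; apply: eq_bigr => i _.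
  by case: ltnP => // /H ->.
transitivity (\sum_(i < (logn 2 m).+1) F i).
  by apply: eq_bigr => i _; rewrite E.
set L := ((logn 2 m).+1 + B)%N.
rewrite (wide _ L) ?leq_addr//; last first.
  move=> i li; rewrite /F /dirac1; case: eqP => [mE|]; last by rewrite mulr0.
  have : (2 ^ i %| m)%N by rewrite mE dvdn_mulr.
  by rewrite pfactor_dvdn// leqNgt li.
rewrite -(wide B L) ?leq_addl//.
move=> i Bi; rewrite /F /dirac1; case: eqP => [mE|]; last by rewrite mulr0.
by move: mM; rewrite mE /hk trunc_log_mul2X// -/(hk n); move: Bi; rewrite /B; lia.
Qed.

Lemma HP_sum (J : Type) (s : seq J) M (F : J -> nat -> R[i]) t :
  HP M (fun n => \sum_(i <- s) F i n) t = \sum_(i <- s) HP M (F i) t.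
Proof. exact: val_sum. Qed.

Lemma HP_conv_dirac c n M t : (0 < n)%N -> I t ->
  HP M (conv c (dirac1 R n)) t = \sum_(i < M - hk n) c i * haar (2 ^ i * n)%N t.
Proof.
move=> n0 It; rewrite (@HP_eq _ M _ (fun m => \sum_(i < M - hk n) c i * dirac1 R (2 ^ i * n)%N m)).
  rewrite HP_sum; apply: eq_bigr => i _; rewrite HPZ HP_dirac ?muln_gt0 ?expn_gt0//.
  by rewrite ifT// /hk trunc_log_mul2X// -/(hk n); have := ltn_ord i; lia.
by move=> m m0 mM; exact: conv_dirac.
Qed.

Lemma dil_chain c f n t : chaos_coef c f -> (0 < n)%N -> I t ->
  exists N, forall M, (N <= M)%N -> dil f n t = HP M (conv c (dirac1 R n)) t.
Proof.
move=> fc n0 It; have [nt|nt] := pselect (dy n t); last first.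
  exists 0%N => M _; rewrite HP_conv_dirac// big1; last first.
    by move=> i _; rewrite haar_out// mulr0.
  rewrite /dil; case: ifP => // /andP[h1 h2]; exfalso; apply: nt.
  by rewrite dyE -natr1; apply/andP; split; lra.
have sI : I (2 ^+ hk n * t - (hj n)%:R).
  move: nt; rewrite dyE -natr1 => /andP[h1 h2].
  by rewrite /Iset /= in_itv /=; apply/andP; split; lra.
have [N HN] := fc _ sI; exists (N + hk n)%N => M NM.
rewrite HP_conv_dirac// /dil; move: (sI); rewrite /Iset /= in_itv /= => ->.
rewrite (HN (M - hk n)%N); last by lia.
by apply: eq_bigr => i _; rewrite haar_chain.
Qed.

End Multiplier.

(** * The multiplier bounds and the equivalence with the Haar system *)

Section Equivalence.
Variable R : realType.
Local Open Scope classical_set_scope.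
Local Notation mu := (@mu R).
Local Notation I := (@Iset R).
Implicit Types (t : R) (n M k : nat) (a b c d : nat -> R[i]) (p : R).
Implicit Types (f g u v : R -> R[i]).
Local Hint Extern 0 (measurable (@Iset _)) => exact: mI : core.
Local Hint Extern 0 (measurable (dy _)) => exact: measurable_dy : core.

Lemma cmeas_lim (G : nat -> R -> R[i]) f : (forall k, cmeas (G k)) ->
  (forall t, I t -> exists N, forall M, (N <= M)%N -> f t = G M t) -> cmeas f.
Proof.
move=> mG H; split; apply/measurable_EFinP.
  apply: (@emeasurable_fun_cvg _ _ _ _ (fun k t => (complex.Re (G k t))%:E)).
    by move=> k; apply/measurable_EFinP; exact: (mG k).1.
  move=> t It; have [N HN] := H t It; apply: cvg_near_cst; near=> M.
  by rewrite /= (HN M)//; near: M; exact: nbhs_infty_ge.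
apply: (@emeasurable_fun_cvg _ _ _ _ (fun k t => (complex.Im (G k t))%:E)).
  by move=> k; apply/measurable_EFinP; exact: (mG k).2.
move=> t It; have [N HN] := H t It; apply: cvg_near_cst; near=> M.
by rewrite /= (HN M)//; near: M; exact: nbhs_infty_ge.
Unshelve. all: by end_near. Qed.

Lemma Np_lim p (G : nat -> R -> R[i]) (w : R -> R[i]) f (K : \bar R) : 1 < p ->
  (forall k, cmeas (G k)) -> cmeas w ->
  (forall t, I t -> exists N, forall M, (N <= M)%N -> f t = G M t) ->
  (forall k, Np p (fun t => (w t - G k t)%R) <= K)%E ->
  (Np p (fun t => (w t - f t)%R) <= K)%E.
Proof.
move=> p1 mG mw H HK; have mf := cmeas_lim mG H.
apply: (@fatou_le _ (fun k t => (cabs (w t - G k t) `^ p)%:E)) => //.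
- by move=> k; apply: measurable_cabs_powR; exact: cmeasB.
- by move=> k t _; rewrite lee_fin powR_ge0.
- by apply: measurable_cabs_powR; exact: cmeasB.
- apply: (@ae_imply _ (fun=> True)); last by exists set0; split => // t /=.
  move=> t _ It; have [N HN] := H t It; apply: cvg_near_cst; near=> M.
  by rewrite (HN M)//; near: M; exact: nbhs_infty_ge.
Unshelve. all: by end_near. Qed.

(** The partial sums of [g] approach [g] in L^p and are eventually equal to f_n at each point.
    Fatou's lemma identifies the two limits, with no prior knowledge that f_n is in L^p. *)
Lemma dil_coef p c f g n : 1 < p -> chaos_coef c f -> (0 < n)%N -> inLp0 p g ->
  (forall m, (0 < m)%N -> coef g m = conv c (dirac1 R n) m) -> aeq g (dil f n).
Proof.
move=> p1 fc n0 /(inLp0P _ (ltW p1))[gp g0] gc.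
have [mg _] := (inLpP _ _).1 gp.
have lim t : I t -> exists N, forall M, (N <= M)%N ->
    dil f n t = HP M (coef g) t.
  move=> It; have [N HN] := dil_chain fc n0 It; exists N => M NM.
  by rewrite (HN M)//; apply: HP_eq => m m0 _; rewrite gc.
have mf : cmeas (dil f n) by apply: (cmeas_lim _ lim) => k; exact: cmeas_HP.
apply: (@Np0_aeq _ p) => //; first lra.
apply/eqP; rewrite eq_le Np_ge0 andbT; apply/lee_addgt0Pr => e e0; rewrite add0e.
pose P j M := (j <= M)%N /\ (Np p (fun t => (g t - HP M (coef g) t)%R) <= e%:E)%E.
have exM j : exists M, P j M.
  by have [M jM HM] := Np_dense j p1 gp g0 e0; exists M.
have [K HK] := choice exM.
apply: (@Np_lim _ (fun j => HP (K j) (coef g))) => //.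
- by move=> k; exact: cmeas_HP.
- move=> t It; have [N HN] := lim t It; exists N => M NM; apply: HN.
  exact: leq_trans NM (HK M).1.
- by move=> k; exact: (HK k).2.
Qed.

Lemma Lpnorm_le p (A : R) f u : 0 < p -> 0 <= A -> inLp p f -> inLp p u ->
  (Np p f <= A%:E * Np p u)%E -> Lpnorm p f <= A `^ p^-1 * Lpnorm p u.
Proof.
move=> p0 A0 fp up H; rewrite /Lpnorm -/(Np p f) -/(Np p u).
rewrite -powRM ?fine_ge0 ?Np_ge0// ge0_ler_powR ?invr_ge0 ?(ltW p0) ?nnegrE//.
- by rewrite fine_ge0 ?Np_ge0.
- by rewrite mulr_ge0 ?fine_ge0 ?Np_ge0.
by rewrite -lee_fin EFinM !fineK// Np_fin.
Qed.

Lemma powR_inv_le p (C x y : R) : 0 < p -> 0 <= C -> 0 <= x -> 0 <= y ->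
  x `^ p^-1 <= C * y `^ p^-1 -> x <= C `^ p * y.
Proof.
move=> p0 C0 x0 y0 H; have := ge0_ler_powR (ltW p0) _ _ H.
rewrite !nnegrE powR_ge0 mulr_ge0 ?powR_ge0// => /(_ isT isT).
have pn0 : p != 0 by rewrite gt_eqF.
have E (z : R) : 0 <= z -> (z `^ p^-1) `^ p = z.
  by move=> z0; rewrite -powRrM mulVf// powRr1.
by rewrite (powRM _ C0 (powR_ge0 _ _)) (E _ x0) (E _ y0).
Qed.

Lemma Np_Lpnorm p (C : R) f u : 0 < p -> 0 <= C -> inLp p f -> inLp p u ->
  Lpnorm p f <= C * Lpnorm p u -> (Np p f <= (C `^ p)%:E * Np p u)%E.
Proof.
move=> p0 C0 fp up; rewrite /Lpnorm -/(Np p f) -/(Np p u) => H.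
rewrite -(fineK (Np_fin fp)) -(fineK (Np_fin up)) -EFinM lee_fin.
by apply: powR_inv_le H => //; rewrite fine_ge0 ?Np_ge0.
Qed.

Lemma equiv_of_Bd p c d f : 1 < p -> p <= 2 -> chaos_coef c f ->
  Bd p c -> Bd 2 c -> Bd p d -> Bd 2 d -> (forall m, cauchy d c m = delta R m) ->
  equiv_haar p (dil f).
Proof.
move=> p1 p2 fc Bpc B2c Bpd B2d dc; have p1' := ltW p1.
have p0 : 0 < p by lra.
have cd m : cauchy c d m = delta R m by rewrite cauchyC.
pose S u g := inLp0 p g /\ forall n, (0 < n)%N -> coef g n = conv c (coef u) n.
(* The image is chosen among representatives, so linearity holds only almost everywhere, by
   [coef_inj]; the default 0 is taken only outside L^p_0. *)
pose T u := xget (fun=> 0) (S u).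
have TS u : inLp0 p u -> S u (T u).
  by move=> up; have [g Hg] := mult_exists p1 p2 Bpc B2c up; exact: (xgetPex _ (ex_intro _ g Hg)).
have [D1 D10 HD1] := Bd_Np Bpc; have [D2 D20 HD2] := Bd_Np Bpd.
pose A1 := 2 `^ p * D1; pose A2 := 2 `^ p * D2.
have A10 : 0 <= A1 by rewrite mulr_ge0 ?powR_ge0.
have A20 : 0 <= A2 by rewrite mulr_ge0 ?powR_ge0.
have toLp u : inLp0 p u -> inLp p u by move=> /(inLp0P _ p1')[].
have ci u : inLp0 p u -> cint u by move=> /toLp/(inLp_cint p1').
have inv u n : inLp0 p u -> (0 < n)%N -> coef u n = conv d (coef (T u)) n.
  move=> up n0; rewrite -[LHS](conv_inv (coef u) n0 dc).
  by apply: eq_conv_pos => // m m0 _; rewrite (TS _ up).2.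
have [C0 C1 C2] : [/\ 0 < A1 `^ p^-1 + A2 `^ p^-1 + 1,
    A1 `^ p^-1 <= A1 `^ p^-1 + A2 `^ p^-1 + 1 & A2 `^ p^-1 <= A1 `^ p^-1 + A2 `^ p^-1 + 1].
  move: (A1 `^ p^-1) (A2 `^ p^-1) (powR_ge0 A1 p^-1) (powR_ge0 A2 p^-1) => x y x0 y0.
  by split; lra.
exists T, (A1 `^ p^-1 + A2 `^ p^-1 + 1); split=> //.
- by move=> u /TS[].
- move=> u v up vp uv; apply: (coef_inj p1 (TS _ up).1 (TS _ vp).1) => n n0.
  rewrite (TS _ up).2// (TS _ vp).2//; apply: eq_conv_pos => // m m0 _.
  by apply: aeq_coef => //; exact: ci.
split.
- move=> r s u v up vp; have rsp := inLp0_lin r s p1' up vp.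
  apply: (coef_inj p1 (TS _ rsp).1 (inLp0_lin r s p1' (TS _ up).1 (TS _ vp).1)) => n n0.
  rewrite (TS _ rsp).2// coef_lin//; last 2 first.
  + exact: ci (TS _ up).1.
  + exact: ci (TS _ vp).1.
  rewrite (TS _ up).2// (TS _ vp).2// -!convZ -convD.
  by apply: eq_conv_pos => // m m0 _; rewrite coef_lin//; exact: ci.
- move=> u up; have Tp := (TS _ up).1.
  have n1 : 0 <= Lpnorm p u by exact: powR_ge0.
  have n2 : 0 <= Lpnorm p (T u) by exact: powR_ge0.
  have [h1 h2] : Lpnorm p (T u) <= A1 `^ p^-1 * Lpnorm p u /\
      Lpnorm p u <= A2 `^ p^-1 * Lpnorm p (T u).
    split; apply: Lpnorm_le => //; [exact: toLp|exact: toLp| |exact: toLp|exact: toLp|].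
      exact: mult_bound p1 D10 HD1 up Tp (TS _ up).2.
    exact: mult_bound p1 D20 HD2 Tp up (fun n => @inv u n up).
  move: (Lpnorm p u) (Lpnorm p (T u)) n1 n2 h1 h2 => x y x0 y0 h1 h2.
  by split; [exact: le_trans h1 (ler_wpM2r x0 C1)|exact: le_trans h2 (ler_wpM2r y0 C2)].
- move=> v vp; have [u [up uc]] := mult_exists p1 p2 Bpd B2d vp.
  exists u; split => //; apply: (coef_inj p1 (TS _ up).1 vp) => n n0.
  rewrite (TS _ up).2// -[RHS](conv_inv (coef v) n0 cd).
  by apply: eq_conv_pos => // m m0 _; rewrite uc.
- move=> n n0; have hp := inLp0_haar p1' n0.
  apply: (dil_coef p1 fc n0 (TS _ hp).1) => m m0; rewrite (TS _ hp).2//.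
  by apply: eq_conv_pos => // j j0 _; rewrite coef_haar.
Qed.

Lemma Ex_delta M l0 n : (l0 %/ 2 ^ M = n)%N ->
  Ex M (fun l => (l == l0)%:R) n = 2 ^- M :> R.
Proof.
elim: M l0 => [|M IH] l0.
  by rewrite expn0 divn1 => ->; rewrite Ex0 eqxx expr0 invr1.
rewrite expnS divnMA divn2 => ln; rewrite ExSr exprS invfM -(IH _ ln) -ExZ.
apply: Ex_eq => l _; rewrite /avg2 mulrC; congr (_ * _).
rewrite -natrD; congr (_%:R); have := odd_double_half l0; case: (odd l0) => /= h.
  have -> : (l.*2 == l0) = false by apply/negbTE/eqP => h'; lia.
  by rewrite add0n; congr nat_of_bool; apply/eqP/eqP; lia.
have -> : (l.*2.+1 == l0) = false by apply/negbTE/eqP => h'; lia.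
by rewrite addn0; congr nat_of_bool; apply/eqP/eqP; lia.
Qed.

(** The total mean supplies the one missing value at level [M]; coarser averages are means of those
    of level [M]. *)
Lemma av_vanish (g : R -> R) M l0 : mu.-integrable I (EFin \o g) -> av g 1 = 0 ->
  (l0 %/ 2 ^ M = 1)%N ->
  (forall l, (l %/ 2 ^ M = 1)%N -> l != l0 -> av g l = 0) ->
  forall x, (0 < x)%N -> (hk x <= M)%N -> av g x = 0.
Proof.
move=> ig g1 lM H.
have gl0 : av g l0 = 0.
  have : Ex M (fun l => av g l0 * (l == l0)%:R) 1 = 0.
    rewrite -[RHS]g1 (av_Ex M (isT : (0 < 1)%N) ig); apply: Ex_eq => l lM'.
    by case: eqP => [->|/eqP/(H _ lM') ->]; rewrite ?mulr1 ?mulr0.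
  rewrite ExZ Ex_delta// => /eqP; rewrite mulf_eq0 invr_eq0 expf_eq0/= pnatr_eq0 andbF orbF.
  by move/eqP.
move=> x x0 xM; rewrite (av_Ex (M - hk x) x0 ig) -[RHS](Ex_cst (M - hk x) 0 x).
apply: Ex_eq => l lx.
have [->//|ll] := eqVneq l l0; apply: H => //.
rewrite -{1}(subnK xM) expnD divnMA lx.
have := @trunc_log_ltn 2 x isT; rewrite -/(hk x) expnS => h1.
apply/eqP; rewrite eqn_leq -ltnS ltn_divLR ?expn_gt0// divn_gt0 ?expn_gt0//.
by rewrite h1; exact: trunc_logP.
Qed.

Lemma av_ae0 (g : R -> R) n : (0 < n)%N -> mu.-integrable I (EFin \o g) ->
  {ae mu, forall t, dy n t -> g t = 0} -> av g n = 0.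
Proof.
move=> n0 ig g0; rewrite -[RHS](av_cst 0 n); congr (_ * fine _).
apply: ae_eq_integral => //; first exact: measurable_int (integrable_dy n0 ig).
by apply: ae_imply g0 => t + nt => ->.
Qed.

Lemma HP_stable c n M t : (0 < n)%N -> (hk n <= M)%N ->
  leaf M t <> (2 ^ (M - hk n) * n)%N -> forall j,
  HP (M + j) (conv c (dirac1 R n)) t = HP M (conv c (dirac1 R n)) t.
Proof.
move=> n0 nM lt; elim=> [|j IH]; first by rewrite addn0.
rewrite addnS HPS IH.
suff -> : conv c (dirac1 R n) (leaf (M + j) t) = 0 by rewrite oppr0 if_same addr0.
have lp := leaf_gt0 (M + j) t.
rewrite (@conv_dirac _ c n _ n0 lp (M + j).+1) ?hk_leaf// big1// => i _.
rewrite /dirac1; case: eqP => [E|]; last by rewrite mulr0.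
exfalso; apply: lt.
have iE : (nat_of_ord i = M - hk n + j)%N.
  by have := hk_leaf (M + j) t; rewrite E /hk trunc_log_mul2X// -/(hk n); lia.
by rewrite -(leaf_div M j) E iE expnD mulnAC mulnK ?expn_gt0.
Qed.

(** The series of f_n is only known to converge pointwise, so its coefficients cannot be computed
    term by term. Off a single interval of level [M] it has already reached its final value; the
    difference [w] to the partial sum thus has zero averages over the others, and the mean zero of
    [g] settles the last one. *)
Lemma coef_dil p c f g n : 1 < p -> chaos_coef c f -> (0 < n)%N -> inLp0 p g ->
  aeq g (dil f n) -> forall m, (0 < m)%N -> coef g m = conv c (dirac1 R n) m.
Proof.
move=> p1 fc n0 /(inLp0P _ (ltW p1))[gp g0] gf m m0; have p1' := ltW p1.
set ch := conv c (dirac1 R n); pose M := (maxn (hk n) (hk m)).+1.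
pose w t := g t - HP M ch t.
have wp : inLp p w by apply: inLpB (inLp_HP p M ch) => //; lra.
have cw := inLp_cint p1' wp; have [cw1 cw2] := cw.
have cg := inLp_cint p1' gp.
have cH := inLp_cint p1' (inLp_HP p M ch).
have nM : (hk n <= M)%N by rewrite /M leqW// leq_maxl.
have mM : (hk m < M)%N by rewrite /M ltnS leq_maxr.
have w1 : avc w 1 = 0 by rewrite avcB// g0 avc_HP// sub0r oppr0.
(* The node of level [M] on the chain of [n], below which the series still changes. *)
pose l0 := (2 ^ (M - hk n) * n)%N.
have l0M : (l0 %/ 2 ^ M = 1)%N.
  have := @trunc_logP 2 l0 isT; have := @trunc_log_ltn 2 l0 isT.
  rewrite /l0 trunc_log_mul2X// -/(hk n) subnK// -/l0 => h1 h2.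
  apply/eqP; rewrite eqn_leq -ltnS ltn_divLR ?expn_gt0// divn_gt0 ?expn_gt0//.
  rewrite -expnS h1 h2// /l0 muln_gt0 expn_gt0//.
have wae l : (l %/ 2 ^ M = 1)%N -> l != l0 -> {ae mu, forall t, dy l t -> w t = 0}.
  move=> lM ll; have lp : (0 < l)%N by case: l lM {ll} => //; rewrite div0n.
  apply: ae_imply gf => t + lt; have It := dy_I lp lt; move=> /(_ It) gt.
  have [N HN] := dil_chain fc n0 It; rewrite /w gt (HN (M + N)%N) ?leq_addl//.
  rewrite HP_stable ?subrr// => E; move/eqP: ll; apply.
  by rewrite -(leaf_dy lp lt) /hk (lev_div lM).
have w0 x : (0 < x)%N -> (hk x <= M)%N -> avc w x = 0.
  move=> x0 xM; apply: cplx_eq => /=.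
    apply: (av_vanish cw1 _ l0M _ x0 xM).
      by rewrite -[LHS]/(complex.Re (avc w 1)) w1.
    move=> l lM ll; apply: av_ae0 => //; first by case: l lM {ll} => //; rewrite div0n.
    by apply: ae_imply (wae _ lM ll) => t + lt => ->.
  apply: (av_vanish cw2 _ l0M _ x0 xM).
    by rewrite -[LHS]/(complex.Im (avc w 1)) w1.
  move=> l lM ll; apply: av_ae0 => //; first by case: l lM {ll} => //; rewrite div0n.
  by apply: ae_imply (wae _ lM ll) => t + lt => ->.
have : coef w m = 0.
  by rewrite /coef !w0 ?double_gt0 ?hk_double ?hk_doubleS// subrr mul0r.
by rewrite coefB// coef_HP// mM => /eqP; rewrite subr_eq0 => /eqP.
Qed.

Lemma coef_small p f n : 1 < p -> (0 < n)%N -> inLp p f ->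
  ((cabs (coef f n) `^ p)%:E <= (2 ^+ (hk n).+1)%:E * Np p f)%E.
Proof.
move=> p1 n0 fp.
have n1 : (0 < n.*2)%N by rewrite double_gt0.
have := cabs_avc_Np p1 n1 fp; have := cabs_avc_Np p1 (isT : (0 < n.*2.+1)%N) fp.
rewrite (hk_double n0) (hk_doubleS n0); set X := avc f n.*2.+1; set Y := avc f n.*2.
move=> hX hY.
have : cabs (coef f n) <= Num.max (cabs X) (cabs Y).
  rewrite /coef cabsM -/X -/Y.
  have -> : cabs (2^-1 : R[i]) = (2^-1 : R).
    rewrite /cabs Normc.normcV; congr (_^-1).
    by rewrite -[2]/(1 *+ 2) normcMn Normc.normc1.
  rewrite ler_pdivrMr//; apply: (le_trans (cabsB _ _)).
  move: (cabs X) (cabs Y) => x y.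
  by have /orP[xy|yx] := le_total x y; [rewrite max_r//|rewrite max_l//]; lra.
rewrite le_max => /orP[] h; have p0 := ltW (lt_trans ltr01 p1).
  by apply: le_trans hX; rewrite lee_fin; apply: ge0_ler_powR; rewrite // nnegrE cabs_ge0.
by apply: le_trans hY; rewrite lee_fin; apply: ge0_ler_powR; rewrite // nnegrE cabs_ge0.
Qed.

Lemma haar_sum M a t : I t -> HP M a t = \sum_(1 <= n < 2 ^ M) a n * haar n t.
Proof.
move=> It; rewrite (@HP_eq _ M _ (fun m => \sum_(1 <= n < 2 ^ M) a n * dirac1 R n m)).
  rewrite HP_sum; apply: eq_big_nat => n /andP[n0 nM]; rewrite HPZ HP_dirac//.
  rewrite ifT// /hk -(ltn_exp2l _ _ (isT : (1 < 2)%N)).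
  by apply: leq_ltn_trans nM; exact: trunc_logP.
move=> m m0 mM; have mI : m \in index_iota 1 (2 ^ M).
  rewrite mem_index_iota m0 (leq_trans (@trunc_log_ltn 2 m isT))//.
  by rewrite leq_exp2l.
rewrite (bigD1_seq m)//= ?iota_uniq// /dirac1 eqxx mulr1 big1 ?addr0//.
by move=> n /negbTE nm; rewrite eq_sym nm mulr0.
Qed.

(** Once [T] is known to act as [conv c] on Haar coefficients, its two norm bounds pass to [conv c]
    and to [conv (cinv c)], because cutting at level [M] contracts the norm. *)
Lemma Bd_of_equiv p c f : 1 < p -> chaos_coef c f -> equiv_haar p (dil f) ->
  [/\ c 0%N != 0, Bd p c & Bd p (cinv c)].
Proof.
move=> p1 fc [T [C [C0 TL Tae [Tlin Tbd Tonto Thaar]]]].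
have p1' := ltW p1; have p0 : 0 < p by lra.
have toLp u : inLp0 p u -> inLp p u by move=> /(inLp0P _ p1')[].
have ci u : inLp0 p u -> cint u by move=> /toLp/(inLp_cint p1').
have mean0 u : inLp0 p u -> avc u 1 = 0 by move=> /(inLp0P _ p1')[].
have cm u : inLp0 p u -> cmeas u by move=> /toLp/inLpP[].
pose P u := inLp0 p u /\ forall m, (0 < m)%N -> coef (T u) m = conv c (coef u) m.
have TN u : inLp0 p u -> (Np p (T u) <= (C `^ p)%:E * Np p u)%E.
  move=> up; apply: Np_Lpnorm => //; [exact: ltW|exact/toLp/TL|exact: toLp|].
  exact: (Tbd u up).1.
have TN' u : inLp0 p u -> (Np p u <= (C `^ p)%:E * Np p (T u))%E.
  move=> up; apply: Np_Lpnorm => //; [exact: ltW|exact: toLp|exact/toLp/TL|].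
  exact: (Tbd u up).2.
have Plin (r s : R[i]) u v : P u -> P v -> P (fun t => r * u t + s * v t).
  move=> [up uc] [vp vc]; have rsp := inLp0_lin r s p1' up vp; split => // m m0.
  rewrite (aeq_coef m0 _ _ (Tlin r s u v up vp)); last 2 first.
  - exact/ci/TL.
  - by apply/ci/inLp0_lin => //; exact: TL.
  rewrite coef_lin//; [|exact/ci/TL|exact/ci/TL]; rewrite uc// vc// -!convZ -convD.
  by apply: eq_conv_pos => // j j0 _; rewrite coef_lin//; exact: ci.
have Peq u v : (forall t, I t -> u t = v t) -> P u -> P v.
  move=> uv [up uc]; have vp := inLp0_eqI uv up; split => // m m0.
  rewrite -(aeq_coef m0 _ _ (Tae _ _ up vp (aeq_eqI uv))); try exact/ci/TL.
  rewrite uc//; apply: eq_conv_pos => // j j0 _.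
  by rewrite /coef !(avc_eqI _ uv)// double_gt0.
have Phaar n : (0 < n)%N -> P (@haar R n).
  move=> n0; have hp := inLp0_haar p1' n0; split => // m m0.
  rewrite (coef_dil p1 fc n0 (TL _ hp) (Thaar n n0))//.
  by apply: eq_conv_pos => // j j0 _; rewrite coef_haar.
have Psum a N : P (fun t => \sum_(1 <= n < N.+1) a n * haar n t).
  elim: N => [|N IH].
    apply: Peq (Plin 0 0 _ _ (Phaar 1%N isT) (Phaar 1%N isT)) => t _.
    by rewrite big_geq// !mul0r addr0.
  apply: Peq (Plin 1 (a N.+1) _ _ IH (Phaar N.+1 isT)) => t _.
  by rewrite mul1r [RHS]big_nat_recr.
have PHP M a : P (HP M a).
  apply: Peq (Psum a (2 ^ M).-1) => t It.
  by rewrite prednK ?expn_gt0// haar_sum.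
(* Linearity has settled finite Haar sums; density and the continuity of coefficients do the rest.
   The coefficient [m] of the image reads [u] only up to the level of [m], so cutting [u] beyond it
   changes nothing on the side of [conv c]. *)
have coefT u : inLp0 p u -> P u.
  move=> up; split => // m m0; have [up' u0] := (inLp0P _ p1').1 up.
  apply/eqP; rewrite -subr_eq0; apply/eqP/cabs_eq0.
  apply: (@powR_eq0_eq0 _ _ p).
  apply: (@le_addgt0_eq0 _ _ (2 ^+ (hk m).+1 * C `^ p)); first exact: powR_ge0.
  move=> e e0; have [K mK HK] := Np_dense (hk m).+1 p1 up' u0 e0.
  set s := HP K (coef u); have [sp sc] := PHP K (coef u).
  have wp := inLp0B p1' up sp.
  have E : coef (T u) m - conv c (coef u) m = coef (T (fun t => u t - s t)) m.
    have -> : conv c (coef u) m = conv c (coef s) m.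
      apply: eq_conv_pos => // j j0 jm; rewrite /s coef_HP// ifT//.
      exact: leq_ltn_trans jm mK.
    rewrite -sc// -coefB//; [|exact/ci/TL|exact/ci/TL].
    have := Tlin 1 (-1) u s up sp.
    have -> : (fun x => 1 * u x + -1 * s x) = (fun t => u t - s t).
      by apply/funext => t; rewrite mul1r mulN1r.
    have -> : (fun x => 1 * T u x + -1 * T s x) = (fun t => T u t - T s t).
      by apply/funext => t; rewrite mul1r mulN1r.
    move=> h; apply/esym/(aeq_coef m0 _ _ h); first exact/ci/TL.
    exact: ci (inLp0B p1' (TL _ up) (TL _ sp)).
  rewrite E -lee_fin; apply: (le_trans (coef_small p1 m0 (toLp _ (TL _ wp)))).
  rewrite -mulrA EFinM lee_wpmul2l ?lee_fin ?exprn_ge0//.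
  apply: (le_trans (TN _ wp)).
  by rewrite EFinM lee_wpmul2l ?lee_fin ?powR_ge0.
(* Of all c_i only c_0 enters the coefficient of h_1 in an image, and h_1 is an image. *)
have c0 : c 0%N != 0.
  have hp := @inLp0_haar R p 1 p1' isT.
  have [u [up Tu]] := Tonto _ hp.
  have := (coefT u up).2 1%N isT.
  rewrite (aeq_coef (isT : (0 < 1)%N) _ _ Tu); [|exact/ci/TL|exact: ci].
  rewrite coef_haar// /dirac1 eqxx /conv logn1 big_ord1 => h.
  by apply/eqP => h0; move: h; rewrite h0 mul0r => /eqP; rewrite oner_eq0.
split => //.
  exists (C `^ p); first exact: powR_ge0.
  move=> M a; rewrite -lee_fin EFinM -!Np_HP; have [sp sc] := PHP M a.
  apply: le_trans (TN _ sp).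
  have -> : Np p (HP M (conv c a)) = Np p (HP M (coef (T (HP M a)))).
    apply: eq_integral => t _; congr ((cabs _ `^ _)%:E); apply: HP_eq => n n0 nM.
    rewrite sc//; apply: eq_conv_pos => // m m0 mn.
    by rewrite coef_HP// ifT// (leq_ltn_trans mn).
  by apply: Np_HP_coef => //; [exact/toLp/TL|exact/mean0/TL].
exists (C `^ p); first exact: powR_ge0.
(* The preimage [u] of a finite sum may have coefficients on all levels; on those below [M] they are
   the ones of [conv (cinv c) a]. *)
move=> M a; rewrite -lee_fin EFinM -!Np_HP; have [sp _] := PHP M a.
have [u [up Tu]] := Tonto _ sp.
rewrite -(aeq_Np p (cm _ (TL _ up)) (cm _ sp) Tu).
apply: le_trans (TN' _ up).
have -> : Np p (HP M (conv (cinv c) a)) = Np p (HP M (coef u)).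
  apply: eq_integral => t _; congr ((cabs _ `^ _)%:E); apply: HP_eq => n n0 nM.
  rewrite -[RHS](conv_inv (coef u) n0 (fun m => cinvE m c0)).
  apply: eq_conv_pos => // m m0 mn; rewrite -(coefT u up).2//.
  rewrite (aeq_coef m0 _ _ Tu); [|exact/ci/TL|exact: ci].
  by rewrite coef_HP// ifT// (leq_ltn_trans mn).
by apply: Np_HP_coef => //; [exact: toLp|exact: mean0].
Qed.

Lemma chaos_inL2 c f : chaos_coef c f -> Bd 2 c -> inLp 1 f -> inLp 2 f.
Proof.
move=> fc /Bd_l2[D D0 HD] /inLpP[mf _]; apply/inLpP; split => //.
have f1 t : I t -> dil f 1 t = f t.
  rewrite /Iset /= in_itv /= => It; rewrite /dil.
  have -> : hk 1 = 0%N by []. have -> : hj 1 = 0%N by [].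
  by rewrite expr0 mul1r subr0 It.
apply: (@le_lt_trans _ _ (D * l2 1 (dirac1 R 1))%:E); last by rewrite ltry.
have -> : Np 2 f = Np 2 (fun t => 0 - f t).
  by apply: eq_integral => t _; rewrite sub0r cabsN.
apply: (@Np_lim _ (fun M => HP M (conv c (dirac1 R 1)))).
- by lra.
- by move=> k; exact: cmeas_HP.
- by split; exact: measurable_cst.
- move=> t It; have [N HN] := dil_chain fc (isT : (0 < 1)%N) It.
  by exists N => M NM; rewrite -(HN M NM) f1.
move=> k; have -> : Np 2 (fun t => 0 - HP k (conv c (dirac1 R 1)) t) =
    Np 2 (HP k (conv c (dirac1 R 1))).
  by apply: eq_integral => t _; rewrite sub0r cabsN.
rewrite Np2_HP lee_fin (le_trans (HD _ _))// ler_wpM2l//.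
apply: le_trans (l2_trunc k 1 (dirac1 R 1)).
rewrite le_eqVlt; apply/orP; left; apply/eqP; apply: Ex_eq => l lk.
congr (cabs _ ^+ 2); apply: eq_val => j /andP[j0 jk]; rewrite /trunc /dirac1.
by case: eqP => [->|_]; rewrite ?if_same.
Qed.

End Equivalence.

Unset Implicit Arguments.

Theorem theorem2 (R : realType) (f : R -> R[i]) :
  first_order_haar_chaos f -> inLp 1 f ->
  ((exists p : R, 1 < p <= 2 /\ inLp p f /\ equiv_haar p (dil f)) <->
   (inLp 2 f /\ forall p : R, 1 < p <= 2 -> equiv_haar p (dil f))).
Proof.
move=> [c fc] f1; split=> [[p [/andP[p1 p2] [_ eq_p]]]|[f2 H]]; last first.
  have h2 : 1 < (2 : R) <= 2 by apply/andP; split; lra.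
  by exists 2; split => //; split => //; exact: H.
have [c0 Bc Bd_] := Bd_of_equiv p1 fc eq_p.
(* The transfer lemmas concern exponents strictly below 2; at 2 there is nothing to transfer. *)
have to2 b : Bd p b -> Bd 2 b.
  by have [->//|pn2] := eqVneq p 2; apply: Bd_Bd2; rewrite // lt_neqAle pn2.
have Bc2 := to2 _ Bc; have Bd2 := to2 _ Bd_.
split; first exact: chaos_inL2 fc Bc2 f1.
move=> q /andP[q1 q2].
have toq b : Bd 2 b -> Bd q b.
  by have [->//|qn2] := eqVneq q 2; apply: Bd2_Bd; rewrite // lt_neqAle qn2.
by apply: (@equiv_of_Bd _ q c (cinv c)) => //; [exact: toq|exact: toq|move=> m; exact: cinvE].
Qed.
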